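(* Let $x_1^n$, $n=0,1,\dots$, be the first component of the numerical solution $X^n=(x_1^n,x_2^n)^T$ generated with time step $\Delta t$ and initial value $X^0\in\mathbb{R}^2$ by the scheme $$x_1^{n}=x_1^{n-1}-f(x_2^{n-1})\Delta t+\sigma N^{n-1}_{x_1},\qquad x_2^{n}=x_2^{n-1}+g\big(x_1^{n-1}-f(x_2^{n-1})\Delta t\big)\Delta t+\sigma N^{n-1}_{x_2}.$$ Let $\chi_1$ be the zero-mean solution on $\mathbb{T}^2=\mathbb{R}^2/\mathbb{Z}^2$ of the cell problem $\mathcal{L}\chi_1=f$, where $$\mathcal{L}=-f\,\partial_{x_1}+g\,\partial_{x_2}+\tfrac12\sigma^2\partial^2_{x_1x_1}+\tfrac12\sigma^2\partial^2_{x_2x_2}.$$ Then $$\lim_{n\to\infty}\frac{\mathbb{E}(x_1^n)^2}{n\Delta t}=\sigma^2-2\int_{\mathbb{T}^2}\chi_1 f+\mathcal{O}(\Delta t)\qquad(\Delta t\to0),$$ where the constant in $\mathcal{O}(\Delta t)$ does not depend on the computational time $T=n\Delta t$; i.e. there are constants $C,\delta>0$, independent of $n$ and $\Delta t$, such that for all $0<\Delta t<\delta$ the limit on the left exists and differs from $\sigma^2-2\int_{\mathbb{T}^2}\chi_1 f$ by at most $C\Delta t$ in absolute value.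
   Context: Let $H(x_1,x_2)=F(x_2)+G(x_1)$ be a smooth separable function (Hamiltonian) on $\mathbb{R}^2$, periodic with period $1$ in each variable. Put $f(x_1,x_2)=f(x_2)=H_{x_2}=F'(x_2)$ and $g(x_1,x_2)=g(x_1)=H_{x_1}=G'(x_1)$, and let $\sigma>0$. The scheme approximates the SDE $dx_1=-f(x_2)\,dt+\sigma\,dW_{1,t}$, $dx_2=g(x_1)\,dt+\sigma\,dW_{2,t}$ with independent Brownian motions $W_1,W_2$. All $N^{k}_{x_1},N^{k}_{x_2}$ ($k\ge0$) are i.i.d. normal random variables with mean $0$ and variance $\Delta t$. The initial value $X^0=(x_1^0,x_2^0)^T$ is deterministic. Periodic functions on $\mathbb{R}^2$ are identified with functions on $\mathbb{T}^2$; $f$ has zero mean and the cell problem has a unique smooth zero-mean solution $\chi_1$. *)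

(* Defs.v *)
From HB Require Import structures.
From mathcomp Require Import all_boot all_order all_algebra.
From mathcomp Require Import all_classical all_reals all_analysis.
Set Implicit Arguments.
Unset Strict Implicit.
Unset Printing Implicit Defensive.
Import Order.TTheory GRing.Theory Num.Theory.
Import numFieldNormedType.Exports.
Local Open Scope classical_set_scope.
Local Open Scope ring_scope.

Section plane.
Context {R : realType}.
Implicit Types (u : R * R -> R) (x : R * R).

Definition e1 : R * R := (1, 0).
Definition e2 : R * R := (0, 1).

(* The mixed partial derivative of u along the word s; [true] stands for the
   first coordinate, and the head of s is the outermost derivative. *)
Fixpoint iter_partial (s : seq bool) u : R * R -> R :=
  if s is b :: s' then 'D_(if b then e1 else e2) (iter_partial s' u) else u.

Definition smooth u : Prop := forall s : seq bool,
  [/\ continuous (iter_partial s u),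
      forall x, derivable (iter_partial s u) x e1 &
      forall x, derivable (iter_partial s u) x e2].

(* Functions on the torus R^2/Z^2 are represented by Z^2-periodic functions. *)
Definition torus_fun u : Prop := periodic u e1 /\ periodic u e2.

Definition torus_integral u : R :=
  \int[(@lebesgue_measure R \x @lebesgue_measure R)%E]_(x in
    `[0, 1[%classic `*` `[0, 1[%classic) u x.

Definition hamiltonian (F G : R -> R) : R * R -> R := fun x => F x.2 + G x.1.

Definition generator (f g : R -> R) (sigma : R) u : R * R -> R := fun x =>
  - f x.2 * 'D_e1 u x + g x.1 * 'D_e2 u x
  + 2^-1 * sigma ^+ 2 * 'D_e1 ('D_e1 u) x
  + 2^-1 * sigma ^+ 2 * 'D_e2 ('D_e2 u) x.

Definition cell_solution (f g : R -> R) (sigma : R) (chi : R * R -> R) : Prop :=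
  [/\ smooth chi, torus_fun chi, torus_integral chi = 0 &
      forall x, generator f g sigma chi x = f x.2].

Definition step (f g : R -> R) (sigma dt : R) x (xi1 xi2 : R) : R * R :=
  let y := x.1 - f x.2 * dt in
  (y + sigma * xi1, x.2 + g y * dt + sigma * xi2).

Fixpoint scheme (f g : R -> R) (sigma dt : R) (x0 : R * R) (xi1 xi2 : nat -> R)
    (n : nat) : R * R :=
  if n is k.+1
  then step f g sigma dt (scheme f g sigma dt x0 xi1 xi2 k) (xi1 k) (xi2 k)
  else x0.

End plane.

Section noise.
Context {R : realType} {d : measure_display} {T : measurableType d}.
Variable P : probability T R.

Definition mutually_independent (I : choiceType) (X : I -> {RV P >-> R}) : Prop :=
  forall (s : seq I) (B : I -> set R), uniq s ->
    (forall i, measurable (B i)) ->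
    P (\bigcap_(i in [set` s]) (X i @^-1` B i)) =
    (\prod_(i <- s) P (X i @^-1` B i))%E.

(* The second parameter of [normal_prob] is the standard deviation. *)
Definition normally_distributed (m v : R) (X : {RV P >-> R}) : Prop :=
  forall A : set R, measurable A ->
    distribution P X A = normal_prob m (Num.sqrt v) A.

Definition gaussian_noise (dt : R) (N1 N2 : nat -> {RV P >-> R}) : Prop :=
  [/\ forall k, normally_distributed 0 dt (N1 k),
      forall k, normally_distributed 0 dt (N2 k) &
      mutually_independent (fun i : nat + nat =>
        match i with inl k => N1 k | inr k => N2 k end)].

End noise.

(* Main.v *)
Require Import Defs.
From HB Require Import structures.
From mathcomp Require Import all_boot all_order all_algebra.
From mathcomp Require Import all_classical all_reals all_analysis.
From mathcomp Require Import measurable_realfun.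
From mathcomp Require Import ring lra.
Set Implicit Arguments.
Unset Strict Implicit.
Unset Printing Implicit Defensive.
Import Order.TTheory GRing.Theory Num.Theory.
Import numFieldNormedType.Exports.
Local Open Scope classical_set_scope.
Local Open Scope ring_scope.

(** One step of the scheme is [drift], a composition of two shears, followed by
    the addition of Gaussian noise of deviation s = sigma sqrt dt. Write P for
    the Markov operator [transition] of the scheme on functions of the torus,
    and f for the derivative of F, which has mean zero as a partial derivative of
    the periodic Hamiltonian ([unif_pd]). As shears and translations preserve
    area, the uniform law is invariant under P ([unif_transition]).

    Existence of the limit. The Gaussian kernel dominates a multiple of the
    uniform law ([gauss2_minorization]), so the iterates of P converge
    geometrically in the supremum norm ([iter_transition_mixing]) and the equation
    P c = c + dt f has a bounded periodic solution c ([poisson_equation]). Then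
    V = x_1 + c is a martingale along the scheme. Its increments have a
    conditional variance h that is a bounded function on the torus
    ([increment_variance]), so E V(X^n)^2 is V(x^0)^2 plus the sum of the
    P^k h(x^0) for k < n ([expect_corrected_square]), which is n times the mean of
    h up to a bounded error. Since c is bounded, E (x_1^n)^2 grows at the same rate
    ([mean_square_growth]), and the limit is the mean of h divided by dt.

    Its value. By invariance of the uniform law the mean of h is
    s^2 - 2 dt <c f> - dt^2 <f^2>, where <.> is the mean over the torus
    ([unif_increment_variance]); so the limit is sigma^2 - 2 <c f> up to order dt,
    and c has to be compared with chi_1. A Taylor expansion gives
    P chi_1 = chi_1 + dt L chi_1 + O(dt^2) ([local_error]), and L chi_1 = f, so
    e = c - chi_1 satisfies P e - e = O(dt^2).

    The contraction in the supremum norm degenerates far too fast as dt tends to 0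
    to conclude, but in mean square P has a spectral gap of order dt
    ([heat_spectral_gap]). The variance lost in one step is the mean of
    D(v) = <(phi(. + v) - phi)^2> over the difference v of two independent
    Gaussian displacements of size s. Since D(m v) <= m^2 D(v), displacements
    magnified m ~ 1 / s times account for at most m^2 times that loss, and
    they spread over the whole torus, on which D has mean 2 <phi^2>. Hence e is of
    order dt in mean square, up to its mean, and <e f> = O(dt)
    ([effective_diffusivity]).

    On the probabilistic side only the Markov property is used ([expect_step]): the
    state at time n is independent of the noise from time n on, which makes a joint
    expectation a double integral by Tonelli's theorem. *)

(** * Integrals against a probability *)

Section bounded_measurable.
Context {R : realType}.

(** Integrable against every probability, and stable under products, composition
    and integration in a parameter, so that linearity and Fubini apply to such
    functions without further conditions. *)
Definition bmeas d (X : measurableType d) (phi : X -> R) : Prop :=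
  measurable_fun setT phi /\ exists M : R, forall x, `|phi x| <= M.

Context d (X : measurableType d).
Implicit Types (phi psi : X -> R) (mu : probability X R).

Lemma bmeas_cst (c : R) : bmeas (fun _ : X => c).
Proof. by split; [exact: measurable_cst|exists `|c|]. Qed.

Lemma bmeasD phi psi : bmeas phi -> bmeas psi -> bmeas (fun x => phi x + psi x).
Proof.
move=> [mf [M fM]] [mg [N gN]]; split; first exact: measurable_funD.
by exists (M + N) => x; rewrite (le_trans (ler_normD _ _))// lerD.
Qed.

Lemma bmeasM phi psi : bmeas phi -> bmeas psi -> bmeas (fun x => phi x * psi x).
Proof.
move=> [mf [M fM]] [mg [N gN]]; split; first exact: measurable_funM.
by exists (M * N) => x; rewrite normrM ler_pM.
Qed.

Lemma bmeasZ (c : R) phi : bmeas phi -> bmeas (fun x => c * phi x).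
Proof. exact/bmeasM/bmeas_cst. Qed.

Lemma bmeasB phi psi : bmeas phi -> bmeas psi -> bmeas (fun x => phi x - psi x).
Proof.
move=> bf bg; rewrite (_ : (fun x => _) = (fun x => phi x + -1 * psi x)).
  exact/bmeasD/bmeasZ.
by apply/funext => x; rewrite mulN1r.
Qed.

Lemma bmeasX phi n : bmeas phi -> bmeas (fun x => phi x ^+ n).
Proof.
move=> bf; elim: n => [|n IH]; first by under eq_fun do rewrite expr0; exact: bmeas_cst.
by under eq_fun do rewrite exprS; exact: bmeasM.
Qed.

Lemma bmeas_comp d' (Y : measurableType d') (T : Y -> X) phi :
  bmeas phi -> measurable_fun setT T -> bmeas (fun y => phi (T y)).
Proof.
move=> [mf [M fM]] mT; split; first exact: (measurableT_comp mf mT).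
by exists M.
Qed.

Lemma bmeas_integrable mu phi : bmeas phi -> mu.-integrable setT (EFin \o phi).
Proof.
move=> [mf [M fM]]; apply: measurable_bounded_integrable => //.
  by apply: (le_lt_trans (probability_le1 mu measurableT)); rewrite ltry.
exists M; split; first exact: num_real.
by move=> x Mx y _; apply: (le_trans (fM y)); exact: ltW.
Qed.

Lemma Rintegral_prob_cst mu (c : R) : \int[mu]_x c = c.
Proof. by rewrite Rintegral_cst// [X in fine X](@probability_setT _ _ _ mu) mulr1. Qed.

Lemma bmeas_intD mu phi psi : bmeas phi -> bmeas psi ->
  \int[mu]_x (phi x + psi x) = \int[mu]_x phi x + \int[mu]_x psi x.
Proof. by move=> bf bg; rewrite RintegralD//; exact: bmeas_integrable. Qed.

Lemma bmeas_intB mu phi psi : bmeas phi -> bmeas psi ->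
  \int[mu]_x (phi x - psi x) = \int[mu]_x phi x - \int[mu]_x psi x.
Proof. by move=> bf bg; rewrite RintegralB//; exact: bmeas_integrable. Qed.

Lemma bmeas_intZ mu phi (c : R) : bmeas phi ->
  \int[mu]_x (c * phi x) = c * \int[mu]_x phi x.
Proof. by move=> bf; rewrite RintegralZl//; exact: bmeas_integrable. Qed.

Lemma bmeas_int_le mu phi psi : bmeas phi -> bmeas psi ->
  (forall x, phi x <= psi x) -> \int[mu]_x phi x <= \int[mu]_x psi x.
Proof. by move=> bf bg fg; apply: le_Rintegral => //; exact: bmeas_integrable. Qed.

Lemma bmeas_int_norm_le mu phi (M : R) : bmeas phi -> (forall x, `|phi x| <= M) ->
  `|\int[mu]_x phi x| <= M.
Proof.
move=> bf fM; rewrite ler_norml; apply/andP; split.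
- rewrite -[leLHS](Rintegral_prob_cst mu); apply: bmeas_int_le => //.
    exact: bmeas_cst.
  by move=> x; have := fM x; rewrite ler_norml => /andP[].
- rewrite -[leRHS](Rintegral_prob_cst mu); apply: bmeas_int_le => //.
    exact: bmeas_cst.
  by move=> x; have := fM x; rewrite ler_norml => /andP[].
Qed.

Lemma bmeas_int_EFin mu phi : bmeas phi ->
  (\int[mu]_x (phi x)%:E)%E = (\int[mu]_x phi x)%:E.
Proof.
by move=> bf; rewrite /Rintegral fineK//; apply/integrable_fin_num/bmeas_integrable.
Qed.

Lemma integrable_EFinZ mu phi (c : R) : mu.-integrable setT (EFin \o phi) ->
  mu.-integrable setT (EFin \o (fun x => c * phi x)).
Proof. exact: integrableZl. Qed.

Lemma integrable_EFinD mu phi psi : mu.-integrable setT (EFin \o phi) ->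
  mu.-integrable setT (EFin \o psi) ->
  mu.-integrable setT (EFin \o (fun x => phi x + psi x)).
Proof. exact: integrableD. Qed.

Lemma integrable_EFinB mu phi psi : mu.-integrable setT (EFin \o phi) ->
  mu.-integrable setT (EFin \o psi) ->
  mu.-integrable setT (EFin \o (fun x => phi x - psi x)).
Proof. exact: integrableB. Qed.

End bounded_measurable.

(** A difference of two integrals of nonnegative functions, each measurable in
    the parameter by Tonelli. *)
Lemma measurable_Rintegral {R : realType} d1 d2 (X : measurableType d1)
    (Y : measurableType d2) (nu : probability Y R) (phi : X * Y -> R) :
  measurable_fun setT phi -> measurable_fun setT (fun x => \int[nu]_y phi (x, y)).
Proof.
move=> mphi; apply: (measurableT_comp (measurable_realfun.fine_measurable measurableT)).
have mE : measurable_fun setT (EFin \o phi) by exact/measurable_EFinP.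
rewrite (_ : (fun x => _) = (fun x => \int[nu]_y (EFin \o phi)^\+ (x, y)
    - \int[nu]_y (EFin \o phi)^\- (x, y))%E); last first.
  apply/funext => x; rewrite integralE; congr (_ - _)%E; apply: eq_integral => y _.
    by rewrite !funeposE.
  by rewrite !funenegE.
apply: emeasurable_funB; apply: measurable_fun_fubini_tonelli_F => //.
- exact: measurable_funepos.
- exact: measurable_funeneg.
Qed.

(** The bound may be unbounded in the second variable: this covers a bounded
    function multiplied by Gaussian noise. *)
Section dominated_fubini.
Context {R : realType} d1 d2 (X : measurableType d1) (Y : measurableType d2).
Variables (mu : probability X R) (nu : probability Y R).
Variables (phi : X * Y -> R) (w : Y -> R).
Hypotheses (mphi : measurable_fun setT phi)
  (iw : nu.-integrable setT (EFin \o w)) (phiw : forall x y, `|phi (x, y)| <= w y).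

Lemma dominated_integrable2 : (mu \x nu)%E.-integrable setT (EFin \o phi).
Proof.
have mw := measurable_int _ iw.
apply/integrable21ltyP; first exact/measurable_EFinP.
apply: (@le_lt_trans _ _ (\int[nu]_y `|(w y)%:E|)%E); last first.
  by have /integrableP[] := iw.
apply: ge0_le_integral => //.
- move=> y _; exact: integral_ge0.
- apply: (measurable_fun_fubini_tonelli_G (abse \o (EFin \o phi))) => //.
    by apply: measurableT_comp => //; exact/measurable_EFinP.
  by move=> x; exact: abse_ge0.
- exact: measurableT_comp mw.
- move=> y _; have w0 (x : X) : 0 <= w y by exact: le_trans (normr_ge0 _) (phiw x y).
  apply: (@le_trans _ _ (\int[mu]_x (cst `|(w y)%:E| x))%E); last first.
    by rewrite integral_cst// [X in (_ * X)%E](@probability_setT _ _ _ mu) mule1.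
  apply: ge0_le_integral => //.
    apply: measurableT_comp => //; apply/measurable_EFinP.
    exact: (measurableT_comp mphi (measurable_pair2 y)).
  by move=> x _; rewrite /= lee_fin (ger0_norm (w0 x)).
Qed.

Lemma dominated_integrable1 x : nu.-integrable setT (fun y => (phi (x, y))%:E).
Proof.
apply: (le_integrable _ _ _ iw) => //.
  by apply/measurable_EFinP; exact: (measurableT_comp mphi (measurable_pair1 x)).
by move=> y _ /=; rewrite lee_fin (le_trans (phiw x y))// ler_norm.
Qed.

Lemma dominated_int1 :
  \int[(mu \x nu)%E]_z phi z = \int[mu]_x \int[nu]_y phi (x, y).
Proof.
rewrite /Rintegral -(integral12_prod_meas1 dominated_integrable2); congr fine.
apply: eq_integral => x _; rewrite /fubini_F /= fineK//.
exact/integrable_fin_num/dominated_integrable1.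
Qed.

Lemma dominated_int2 :
  \int[(mu \x nu)%E]_z phi z = \int[nu]_y \int[mu]_x phi (x, y).
Proof.
rewrite /Rintegral -(integral21_prod_meas1 dominated_integrable2); congr fine.
apply: eq_integral => y _; rewrite /fubini_G /= fineK//.
apply/integrable_fin_num => //.
have bf : bmeas (fun x => phi (x, y)).
  split; first exact: (measurableT_comp mphi (measurable_pair2 y)).
  by exists (w y).
exact: bmeas_integrable bf.
Qed.

End dominated_fubini.

Section bounded_fubini.
Context {R : realType} d1 d2 (X : measurableType d1) (Y : measurableType d2).
Variables (mu : probability X R) (nu : probability Y R).
Variables (phi : X * Y -> R).
Hypotheses (bphi : bmeas phi).

Lemma bmeas_pair1 x : bmeas (fun y => phi (x, y)).
Proof. exact/(bmeas_comp bphi)/measurable_pair1. Qed.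

Lemma bmeas_pair2 y : bmeas (fun x => phi (x, y)).
Proof. exact/(bmeas_comp bphi)/measurable_pair2. Qed.

Lemma bmeas_int : bmeas (fun x => \int[nu]_y phi (x, y)).
Proof.
have [mphi [M fM]] := bphi; split.
  exact: measurable_Rintegral.
by exists M => x; apply: bmeas_int_norm_le => //; exact: bmeas_pair1.
Qed.

Lemma bmeas_int1 : \int[(mu \x nu)%E]_z phi z = \int[mu]_x \int[nu]_y phi (x, y).
Proof.
have [mphi [M fM]] := bphi; have iM := bmeas_integrable nu (bmeas_cst Y M).
by apply: dominated_int1 mphi iM _ => *; exact: fM.
Qed.

Lemma bmeas_int2 : \int[(mu \x nu)%E]_z phi z = \int[nu]_y \int[mu]_x phi (x, y).
Proof.
have [mphi [M fM]] := bphi; have iM := bmeas_integrable nu (bmeas_cst Y M).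
by apply: dominated_int2 mphi iM _ => *; exact: fM.
Qed.

Lemma bmeas_fubini : \int[mu]_x \int[nu]_y phi (x, y) = \int[nu]_y \int[mu]_x phi (x, y).
Proof. by rewrite -bmeas_int1 bmeas_int2. Qed.

End bounded_fubini.

(** * Lebesgue measure, the Gaussian law and the circle *)

Section affine_change_of_variable.
Context {R : realType}.
Local Notation mu := (@lebesgue_measure R).
Variables (a b : R) (a_gt0 : 0 < a).

Let T : measurableTypeR R -> measurableTypeR R := fun x => a * x + b.

Let mT : measurable_fun setT T.
Proof. by apply: measurable_realfun.measurable_funD => //; exact: measurable_cst. Qed.

Let affine_measure : {measure set (measurableTypeR R) -> \bar R} :=
  measure_function_pushforward__canonical__measure_function_Measure mu mT.

(** The right-hand side is a measure in A that gives intervals their length. *)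
Lemma lebesgue_measure_affine (A : set R) : measurable A ->
  mu A = (a%:E * mu ((fun x => (a * x + b)%R) @^-1` A))%E.
Proof.
move=> mA.
apply: (@lebesgue_measure_unique R
  (mscale (NngNum (ltW a_gt0)) affine_measure)) => // _ [[c d]] _ <-.
rewrite /mscale /affine_measure /pushforward /=.
rewrite [X in (_ = _ * mu X)%E](_ : _ = `]((c - b) / a), ((d - b) / a)]%classic).
  rewrite !lebesgue_measure_itv /= !lte_fin ltr_pM2r ?invr_gt0// ltrD2r.
  case: ifPn => _; last by rewrite mule0.
  rewrite -EFinB -EFinB -EFinM; congr _%:E.
  by rewrite -mulrBl mulrCA divff ?gt_eqF// mulr1; ring.
by apply/seteqP; split => x /=; rewrite !in_itv /= ltr_pdivrMr// ler_pdivlMr// /T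
  ltrBlDr lerBrDr mulrC.
Qed.

Lemma ge0_integral_affine (f : R -> \bar R) : measurable_fun setT f ->
  (forall x, 0 <= f x)%E ->
  (\int[mu]_x f x = a%:E * \int[mu]_x f (a * x + b)%R)%E.
Proof.
move=> mf f0.
transitivity (\int[mscale (NngNum (ltW a_gt0)) affine_measure]_x f x)%E.
  apply: eq_measure_integral => A mA _; exact: lebesgue_measure_affine.
by rewrite ge0_integral_mscale//= (ge0_integral_pushforward mT).
Qed.

End affine_change_of_variable.

(** Both integrals are turned into a double integral over the region under the
    graph of f, where the density is only ever tested against indicators. *)
Lemma ge0_integral_density {R : realType} d (X : measurableType d)
    (mu nu : {sigma_finite_measure set X -> \bar R}) (p f : X -> R) :
  measurable_fun setT p -> (forall x, 0 <= p x) ->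
  (forall A, measurable A -> nu A = (\int[mu]_(x in A) (p x)%:E)%E) ->
  measurable_fun setT f -> (forall x, 0 <= f x) ->
  (\int[nu]_x (f x)%:E = \int[mu]_x (f x * p x)%:E)%E.
Proof.
move=> mp p0 nuE mf f0; pose leb := @lebesgue_measure R.
pose E : set (X * measurableTypeR R) := [set z | 0 <= z.2] `&` [set z | z.2 < f z.1].
have mE : measurable E.
  have m2 : measurable_fun setT (fun z : X * measurableTypeR R => z.2 : R).
    exact: measurable_snd.
  have m1 : measurable_fun setT (fun z : X * measurableTypeR R => f z.1).
    exact: (measurableT_comp mf measurable_fst).
  apply: measurableI.
    have := measurable_realfun.measurable_fun_ler (measurable_cst (0 : R)) m2.
    move=> /(_ measurableT [set true] I); rewrite setTI.
    by congr measurable; apply/seteqP; split => z.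
  have := measurable_realfun.measurable_fun_ltr m2 m1.
  move=> /(_ measurableT [set true] I); rewrite setTI.
  by congr measurable; apply/seteqP; split => z.
have layer x : (f x)%:E = (\int[leb]_t (\1_E (x, t))%:E)%E.
  rewrite (_ : (fun t => _) = (fun t => (\1_(`[0, f x[%classic) t)%:E)); last first.
    apply/funext => t; rewrite !indicE; congr ((nat_of_bool _)%:R%:E).
    apply/idP/idP; rewrite !inE /E /= in_itv /=; first by move=> [-> ->].
    by move/andP.
  rewrite integral_indic//= setIT lebesgue_measure_itv/= lte_fin.
  have := f0 x; rewrite le_eqVlt => /predU1P[<-|->]; first by rewrite ltxx.
  by rewrite sube0.
have mI : measurable_fun setT (fun z : X * measurableTypeR R => (\1_E z)%:E : \bar R).
  by apply/measurable_EFinP; exact: measurable_indic.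
have mpI : measurable_fun setT
    (fun z : X * measurableTypeR R => ((p z.1)%:E * (\1_E z)%:E)%E).
  by apply: emeasurable_funM => //; apply/measurable_EFinP; exact: (measurableT_comp mp measurable_fst).
under eq_integral do rewrite layer.
rewrite (fubini_tonelli (fun z => (\1_E z)%:E)) /=; [|exact: mI|by []].
transitivity (\int[leb]_t \int[mu]_x ((p x)%:E * (\1_E (x, t))%:E))%E.
  apply: eq_integral => t _.
  have mEt : measurable [set x | E (x, t)].
    have := measurable_pair2 (T2 := measurableTypeR R) t measurableT mE.
    by rewrite setTI.
  rewrite (_ : (fun x => (\1_E (x, t))%:E) = (fun x => (\1_[set x | E (x, t)] x)%:E)).
    rewrite integral_indic// setIT; apply: (etrans (nuE _ mEt)); rewrite integral_mkcond.
    apply: eq_integral => x _; rewrite patchE indicE.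
    rewrite (_ : ((x, t) \in E) = (x \in [set x | E (x, t)]))//.
    by case: ifPn => xE; rewrite ?mule1 ?mule0.
  by apply/funext => x.
rewrite -(fubini_tonelli (fun z => (p z.1)%:E * (\1_E z)%:E)%E) /=; last 2 first.
- exact: mpI.
- by move=> z; rewrite -EFinM lee_fin mulr_ge0.
- apply: eq_integral => x _; rewrite ge0_integralZl//=.
  + by rewrite -layer -EFinM mulrC.
  + apply/measurable_EFinP; exact: (measurableT_comp (measurable_realfun.measurable_indic mE) (measurable_pair1 x)).
  + by rewrite lee_fin.
Qed.

Section gaussian_law.
Context {R : realType}.
Local Notation mu := (@lebesgue_measure R).
Local Notation gauss := (normal_prob (0 : R) (1 : R)).
Implicit Types f phi : R -> R.

(** Separates the dependence on s from the normalization constant, which drops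
    out of every comparison of two Gaussian densities. *)
Lemma normal_pdf0E (s x : R) : 0 < s ->
  normal_pdf 0 s x = s^-1 * normal_peak 1 * expR (- x ^+ 2 / (s ^+ 2 *+ 2)).
Proof.
move=> s0; rewrite normal_pdfE ?gt_eqF// /normal_fun subr0; congr (_ * _).
rewrite /normal_peak expr1n mul1r -mulrnAr sqrtrM ?sqr_ge0// invfM.
by rewrite sqrtr_sqr gtr0_norm.
Qed.

Lemma ge0_integral_normal_prob (s : R) f : measurable_fun setT f ->
  (forall x, 0 <= f x) ->
  (\int[normal_prob (0 : R) s]_x (f x)%:E = \int[mu]_x (f x * normal_pdf 0 s x)%:E)%E.
Proof.
move=> mf f0; apply: ge0_integral_density => //.
- exact: measurable_normal_pdf.
- by move=> x; exact: normal_pdf_ge0.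
Qed.

(** Expresses the noise by a standard Gaussian whatever the time step. *)
Lemma integral_normal_scale (s : R) f : 0 < s -> measurable_fun setT f ->
  (forall x, 0 <= f x) ->
  (\int[normal_prob (0 : R) s]_x (f x)%:E = \int[gauss]_x (f (s * x)%R)%:E)%E.
Proof.
move=> s0 mf f0; have mp := @measurable_normal_pdf R 0.
have mfs : measurable_fun setT (fun x => f (s * x)).
  by apply: (measurableT_comp mf); exact: measurable_realfun.mulrl_measurable.
rewrite (ge0_integral_normal_prob s mf f0).
rewrite (ge0_integral_normal_prob 1 mfs (fun x => f0 (s * x))).
rewrite (ge0_integral_affine 0 s0); last 2 first.
  by apply/measurable_EFinP; exact: measurable_realfun.measurable_funM.
  by move=> x; rewrite lee_fin mulr_ge0// normal_pdf_ge0.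
have mg : measurable_fun setT (fun x => f (s * x) * normal_pdf 0 s (s * x)).
  apply: measurable_realfun.measurable_funM => //.
  by apply: (measurableT_comp (mp s)); exact: measurable_realfun.mulrl_measurable.
under eq_integral do rewrite addr0.
rewrite -ge0_integralZl//=; last 3 first.
  exact/measurable_EFinP.
  by move=> x _; rewrite lee_fin mulr_ge0// normal_pdf_ge0.
  by rewrite lee_fin ltW.
apply: eq_integral => x _; rewrite -EFinM; congr _%:E.
rewrite !normal_pdf0E// invr1 mul1r mulrCA; congr (_ * _).
rewrite -!mulrA mulVKf ?gt_eqF//; congr (_ * expR _).
rewrite expr1n exprMn -mulr_natr -[(1 *+ 2)]mulr_natr mul1r; field.
by rewrite gt_eqF.
Qed.

(** Multiplied by the standard density the integrand becomes t times the density
    of deviation t. This integral is the source of all the moments below. *)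
Lemma gauss_int_exp (t : R) : 0 < t ->
  (\int[gauss]_x (expR ((1 - t ^- 2) / 2 * x ^+ 2))%:E = t%:E)%E.
Proof.
move=> t0; have me : measurable_fun setT (fun x : R => expR ((1 - t ^- 2) / 2 * x ^+ 2)).
  apply: measurableT_comp => //; apply: measurable_realfun.measurable_funM => //.
rewrite (ge0_integral_normal_prob 1 me (fun x => expR_ge0 _)).
transitivity (\int[mu]_x (t%:E * (normal_pdf 0 t x)%:E))%E; last first.
  rewrite ge0_integralZl//=; first by rewrite integral_normal_pdf mule1.
    by apply/measurable_EFinP; exact: measurable_normal_pdf.
    by move=> x _; rewrite lee_fin normal_pdf_ge0.
  by rewrite lee_fin ltW.
apply: eq_integral => x _; rewrite -EFinM; congr _%:E.
rewrite !normal_pdf0E// invr1 mul1r -!mulrA mulVKf ?gt_eqF//.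
rewrite mulrCA -expRD; congr (_ * expR _).
rewrite expr1n -mulr_natr -[(1 *+ 2)]mulr_natr mul1r; field.
by rewrite gt_eqF.
Qed.

(** The exponential of (1 - 1/4) x^2 / 2 is integrable by [gauss_int_exp] at t = 2
    and dominates the fourth power. *)
Lemma gauss_integrable phi (C : R) : measurable_fun setT phi ->
  (forall x, `|phi x| <= C * (1 + x ^+ 4)) -> gauss.-integrable setT (EFin \o phi).
Proof.
move=> mphi phiC; pose e (x : R) := expR ((1 - 2 ^- 2) / 2 * x ^+ 2).
have me : measurable_fun setT e.
  by apply: measurableT_comp => //; apply: measurable_realfun.measurable_funM.
have C0 : 0 <= C by have := le_trans (normr_ge0 _) (phiC 0); rewrite expr0n addr0 mulr1.
have ie : gauss.-integrable setT (EFin \o (fun x => C * (128 / 9) * e x)).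
  apply/integrableP; split; first by apply/measurable_EFinP; exact: measurable_realfun.measurable_funM.
  under eq_integral => x _ do rewrite /= ger0_norm ?mulr_ge0 ?expR_ge0 ?divr_ge0// EFinM.
  rewrite ge0_integralZl//=; first by rewrite gauss_int_exp// -EFinM ltry.
    exact/measurable_EFinP.
    by move=> x _; rewrite lee_fin expR_ge0.
  by rewrite lee_fin mulr_ge0// divr_ge0.
apply: (le_integrable _ _ _ ie) => //; first exact/measurable_EFinP.
move=> x _ /=; rewrite lee_fin (le_trans (phiC x))//.
rewrite ger0_norm ?mulr_ge0 ?expR_ge0 ?divr_ge0// -mulrA ler_wpM2l//.
have u0 : 0 <= (1 - 2 ^- 2) / 2 * x ^+ 2.
  by rewrite mulr_ge0 ?sqr_ge0// divr_ge0// subr_ge0 invf_le1// ?exprn_gt0// exprn_ege1// ler1n.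
have := expR_ge1Dxn 1 u0; rewrite -/(e x) => h.
have -> : x ^+ 4 = (x ^+ 2) ^+ 2 by rewrite -exprM.
have := sqr_ge0 x; move: h; set y := x ^+ 2 => h y0.
(* (3/8)^2 / 2 = 9/128 is the coefficient of y^2 in the series of exp (3 y / 8). *)
have : 1 + 9 / 128 * y ^+ 2 <= e x.
  by apply: le_trans h; rewrite le_eqVlt; apply/orP; left; apply/eqP; rewrite (_ : 2`! = 2)%N//; field.
lra.
Qed.

End gaussian_law.

Lemma le_of_le_eps {R : realType} (x y K : R) :
  (forall e : R, 0 < e -> e <= 2^-1 -> x <= y + e * K) -> x <= y.
Proof.
move=> h; apply/ler_addgt0Pr => e e0.
have K0 : 0 < `|K| + 1 by rewrite ltr_wpDl.
have h1 : e / (`|K| + 1) * K <= e.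
  by have := ler_norm K; rewrite mulrAC ler_pdivrMr// ler_pM2l//; lra.
have [h3|h3] := leP (e / (`|K| + 1)) 2^-1.
  by apply: (le_trans (h _ _ h3)); [rewrite divr_gt0|rewrite lerD2l].
have half0 : 0 < 2^-1 :> R by lra.
apply: (le_trans (h 2^-1 half0 (lexx _))).
rewrite lerD2l; move: h3; rewrite ltr_pdivlMr// => h3.
by have := ler_norm K; lra.
Qed.

Section gaussian_moments.
Context {R : realType}.
Local Notation mu := (@lebesgue_measure R).
Local Notation gauss := (normal_prob (0 : R) (1 : R)).
Implicit Types f phi : R -> R.

Lemma ge0_gauss_intN f : measurable_fun setT f -> (forall x, 0 <= f x) ->
  (\int[gauss]_x (f (- x)%R)%:E = \int[gauss]_x (f x)%:E)%E.
Proof.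
move=> mf f0; have mp := @measurable_normal_pdf R 0 1.
rewrite !ge0_integral_normal_prob//; last exact: (measurableT_comp mf).
have mN : measurable_fun setT (-%R : measurableTypeR R -> measurableTypeR R) by [].
pose nu : {measure set (measurableTypeR R) -> \bar R} :=
  measure_function_pushforward__canonical__measure_function_Measure mu mN.
transitivity (\int[nu]_x (f x * normal_pdf 0 1 x)%:E)%E; last first.
  by apply: eq_measure_integral => A mA _; exact: lebesgue_measureN.
have mE : measurable_fun setT (fun x => (f x * normal_pdf 0 1 x)%:E).
  by apply/measurable_EFinP; exact: measurable_realfun.measurable_funM.
have E0 : {in setT, forall x, (0 <= (f x * normal_pdf 0 1 x)%:E)%E}.
  by move=> x _; rewrite lee_fin mulr_ge0// normal_pdf_ge0.
apply/esym/(etrans (ge0_integral_pushforward mN mu measurableT mE E0)).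
by apply: eq_integral => x _; rewrite /= !normal_pdf0E// sqrrN.
Qed.

Lemma gauss_intN phi : measurable_fun setT phi ->
  gauss.-integrable setT (EFin \o (fun x => phi (- x))) ->
  \int[gauss]_x phi (- x) = \int[gauss]_x phi x.
Proof.
move=> mphi iphi.
have mN : measurable_fun setT (-%R : measurableTypeR R -> measurableTypeR R) by [].
pose nu : {measure set (measurableTypeR R) -> \bar R} :=
  measure_function_pushforward__canonical__measure_function_Measure gauss mN.
congr fine; transitivity (\int[nu]_x (phi x)%:E)%E.
  rewrite integral_pushforward//; exact/measurable_EFinP.
apply: eq_measure_integral => A mA _.
transitivity (\int[gauss]_x (\1_A (- x)%R)%:E)%E; last first.
  rewrite (@ge0_gauss_intN \1_A); [|exact: measurable_realfun.measurable_indic|by []].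
  by rewrite integral_indic// setIT.
rewrite (_ : (fun x => _) = (fun x => (\1_(-%R @^-1` A) x)%:E)).
  rewrite integral_indic ?setIT//.
  by have := mN measurableT A mA; rewrite setTI.
by apply/funext.
Qed.

Lemma gauss_integrable_id : gauss.-integrable setT (EFin \o (fun x : R => x)).
Proof.
apply: (@gauss_integrable _ _ 1) => // x; rewrite mul1r.
have [h|h] := leP `|x| 1; first by rewrite (le_trans h)// lerDl exprn_even_ge0.
rewrite ler_wpDl// -(ger0_norm (exprn_even_ge0 x (isT : ~~ odd 4))) normrX.
by rewrite exprS ler_peMr// exprn_ege1// ltW.
Qed.

Lemma gauss_int_id : \int[gauss]_x (x : R) = 0.
Proof.
have i1 := gauss_integrable_id.
have iN : gauss.-integrable setT (EFin \o (fun x : R => - x)).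
  rewrite (_ : (EFin \o _) = (fun x => -%E ((EFin \o (fun x : R => x)) x)))//.
  exact: integrableN.
have h1 : \int[gauss]_x (- (x : R)) = \int[gauss]_x (x : R).
  exact: (@gauss_intN (fun x => x)).
have h2 : \int[gauss]_x (-1 * (x : R)) = -1 * \int[gauss]_x (x : R) by rewrite RintegralZl.
have h3 : \int[gauss]_x (-1 * (x : R)) = \int[gauss]_x (- (x : R)).
  by apply: eq_Rintegral => x _; rewrite mulN1r.
by move: h2; rewrite h3 h1; move: (Rintegral _ _ _) => a; clear; lra.
Qed.

Lemma gauss_integrable_sqr : gauss.-integrable setT (EFin \o (fun x : R => x ^+ 2)).
Proof.
apply: (@gauss_integrable _ _ 1) => // x; rewrite mul1r ger0_norm ?sqr_ge0//.
have -> : x ^+ 4 = (x ^+ 2) ^+ 2 by rewrite -exprM.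
nra.
Qed.

Lemma gauss_integrable_pow4 : gauss.-integrable setT (EFin \o (fun x : R => x ^+ 4)).
Proof.
apply: (@gauss_integrable _ _ 1) => // x.
by rewrite mul1r ger0_norm ?exprn_even_ge0// lerDr.
Qed.

Definition gauss_pow4 : R := \int[gauss]_x (x ^+ 4).

Lemma gauss_pow4_ge0 : 0 <= gauss_pow4.
Proof. by apply: Rintegral_ge0 => x _; exact: exprn_even_ge0. Qed.

(** Expanding the exact value t of the integral of exp (- h x ^ 2), where
    1 + 2 h = t ^ -2, to first order in h as t tends to 1 from below. *)
Lemma gauss_int_sqr : \int[gauss]_x (x ^+ 2) = 1.
Proof.
set m2 := \int[gauss]_x _; have m40 := gauss_pow4_ge0.
have m20 : 0 <= m2 by apply: Rintegral_ge0 => x _; exact: sqr_ge0.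
have key (t : R) : 0 < t -> t < 1 -> let h := (t ^- 2 - 1) / 2 in
    0 <= t - 1 + h * m2 /\ t - 1 + h * m2 <= h ^+ 2 * gauss_pow4.
  move=> t0 t1 h.
  have h0 : 0 <= h.
    by rewrite divr_ge0// subr_ge0 invf_ge1// ?exprn_gt0// exprn_ile1// ltW.
  pose e (x : R) := expR (- (h * x ^+ 2)).
  have eE x : e x = expR ((1 - t ^- 2) / 2 * x ^+ 2) by congr expR; rewrite /h; ring.
  have u0 x : 0 <= h * x ^+ 2 by rewrite mulr_ge0// sqr_ge0.
  have elb x : 1 - h * x ^+ 2 <= e x by exact: expR_ge1Dx.
  have eub x : e x <= 1 - h * x ^+ 2 + h ^+ 2 * x ^+ 4.
    rewrite /e expRN; apply: (@le_trans _ _ (1 + h * x ^+ 2)^-1).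
      rewrite lef_pV2 ?posrE ?expR_gt0 ?expR_ge1Dx//.
      by have := u0 x; lra.
    have -> : h ^+ 2 * x ^+ 4 = (h * x ^+ 2) ^+ 2 by ring.
    have := u0 x; move: (h * _) => u {}u0.
    rewrite -div1r ler_pdivrMr; last by lra.
    by have := mulr_ge0 u0 (mulr_ge0 u0 u0); rewrite expr2 => ?; lra.
  have be : bmeas e.
    split; last by exists 1 => x; rewrite ger0_norm ?expR_ge0// -expR0 ler_expR oppr_le0.
    rewrite (funext eE); apply: measurableT_comp => //.
    exact: measurable_realfun.measurable_funM.
  have Ie : \int[gauss]_x e x = t.
    rewrite /Rintegral (_ : (fun x => _) = (fun x =>
      (expR ((1 - t ^- 2) / 2 * x ^+ 2))%:E)) ?gauss_int_exp//.
    by apply/funext => x; rewrite eE.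
  have i2 := gauss_integrable_sqr; have i4 := gauss_integrable_pow4.
  have ie := bmeas_integrable gauss be.
  have i1 := bmeas_integrable gauss (bmeas_cst _ (1 : R)).
  have ih2 := integrable_EFinZ h i2.
  have ih4 := integrable_EFinZ (h ^+ 2) i4.
  have i12 := integrable_EFinB i1 ih2.
  have I12 : \int[gauss]_x (1 - h * x ^+ 2) = 1 - h * m2.
    by rewrite RintegralB// RintegralZl// Rintegral_prob_cst.
  have lb : 1 - h * m2 <= t by rewrite -I12 -Ie; exact: le_Rintegral.
  have ub : t <= 1 - h * m2 + h ^+ 2 * gauss_pow4.
    rewrite -I12 -Ie -RintegralZl// -RintegralD//.
    apply: le_Rintegral => //; exact: integrable_EFinD i12 ih4.
  by split; lra.
(* Take t = 1 - e and cancel a factor e, which is the order of h. *)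
have {}key (e : R) : 0 < e -> e <= 2^-1 ->
    2 - 4 * e <= m2 * (2 - e) /\ m2 * (2 - e) <= 2 + e * (8 * gauss_pow4).
  move=> e0 e1; have t0 : 0 < 1 - e by lra.
  have t1 : 1 - e < 1 by lra.
  have [] := key _ t0 t1; set h := (_ - 1) / 2.
  have hE : 2 * (1 - e) ^+ 2 * h = e * (2 - e).
    by rewrite /h; field; rewrite gt_eqF.
  have tt : 0 < 2 * (1 - e) ^+ 2 by rewrite mulr_gt0// exprn_gt0.
  have E1 : 2 * (1 - e) ^+ 2 * (1 - e - 1 + h * m2) =
      e * (m2 * (2 - e) - 2 * (1 - e) ^+ 2).
    transitivity (2 * (1 - e) ^+ 2 * h * m2 - 2 * (1 - e) ^+ 2 * e); first by ring.
    by rewrite hE; ring.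
  have E2 : 2 * (1 - e) ^+ 2 * (h ^+ 2 * gauss_pow4) = e * ((2 - e) * (h * gauss_pow4)).
    transitivity (2 * (1 - e) ^+ 2 * h * (h * gauss_pow4)); first by ring.
    by rewrite hE; ring.
  move=> k1 k2; split.
    move: k1; rewrite -(pmulr_rge0 _ tt) E1 pmulr_rge0// subr_ge0 => h1.
    apply: le_trans h1; nra.
  move: k2; rewrite -(ler_pM2l tt) E1 E2 ler_pM2l// => h1.
  have hb : h <= 4 * e.
    rewrite -(ler_pM2l tt) hE.
    have : 4^-1 <= (1 - e) ^+ 2 by nra.
    nra.
  have h0 : 0 <= h by rewrite -(pmulr_rge0 _ tt) hE mulr_ge0//; lra.
  have h2 : (2 - e) * (h * gauss_pow4) <= 2 * (4 * e * gauss_pow4).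
    apply: ler_pM => //; [lra|exact: mulr_ge0|lra|exact: ler_wpM2r].
  have : (1 - e) ^+ 2 <= 1 by nra.
  lra.
apply/eqP; rewrite eq_le; apply/andP; split.
  apply: (@le_of_le_eps _ _ _ (4 * gauss_pow4 + m2)) => e e0 e1.
  have [_ h] := key e e0 e1; nra.
apply: (@le_of_le_eps _ _ _ 2) => e e0 e1.
have [h _] := key e e0 e1; nra.
Qed.

End gaussian_moments.

Section circle.
Context {R : realType}.
Local Notation mu := (@lebesgue_measure R).
Local Notation gauss := (normal_prob (0 : R) (1 : R)).
Local Notation circ := (uniform_prob (@ltr01 R)).

Lemma ge0_integral_itv_shift (f : R -> \bar R) (c e t : R) : measurable_fun setT f ->
  (forall x, 0 <= f x)%E ->
  (\int[mu]_(x in `[(c + t)%R, (e + t)%R[) f x = \int[mu]_(x in `[c, e[) f (x + t)%R)%E.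
Proof.
move=> mf f0; rewrite integral_mkcond (ge0_integral_affine t (@ltr01 R)) ?mul1e.
- rewrite [RHS]integral_mkcond; apply: eq_integral => x _; rewrite mul1r !patchE.
  rewrite (_ : (x + t \in _) = (x \in `[c, e[%classic))//.
  by apply/idP/idP; rewrite !inE /= !in_itv /= lerD2r ltrD2r.
- by apply/(measurable_restrictT _ _).1; [exact: measurable_itv|exact: measurable_funTS].
- by move=> x; rewrite patchE; case: ifP.
Qed.

Lemma ge0_integral_circ (f : R -> \bar R) : measurable_fun setT f ->
  (forall x, 0 <= f x)%E ->
  (\int[circ]_x f x = \int[mu]_(x in `[0%R, 1%R[) f x)%E.
Proof.
move=> mf f0.
rewrite integral_uniform// subr0 invr1 mul1e integral_itv_bndo_bndc//.
exact: measurable_funTS.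
Qed.

Section periodic_integral.
Variable f : R -> R.
Hypotheses (mf : measurable_fun setT f) (f0 : forall x, 0 <= f x)
  (fper : periodic f 1).

Let J c := (\int[mu]_(x in `[c, (c + 1)%R[) (f x)%:E)%E.

Let mE : measurable_fun setT (EFin \o f). Proof. exact/measurable_EFinP. Qed.

Let f0E x : (0 <= (f x)%:E)%E. Proof. by rewrite lee_fin. Qed.

Let split_itv (a b c : R) : a <= b -> b <= c ->
  (\int[mu]_(x in `[a, c[) (f x)%:E =
   \int[mu]_(x in `[a, b[) (f x)%:E + \int[mu]_(x in `[b, c[) (f x)%:E)%E.
Proof.
move=> ab bc; rewrite (@itv_bndbnd_setU _ _ _ (BLeft b)) ?bnd_simp//.
rewrite ge0_integral_setU//=.
- exact: measurable_funTS.
- apply/disj_setPS => x /= []; rewrite !in_itv /= => /andP[_ xb] /andP[bx _].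
  by move: (lt_le_trans xb bx); rewrite ltxx.
Qed.

(** Shifting a window of length one by at most one moves a piece of it by a
    whole period. *)
Let J_step (c t : R) : 0 <= t <= 1 -> J (c + t) = J c.
Proof.
move=> /andP[t0 t1]; rewrite /J (@split_itv (c + t) (c + 1)); last 2 first.
  by rewrite lerD2l.
  by rewrite lerD2r lerDl.
rewrite (_ : c + t + 1 = c + t + 1)// (_ : `[c + 1, c + t + 1[ = `[c + 1, (c + t) + 1[)//.
rewrite (ge0_integral_itv_shift c (c + t) 1)//.
rewrite [in RHS](@split_itv c (c + t)) ?lerDl ?lerD2l// addeC; congr (_ + _)%E.
by apply: eq_integral => x _; rewrite fper.
Qed.

Let J_ge0 (c t : R) : 0 <= t -> J (c + t) = J c.
Proof.
move=> t0; pose n := (Num.bound t).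
have tn : t / n%:R <= 1.
  have := archi_boundP t0; rewrite -/n => tn.
  by rewrite ler_pdivrMr ?mul1r ?ltW// (le_lt_trans t0).
have n0 : (n%:R : R) != 0.
  by rewrite gt_eqF// (le_lt_trans t0)//; exact: archi_boundP.
have E k : J (c + k%:R * (t / n%:R)) = J c.
  elim: k => [|k IH]; first by rewrite mul0r addr0.
  rewrite -natr1 mulrDl mul1r addrA J_step// tn andbT divr_ge0//.
by have := E n; rewrite mulrC divfK.
Qed.

Lemma ge0_integral_period (c : R) :
  (\int[mu]_(x in `[c, (c + 1)%R[) (f x)%:E = \int[circ]_x (f x)%:E)%E.
Proof.
rewrite ge0_integral_circ//; have JE : J 0 = (\int[mu]_(x in `[0%R, 1%R[) (f x)%:E)%E.
  by rewrite /J add0r.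
rewrite -JE -/(J c); have [c0|c0] := leP 0 c; first by rewrite -{1}(add0r c) J_ge0.
have c0' : 0 <= - c by rewrite oppr_ge0 ltW.
by rewrite -(J_ge0 c c0') subrr.
Qed.

Lemma ge0_circ_translate (c : R) :
  (\int[circ]_x (f (x + c)%R)%:E = \int[circ]_x (f x)%:E)%E.
Proof.
rewrite -(ge0_integral_period c) [in RHS]addrC -{2}(add0r c).
rewrite (ge0_integral_itv_shift 0 1 c)// ge0_integral_circ//.
apply/measurable_EFinP.
by apply: (measurableT_comp mf); apply: measurable_realfun.measurable_funD.
Qed.

End periodic_integral.

Lemma circ_translate (f : R -> R) (c : R) : bmeas f -> periodic f 1 ->
  \int[circ]_x f (x + c) = \int[circ]_x f x.
Proof.
move=> bf fper; have [mf [M fM]] := bf.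
have mc : measurable_fun setT (fun x : R => x + c).
  exact: measurable_realfun.measurable_funD.
(* Adding the bound M makes f nonnegative. *)
have bM := @bmeas_cst R _ (measurableTypeR R) M.
have bMf : bmeas (fun x => M + f x) by exact: bmeasD.
have h : \int[circ]_x (M + f (x + c)) = \int[circ]_x (M + f x).
  { congr fine; apply: (@ge0_circ_translate (fun x => M + f x)).
  + by case: bMf.
  + by move=> x; have := fM x; rewrite ler_norml => /andP[h _]; rewrite -lerBlDl sub0r.
  + by move=> x; rewrite fper. }
move: h; rewrite !bmeas_intD// ?Rintegral_prob_cst; first by move/addrI.
exact: bmeas_comp bf mc.
Qed.

(** Density that the Gaussian law of deviation r, wrapped around the circle of
    length one, has at least everywhere. *)
Definition gauss_minor (r : R) : R := normal_pdf 0 1 r^-1 / r.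

Lemma gauss_minor_gt0 (r : R) : 0 < r -> 0 < gauss_minor r.
Proof.
move=> r0; rewrite divr_gt0// normal_pdf0E// invr1 mul1r.
by rewrite mulr_gt0 ?expR_gt0 ?normal_peak_gt0.
Qed.

(** On the interval of length 1 / r that the map z |-> v + r z wraps once
    around the circle the Gaussian density is at least its value at 1 / r. *)
Lemma gauss_minorization (f : R -> R) (v r : R) : 0 < r -> bmeas f ->
  (forall x, 0 <= f x) -> periodic f 1 ->
  gauss_minor r * \int[circ]_x f x <= \int[gauss]_z f (v + r * z).
Proof.
move=> r0 bf f0 fper; have [mf _] := bf.
have mz : measurable_fun setT (fun z : R => v + r * z).
  exact: measurable_realfun.measurable_funD.
have bfz : bmeas (fun z => f (v + r * z)) by exact: (bmeas_comp bf mz).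
rewrite -lee_fin EFinM -!bmeas_int_EFin// ge0_integral_normal_prob//; last by case: bfz.
pose fr := (fun x => (f x)%:E) \_ `[v, v + 1[%classic.
have mfr : measurable_fun setT fr.
  apply/(measurable_restrictT _ _).1; first exact: measurable_itv.
  by apply: measurable_funTS; exact/measurable_EFinP.
have fr0 x : (0 <= fr x)%E by rewrite /fr patchE; case: ifP; rewrite ?lee_fin.
have -> : (\int[circ]_x (f x)%:E = r%:E * \int[mu]_x fr (r * x + v)%R)%E.
  by rewrite -(ge0_integral_period mf f0 fper v) integral_mkcond; exact: ge0_integral_affine.
have mfrz : measurable_fun setT (fun x => fr (r * x + v)).
  apply: (measurableT_comp mfr).
  exact: measurable_realfun.measurable_funD.
rewrite muleA -EFinM /gauss_minor divfK ?gt_eqF// -ge0_integralZl//=; last first.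
  by rewrite lee_fin normal_pdf_ge0.
apply: ge0_le_integral => //=.
- by move=> x _; rewrite mule_ge0 ?lee_fin ?normal_pdf_ge0.
- exact: emeasurable_funM.
- apply/measurable_EFinP; apply: measurable_realfun.measurable_funM; first by case: bfz.
  exact: measurable_normal_pdf.
- move=> x _; rewrite /fr patchE; case: ifPn => [|_]; last first.
    by rewrite mule0 lee_fin mulr_ge0// normal_pdf_ge0.
rewrite inE /= in_itv /= lerDr addrC ltrD2l pmulr_rge0// => /andP[x0 rx].
rewrite [v + _]addrC -EFinM lee_fin mulrC ler_wpM2l// !normal_pdf0E//.
rewrite ler_wpM2l ?mulr_ge0 ?invr_ge0 ?normal_peak_ge0// ler_expR.
rewrite !mulNr lerN2 ler_wpM2r ?invr_ge0// ler_pXn2r ?nnegrE ?invr_ge0 ?(ltW r0)//.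
by apply/ltW; rewrite -(ltr_pM2l r0) mulfV ?gt_eqF.
Qed.

End circle.

(** * The torus *)

Section torus.
Context {R : realType}.
Local Notation mu := (@lebesgue_measure R).
Local Notation gauss := (normal_prob (0 : R) (1 : R)).
Local Notation circ := (uniform_prob (@ltr01 R)).
Local Notation unif := (circ \x circ)%E.
Local Notation gauss2 := (gauss \x gauss)%E.
Implicit Types (phi psi : R * R -> R) (v x z : R * R).

Definition tfun phi : Prop := bmeas phi /\ torus_fun phi.

Definition scal (r : R) z : R * R := (r * z.1, r * z.2).

Lemma measurable_fun_pairD d (X : measurableType d) (a b : X -> R * R) :
  measurable_fun setT a -> measurable_fun setT b ->
  measurable_fun setT (fun p => a p + b p).
Proof.
move=> ma mb; apply: (measurable_fun_pair (f := fun p => (a p).1 + (b p).1)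
  (g := fun p => (a p).2 + (b p).2)).
- apply: measurable_realfun.measurable_funD.
    exact: (measurableT_comp measurable_fst ma).
  exact: (measurableT_comp measurable_fst mb).
- apply: measurable_realfun.measurable_funD.
    exact: (measurableT_comp measurable_snd ma).
  exact: (measurableT_comp measurable_snd mb).
Qed.

Lemma measurable_fun_scal d (X : measurableType d) (r : R) (a : X -> R * R) :
  measurable_fun setT a -> measurable_fun setT (fun p => scal r (a p)).
Proof.
move=> ma; apply: measurable_fun_pair.
- apply: measurable_realfun.measurable_funM => //.
  exact: (measurableT_comp measurable_fst ma).
- apply: measurable_realfun.measurable_funM => //.
  exact: (measurableT_comp measurable_snd ma).
Qed.

Lemma torus_fun_add1 phi (a b : R) : torus_fun phi -> phi (a + 1, b) = phi (a, b).
Proof. by move=> [p1 _]; rewrite -(p1 (a, b)) /e1 /GRing.add /= /add_pair /= addr0. Qed.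

Lemma torus_fun_add2 phi (a b : R) : torus_fun phi -> phi (a, b + 1) = phi (a, b).
Proof. by move=> [_ p2]; rewrite -(p2 (a, b)) /e2 /GRing.add /= /add_pair /= addr0. Qed.

Lemma torus_fun_translate phi v : torus_fun phi -> torus_fun (fun x => phi (x + v)).
Proof. by move=> [p1 p2]; split=> x; rewrite addrAC ?p1 ?p2. Qed.

Lemma tfun_translate phi v : tfun phi -> tfun (fun x => phi (x + v)).
Proof.
move=> [bf tf]; split; last exact: torus_fun_translate.
by apply: (bmeas_comp bf); apply: measurable_fun_pairD => //; exact: measurable_cst.
Qed.

Lemma tfun_cst (c : R) : tfun (fun=> c).
Proof. by split; [exact: bmeas_cst|split]. Qed.

Lemma tfunD phi psi : tfun phi -> tfun psi -> tfun (fun x => phi x + psi x).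
Proof.
move=> [bf [f1 f2]] [bg [g1 g2]]; split; first exact: bmeasD.
by split=> x; rewrite ?f1 ?f2 ?g1 ?g2.
Qed.

Lemma tfunM phi psi : tfun phi -> tfun psi -> tfun (fun x => phi x * psi x).
Proof.
move=> [bf [f1 f2]] [bg [g1 g2]]; split; first exact: bmeasM.
by split=> x; rewrite ?f1 ?f2 ?g1 ?g2.
Qed.

Lemma tfunZ (c : R) phi : tfun phi -> tfun (fun x => c * phi x).
Proof. exact/tfunM/tfun_cst. Qed.

Lemma tfunB phi psi : tfun phi -> tfun psi -> tfun (fun x => phi x - psi x).
Proof.
move=> [bf [f1 f2]] [bg [g1 g2]]; split; first exact: bmeasB.
by split=> x; rewrite ?f1 ?f2 ?g1 ?g2.
Qed.

Lemma tfunX phi n : tfun phi -> tfun (fun x => phi x ^+ n).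
Proof.
move=> [bf [f1 f2]]; split; first exact: bmeasX.
by split=> x; rewrite ?f1 ?f2.
Qed.

(** Writing the mean over the torus as an integral against a product of two
    probabilities makes the Gaussian and the torus variables exchangeable. *)
Lemma torus_integralE phi : bmeas phi -> torus_integral phi = \int[unif]_x phi x.
Proof.
move=> bf; have [mf [M fM]] := bf.
pose I1 : set R := `[0, 1[%classic; pose D := I1 `*` I1.
have mI : measurable I1 by exact: measurable_itv.
have mD : measurable D by apply: measurableX.
have DD : ((mu \x mu) D = 1)%E.
  have muI : (mu I1 = 1)%E.
    by rewrite /I1 lebesgue_measure_itv /= lte_fin ltr01 oppr0 adde0.
  by rewrite product_measure1E// [X in (X * _)%E]muI [X in (_ * X)%E]muI mule1.
have ge0E psi : bmeas psi -> (forall x, 0 <= psi x) ->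
    (\int[(mu \x mu)%E]_(x in D) (psi x)%:E = \int[unif]_x (psi x)%:E)%E.
  move=> [mp _] p0; have mE : measurable_fun setT (EFin \o psi) by exact/measurable_EFinP.
  have fub : (\int[circ]_x \int[circ]_y (psi (x, y))%:E = \int[unif]_x (psi x)%:E)%E.
    by rewrite (@fubini_tonelli1 _ _ _ _ _ circ circ (EFin \o psi)).
  rewrite -fub integral_mkcond fubini_tonelli1//; last 2 first.
    by apply/(measurable_restrictT _ _).1 => //; exact: measurable_funTS.
    by move=> x; rewrite patchE; case: ifP => // _; rewrite lee_fin.
  rewrite ge0_integral_circ; last 2 first.
    by apply: (@measurable_fun_fubini_tonelli_F _ _ _ _ _ circ (EFin \o psi)).
    by move=> x; apply: integral_ge0 => y _; rewrite lee_fin.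
  rewrite [RHS]integral_mkcond; apply: eq_integral => x _.
  rewrite /fubini_F patchE; case: ifPn => xI.
    rewrite ge0_integral_circ; last 2 first.
      by apply: (measurableT_comp mE); exact: measurable_pair1.
      by move=> y; rewrite lee_fin.
    rewrite [RHS]integral_mkcond; apply: eq_integral => y _; rewrite !patchE.
    rewrite (_ : ((x, y) \in D) = (y \in I1))//.
    by apply/idP/idP; rewrite !inE /D /=; [case|move=> ?; split => //; rewrite inE in xI].
  rewrite integral0_eq// => y _; rewrite patchE ifN//.
  by apply: contra xI; rewrite !inE /D /= => -[].
(* Adding the bound M reduces to nonnegative functions, where Tonelli applies. *)
have bM := bmeas_cst (R * R)%type M; have bMf := bmeasD bM bf.
have Mf0 x : 0 <= M + phi x.
  by have := fM x; rewrite ler_norml => /andP[h _]; rewrite -lerBlDl sub0r.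
have h : \int[(mu \x mu)%E]_(x in D) (M + phi x) = \int[unif]_x (M + phi x).
  by congr fine; exact: (ge0E (fun x => M + phi x)).
have Dfin : ((mu \x mu) D < +oo)%E by rewrite [X in (X < _)%E]DD ltry.
have iD psi : bmeas psi -> (mu \x mu)%E.-integrable D (EFin \o psi).
  move=> [mp [N hN]]; apply: measurable_bounded_integrable => //.
    exact: measurable_funTS.
  exists N; split; first exact: num_real.
  by move=> y Ny x _; apply: (le_trans (hN x)); exact: ltW.
have hD : \int[(mu \x mu)%E]_(x in D) (M + phi x) =
    \int[(mu \x mu)%E]_(x in D) (M : R) + \int[(mu \x mu)%E]_(x in D) phi x.
  by apply: RintegralD => //; exact: iD.
move: h; rewrite hD (bmeas_intD unif bM bf) Rintegral_prob_cst.
have -> : \int[(mu \x mu)%E]_(x in D) (M : R) = M.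
  by rewrite Rintegral_cst// [X in fine X]DD mulr1.
by move/addrI.
Qed.

(** By Fubini a shear is a translation on each horizontal circle. *)
Lemma unif_shear1 phi (a : R -> R) : tfun phi -> measurable_fun setT a ->
  \int[unif]_x phi (x.1 + a x.2, x.2) = \int[unif]_x phi x.
Proof.
move=> [bf tf] ma.
have bs : bmeas (fun x : R * R => phi (x.1 + a x.2, x.2)).
  apply: (bmeas_comp bf); apply: measurable_fun_pair => //.
  by apply: measurable_realfun.measurable_funD => //; exact: (measurableT_comp ma).
rewrite (bmeas_int2 circ circ bs) (bmeas_int2 circ circ bf); apply: eq_Rintegral => y _.
have per : periodic (fun x : R => phi (x, y)) 1 by move=> x; exact: torus_fun_add1.
have bfy : bmeas (fun x : R => phi (x, y)) by exact: (bmeas_pair2 bf y).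
exact: (circ_translate (a y) bfy per).
Qed.

Lemma unif_shear2 phi (b : R -> R) : tfun phi -> measurable_fun setT b ->
  \int[unif]_x phi (x.1, x.2 + b x.1) = \int[unif]_x phi x.
Proof.
move=> [bf tf] mb.
have bs : bmeas (fun x : R * R => phi (x.1, x.2 + b x.1)).
  apply: (bmeas_comp bf); apply: measurable_fun_pair => //.
  by apply: measurable_realfun.measurable_funD => //; exact: (measurableT_comp mb).
rewrite (bmeas_int1 circ circ bs) (bmeas_int1 circ circ bf); apply: eq_Rintegral => x _.
have per : periodic (fun y : R => phi (x, y)) 1 by move=> y; exact: torus_fun_add2.
have bfx : bmeas (fun y : R => phi (x, y)) by exact: (bmeas_pair1 bf x).
exact: (circ_translate (b x) bfx per).
Qed.

Lemma unif_translate phi v : tfun phi ->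
  \int[unif]_x phi (x + v) = \int[unif]_x phi x.
Proof.
move=> tf; rewrite -(unif_shear1 tf (measurable_cst v.1)).
have t1 : tfun (fun x => phi (x.1 + v.1, x.2)).
  have := tfun_translate (v.1, 0) tf; congr tfun; apply/funext => x.
  by rewrite /GRing.add /= /add_pair /= addr0.
by rewrite -(unif_shear2 t1 (measurable_cst v.2)).
Qed.

(** One factor for each coordinate. *)
Lemma gauss2_minorization phi v (r : R) : 0 < r -> tfun phi -> (forall x, 0 <= phi x) ->
  gauss_minor r ^+ 2 * \int[unif]_x phi x <= \int[gauss2]_z phi (v + scal r z).
Proof.
move=> r0 [bf tf] f0; have k0 := ltW (gauss_minor_gt0 r0).
have mv : measurable_fun setT (fun z => v + scal r z).
  by apply: measurable_fun_pairD; [exact: measurable_cst|exact: measurable_fun_scal].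
have bfv : bmeas (fun z => phi (v + scal r z)) by exact: bmeas_comp.
have bf2 : bmeas (fun z : R * R => phi (v.1 + r * z.1, z.2)).
  apply: (bmeas_comp bf); apply: measurable_fun_pair => //.
  apply: measurable_realfun.measurable_funD => //.
  exact: measurable_realfun.measurable_funM.
rewrite [leRHS]bmeas_int1//.
apply: (@le_trans _ _ (\int[gauss]_x (gauss_minor r * \int[circ]_y phi (v.1 + r * x, y)))).
{ rewrite bmeas_intZ; last exact: (bmeas_int circ bf2).
  rewrite expr2 -mulrA ler_wpM2l//.
  rewrite (bmeas_fubini gauss circ bf2) bmeas_int2// -bmeas_intZ; last first.
    have bs : bmeas (fun z : R * R => phi (z.2, z.1)).
      by apply: (bmeas_comp bf); exact: measurable_swap.
    exact: (bmeas_int circ bs).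
  apply: bmeas_int_le.
  - have bs : bmeas (fun z : R * R => phi (z.2, z.1)).
      by apply: (bmeas_comp bf); exact: measurable_swap.
    exact: (bmeasZ _ (bmeas_int circ bs)).
  - have bs : bmeas (fun z : R * R => phi (v.1 + r * z.2, z.1)).
      exact: (bmeas_comp bf2 (@measurable_swap _ _ _ _)).
    exact: (bmeas_int gauss bs).
  - move=> y; have bfy : bmeas (fun x : R => phi (x, y)) by exact: (bmeas_pair2 bf y).
    have per : periodic (fun x : R => phi (x, y)) 1 by move=> x; exact: torus_fun_add1.
    exact: (gauss_minorization v.1 r0 bfy (fun t => f0 (t, y)) per). }
apply: bmeas_int_le.
- exact: (bmeasZ _ (bmeas_int circ bf2)).
- exact: (bmeas_int gauss bfv).
- move=> x; have bfx : bmeas (fun y : R => phi (v.1 + r * x, y)) by exact: (bmeas_pair1 bf).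
  have per : periodic (fun y : R => phi (v.1 + r * x, y)) 1.
    by move=> y; exact: torus_fun_add2.
  exact: (gauss_minorization v.2 r0 bfx (fun y => f0 (v.1 + r * x, y)) per).
Qed.

End torus.

(** * Gaussian averaging on the torus *)

(** Expresses the variance lost by averaging through increments, on which
    translations act. *)
Lemma variance_double {R : realType} d (X : measurableType d) (mu : probability X R)
    (g : X -> R) : bmeas g ->
  \int[(mu \x mu)%E]_p (g p.1 - g p.2) ^+ 2 =
  2 * (\int[mu]_x g x ^+ 2 - (\int[mu]_x g x) ^+ 2).
Proof.
move=> bg; have bg2 := bmeasX 2 bg.
have bp : bmeas (fun p : X * X => (g p.1 - g p.2) ^+ 2).
  apply/bmeasX/bmeasB; first exact: (bmeas_comp bg measurable_fst).
  exact: (bmeas_comp bg measurable_snd).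
rewrite bmeas_int1//=; set m1 := \int[mu]_x g x; set m2 := \int[mu]_x g x ^+ 2.
have inner x : \int[mu]_y (g x - g y) ^+ 2 = g x ^+ 2 - (2 * m1) * g x + m2.
  transitivity (\int[mu]_y ((g x ^+ 2 - (2 * g x) * g y) + g y ^+ 2)).
    by apply: eq_Rintegral => y _; ring.
  have b1 := bmeasZ (2 * g x) bg; have b2 := bmeas_cst X (g x ^+ 2).
  rewrite bmeas_intD//; last exact: bmeasB.
  rewrite bmeas_intB// Rintegral_prob_cst bmeas_intZ// -/m1 -/m2.
  by ring.
under eq_Rintegral do rewrite inner.
have b1 := bmeasZ (2 * m1) bg; have b2 := bmeas_cst X m2.
rewrite bmeas_intD//; last exact: bmeasB.
rewrite bmeas_intB// bmeas_intZ// Rintegral_prob_cst -/m1 -/m2.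
by ring.
Qed.

Section heat.
Context {R : realType}.
Local Notation gauss := (normal_prob (0 : R) (1 : R)).
Local Notation circ := (uniform_prob (@ltr01 R)).
Local Notation unif := (circ \x circ)%E.
Local Notation gauss2 := (gauss \x gauss)%E.
Implicit Types (phi psi : R * R -> R) (v x z : R * R) (r : R).

(** The semigroup of Brownian motion at time r ^ 2, with generator half the
    Laplacian. *)
Definition heat r phi x : R := \int[gauss2]_z phi (x + scal r z).

Lemma bmeas_heat_integrand r phi x : bmeas phi -> bmeas (fun z => phi (x + scal r z)).
Proof.
move=> bf; apply: (bmeas_comp bf).
by apply: measurable_fun_pairD; [exact: measurable_cst|exact: measurable_fun_scal].
Qed.

Lemma bmeas_heat_joint r phi : bmeas phi ->
  bmeas (fun p : (R * R) * (R * R) => phi (p.1 + scal r p.2)).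
Proof.
move=> bf; apply: (bmeas_comp bf).
apply: measurable_fun_pairD; first exact: measurable_fst.
exact: (measurable_fun_scal r measurable_snd).
Qed.

Lemma bmeas_heat r phi : bmeas phi -> bmeas (heat r phi).
Proof. by move=> bf; exact: (bmeas_int gauss2 (bmeas_heat_joint r bf)). Qed.

Lemma tfun_heat r phi : tfun phi -> tfun (heat r phi).
Proof.
move=> [bf [p1 p2]]; split; first exact: bmeas_heat.
by split=> x; apply: eq_Rintegral => z _; rewrite addrAC ?p1 ?p2.
Qed.

Lemma heat_cst r (c : R) x : heat r (fun=> c) x = c.
Proof. exact: Rintegral_prob_cst. Qed.

Lemma heatD r phi psi x : bmeas phi -> bmeas psi ->
  heat r (fun y => phi y + psi y) x = heat r phi x + heat r psi x.
Proof. by move=> bf bg; rewrite /heat bmeas_intD//; exact: bmeas_heat_integrand. Qed.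

Lemma heatB r phi psi x : bmeas phi -> bmeas psi ->
  heat r (fun y => phi y - psi y) x = heat r phi x - heat r psi x.
Proof. by move=> bf bg; rewrite /heat bmeas_intB//; exact: bmeas_heat_integrand. Qed.

Lemma heatZ r phi (c : R) x : bmeas phi -> heat r (fun y => c * phi y) x = c * heat r phi x.
Proof. by move=> bf; rewrite /heat bmeas_intZ//; exact: bmeas_heat_integrand. Qed.

Lemma heat_norm_le r phi (M : R) x : bmeas phi -> (forall y, `|phi y| <= M) ->
  `|heat r phi x| <= M.
Proof. by move=> bf fM; apply: bmeas_int_norm_le => //; exact: bmeas_heat_integrand. Qed.

Lemma unif_heat r phi : tfun phi -> \int[unif]_x heat r phi x = \int[unif]_x phi x.
Proof.
move=> tf; have [bf _] := tf.
rewrite (bmeas_fubini unif gauss2 (bmeas_heat_joint r bf)) /=.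
under eq_Rintegral do rewrite unif_translate//.
by rewrite Rintegral_prob_cst.
Qed.

(** Doeblin contraction: the averaging kernel dominates a multiple of the
    uniform law, so only the remaining mass sees the oscillation of phi. *)
Lemma heat_contraction r phi (t M : R) : 0 < r -> tfun phi ->
  \int[unif]_x phi x = t -> (forall x, `|phi x - t| <= M) ->
  forall x, `|heat r phi x - t| <= (1 - gauss_minor r ^+ 2) * M.
Proof.
move=> r0 tf ft fM x; have [bf _] := tf; set k := gauss_minor r ^+ 2.
have tM := tfun_cst M; have tt := tfun_cst t.
have fMl y : - M <= phi y - t by have := fM y; rewrite ler_norml => /andP[].
have fMr y : phi y - t <= M by have := fM y; rewrite ler_norml => /andP[].
have tg := tfunB tf tt; have [bg _] := tg; have [bM _] := tM; have [bt _] := tt.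
have bMu := bmeas_cst (R * R)%type M.
have Ig : \int[unif]_y (phi y - t) = 0 by rewrite bmeas_intB// Rintegral_prob_cst ft subrr.
have lo : k * M <= M + (heat r phi x - t).
  have := gauss2_minorization x r0 (tfunD tM tg).
  rewrite bmeas_intD// Rintegral_prob_cst Ig addr0 -/k => /(_ _)/le_trans -> //.
    by move=> y; rewrite -lerBlDl sub0r.
  by rewrite -/(heat r (fun y => M + (phi y - t)) x) heatD// heatB// !heat_cst.
have hi : k * M <= M - (heat r phi x - t).
  have := gauss2_minorization x r0 (tfunB tM tg).
  rewrite bmeas_intB// Rintegral_prob_cst Ig subr0 -/k => /(_ _)/le_trans -> //.
    by move=> y; rewrite subr_ge0.
  by rewrite -/(heat r (fun y => M - (phi y - t)) x) heatB// heatB// !heat_cst.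
rewrite ler_norml; apply/andP; split; clear -lo hi; lra.
Qed.

Section spectral_gap.
Variables (phi : R * R -> R) (tphi : tfun phi) (phi0 : \int[unif]_x phi x = 0).

Let bphi : bmeas phi. Proof. by case: tphi. Qed.

Let A := \int[unif]_x phi x ^+ 2.

Let D v := \int[unif]_x (phi (x + v) - phi x) ^+ 2.

Let tdiff v : tfun (fun x => (phi (x + v) - phi x) ^+ 2).
Proof. by apply/tfunX/tfunB => //; exact: tfun_translate. Qed.

Let D_diff (a b : R * R) : \int[unif]_x (phi (x + a) - phi (x + b)) ^+ 2 = D (a - b).
Proof.
rewrite /D -(unif_translate b (tdiff (a - b))); apply: eq_Rintegral => x _.
by rewrite -addrA (addrC b) subrK.
Qed.

Let bD_joint : bmeas (fun p : (R * R) * (R * R) => (phi (p.2 + p.1) - phi p.2) ^+ 2).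
Proof.
apply/bmeasX/bmeasB; last exact: (bmeas_comp bphi measurable_snd).
apply: (bmeas_comp bphi); apply: measurable_fun_pairD; first exact: measurable_snd.
exact: measurable_fst.
Qed.

Let tD : tfun D.
Proof.
split; first exact: (bmeas_int unif bD_joint).
by have [_ [p1 p2]] := tphi; split=> v; apply: eq_Rintegral => x _; rewrite addrA ?p1 ?p2.
Qed.

Let D_ge0 v : 0 <= D v.
Proof. by apply: Rintegral_ge0 => x _; exact: sqr_ge0. Qed.

(** The increment over u + v is the sum of two, whose squares are split with
    weights 1 + c and 1 + 1 / c. *)
Let D_add (u v : R * R) (c : R) : 0 < c -> D (u + v) <= (1 + c) * D u + (1 + c^-1) * D v.
Proof.
move=> c0; have [bu _] := tdiff u; have [bv _] := tdiff v.
have [bw _] := tfun_translate v (tdiff u).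
have E : D u = \int[unif]_x (phi (x + v + u) - phi (x + v)) ^+ 2.
  exact: esym (unif_translate v (tdiff u)).
rewrite E /D -!bmeas_intZ// -bmeas_intD; last 2 first.
  exact: bmeasZ.
  exact: bmeasZ.
apply: bmeas_int_le; first by case: (tdiff (u + v)).
  by apply: bmeasD; exact: bmeasZ.
move=> x; rewrite -addrA (addrC v u); set a := phi (x + _); set b := phi (x + v).
set e := phi x; rewrite -subr_ge0.
have -> : (1 + c) * (a - b) ^+ 2 + (1 + c^-1) * (b - e) ^+ 2 - (a - e) ^+ 2 =
    c^-1 * (c * (a - b) - (b - e)) ^+ 2 by field; rewrite gt_eqF.
by rewrite mulr_ge0 ?sqr_ge0// invr_ge0 ltW.
Qed.

(** With weight c = 1 / (m + 1) at the step from m + 1 to m + 2 the constants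
    telescope to a square. *)
Let D_mul v m : D (v *+ m.+1) <= m.+1%:R ^+ 2 * D v.
Proof.
elim: m => [|m IH]; first by rewrite expr1n mul1r.
rewrite mulrSr; have m0 : 0 < m.+1%:R^-1 :> R by rewrite invr_gt0.
apply: (le_trans (D_add _ _ m0)); rewrite invrK.
apply: (@le_trans _ _ ((1 + m.+1%:R^-1) * (m.+1%:R ^+ 2 * D v) + (1 + m.+1%:R) * D v)).
  by rewrite lerD2r ler_wpM2l// addr_ge0// ltW.
rewrite -(natr1 m.+1) le_eqVlt; apply/orP; left; apply/eqP; field.
by rewrite gt_eqF// -invr_gt0.
Qed.

(** The cross term vanishes since phi has mean zero. *)
Let D_mean : \int[unif]_v D v = 2 * A.
Proof.
have bA := bmeasX 2 bphi.
rewrite (bmeas_fubini unif unif bD_joint) /=.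
have inner x : \int[unif]_v (phi (x + v) - phi x) ^+ 2 = A + phi x ^+ 2.
  have tx : tfun (fun v => phi (v + x)) by exact: tfun_translate.
  have [bx _] := tx.
  transitivity (\int[unif]_v ((phi (v + x) ^+ 2 - (2 * phi x) * phi (v + x)) + phi x ^+ 2)).
    by apply: eq_Rintegral => v _; rewrite (addrC v x); ring.
  have b1 := bmeasZ (2 * phi x) bx; have b2 := bmeas_cst (R * R)%type (phi x ^+ 2).
  have b3 := bmeasX 2 bx.
  rewrite bmeas_intD//; last exact: bmeasB.
  rewrite bmeas_intB// Rintegral_prob_cst bmeas_intZ// (unif_translate x tphi) phi0.
  by rewrite (unif_translate x (tfunX 2 tphi)) -/A mulr0 subr0.
under eq_Rintegral do rewrite inner.
rewrite bmeas_intD//; last exact: bmeas_cst.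
by rewrite Rintegral_prob_cst -/A; ring.
Qed.

(** The averaging of phi loses the mean square of its increments over two
    independent Gaussian displacements of size r; magnifying these m times costs
    a factor m ^ 2 at most, and m r of order one makes them spread over the
    whole torus, where the increments of a function of mean zero add up to twice
    its mean square. *)
Lemma heat_spectral_gap r m : 0 < r ->
  \int[unif]_x heat r phi x ^+ 2 <=
  (1 - gauss_minor (m.+1%:R * r) ^+ 2 / m.+1%:R ^+ 2) * A.
Proof.
move=> r0; have mr0 : 0 < m.+1%:R * r by rewrite mulr_gt0.
pose G2 : probability (measurableTypeR R * measurableTypeR R)%type R := gauss2.
set k := gauss_minor _ ^+ 2; have k0 : 0 <= k by exact: sqr_ge0.
have bA := bmeasX 2 bphi.
pose inc s (p : (R * R) * (R * R)) := scal s p.1 - scal s p.2.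
have minc s : measurable_fun setT (inc s).
  rewrite /inc (_ : (fun p => _) = (fun p => scal s p.1 + scal (- s) p.2)).
    apply: measurable_fun_pairD; first exact: (measurable_fun_scal s measurable_fst).
    exact: (measurable_fun_scal (- s) measurable_snd).
  apply/funext => p; congr (_ + _).
  by rewrite /scal !mulNr.
have bDi s : bmeas (fun p => D (inc s p)) by case: tD => bD _; exact: bmeas_comp.
have loss : \int[(G2 \x G2)%E]_p D (inc r p) =
    2 * (A - \int[unif]_x heat r phi x ^+ 2).
  have bj : bmeas (fun q : ((R * R) * (R * R)) * (R * R) =>
      (phi (q.2 + scal r q.1.1) - phi (q.2 + scal r q.1.2)) ^+ 2).
    apply/bmeasX/bmeasB; apply: (bmeas_comp bphi); apply: measurable_fun_pairD;
      try exact: measurable_snd; apply: measurable_fun_scal.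
      exact: (measurableT_comp measurable_fst measurable_fst).
    exact: (measurableT_comp measurable_snd measurable_fst).
  under eq_Rintegral do rewrite -D_diff.
  rewrite (bmeas_fubini (G2 \x G2)%E unif bj) /=.
  under eq_Rintegral => x _ do
    rewrite (variance_double G2 (bmeas_heat_integrand r x bphi)).
  have bh := bmeas_heat r bphi; have bh2 := bmeas_heat r bA.
  transitivity (\int[unif]_x (2 * (heat r (fun y => phi y ^+ 2) x - heat r phi x ^+ 2))).
    by [].
  rewrite bmeas_intZ; last by apply: bmeasB => //; exact: bmeasX.
  rewrite bmeas_intB//; last exact: bmeasX.
  by rewrite (unif_heat r (tfunX 2 tphi)).
have big : 2 * k * A <= \int[(G2 \x G2)%E]_p D (inc (m.+1%:R * r) p).
  rewrite (bmeas_int2 G2 G2 (bDi (m.+1%:R * r))) -[X in X <= _](Rintegral_prob_cst G2).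
  apply: bmeas_int_le; first exact: bmeas_cst.
    have bs : bmeas (fun p : (R * R) * (R * R) => D (inc (m.+1%:R * r) (p.2, p.1))).
      exact: (bmeas_comp (bDi _) (@measurable_swap _ _ _ _)).
    exact: (bmeas_int G2 bs).
  move=> z; have := gauss2_minorization (- scal (m.+1%:R * r) z) mr0 tD D_ge0.
  rewrite D_mean -/k /inc /= => h; rewrite mulrAC mulrC; apply: (le_trans h).
  rewrite le_eqVlt; apply/orP; left; apply/eqP.
  by apply: eq_Rintegral => w _; rewrite addrC.
have scale : \int[(G2 \x G2)%E]_p D (inc (m.+1%:R * r) p) <=
    m.+1%:R ^+ 2 * \int[(G2 \x G2)%E]_p D (inc r p).
  rewrite -(bmeas_intZ (G2 \x G2)%E (m.+1%:R ^+ 2) (bDi r)).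
  apply: bmeas_int_le; [exact: bDi|exact/bmeasZ/bDi|move=> p].
  rewrite (_ : inc _ p = inc r p *+ m.+1)//.
  have sc w : scal (m.+1%:R * r) w = scal r w *+ m.+1.
    have pairMn (a b : R) n : (a *+ n, b *+ n) = (a, b) *+ n :> R * R.
      by elim: n => // n IH; rewrite !mulrS -IH.
    by rewrite /scal -!mulrA !mulr_natl pairMn.
  by rewrite /inc !sc -mulrnBl.
have m2 : 0 < m.+1%:R ^+ 2 :> R by rewrite exprn_gt0.
have := le_trans big scale; rewrite loss => h.
have {}h : k * A <= m.+1%:R ^+ 2 * (A - \int[unif]_x heat r phi x ^+ 2).
  by rewrite -(ler_pM2l (ltr0n _ 2)) mulrA (le_trans h)// mulrCA.
rewrite mulrBl mul1r lerBrDr -lerBrDl mulrAC ler_pdivrMr//.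
by rewrite (mulrC (_ - _)).
Qed.

End spectral_gap.

End heat.

(** * Taylor estimates *)

Section taylor.
Context {R : realType}.
Implicit Types (phi psi : R -> R) (M t : R).

(** Each order of a Taylor estimate follows from the one before it by the mean
    value theorem. *)
Lemma mean_value_pow_bound psi psi' M n : psi 0 = 0 ->
  (forall t, is_derive t (1 : R) psi (psi' t)) ->
  (forall t, `|psi' t| <= M * `|t| ^+ n) ->
  forall t, `|psi t| <= M * `|t| ^+ n.+1.
Proof.
move=> psi0 dpsi bpsi t.
have cont a b : {within `[a, b], continuous psi}.
  by apply: derivable_within_continuous => x _; exact: ex_derive.
have M0 : 0 <= M.
  by have := le_trans (normr_ge0 _) (bpsi 1); rewrite normr1 expr1n mulr1.
have bound c : `|c| <= `|t| -> `|psi' c * t| <= M * `|t| ^+ n.+1.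
  move=> ct; rewrite normrM exprSr mulrA ler_wpM2r// (le_trans (bpsi c))//.
  by rewrite ler_wpM2l// lerXn2r.
have [t0|t0] := leP 0 t.
  have [c] := MVT_segment t0 (fun x _ => dpsi x) (cont 0 t).
  rewrite in_itv /= => /andP[c0 ct]; rewrite psi0 !subr0 => ->.
  by apply: bound; rewrite !ger0_norm.
have [c] := MVT_segment (ltW t0) (fun x _ => dpsi x) (cont t 0).
rewrite in_itv /= => /andP[tc c0]; rewrite psi0 !sub0r => /eqP.
rewrite eqr_oppLR mulrN opprK => /eqP ->.
by apply: bound; rewrite (ltr0_norm t0) (ler0_norm c0) lerN2.
Qed.

Lemma taylor1 phi0 phi1 M : (forall t, is_derive t (1 : R) phi0 (phi1 t)) ->
  (forall t, `|phi1 t| <= M) -> forall t, `|phi0 t - phi0 0| <= M * `|t|.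
Proof.
move=> d0 bM t; rewrite -[`|t|]expr1.
apply: (@mean_value_pow_bound (fun t => phi0 t - phi0 0) phi1 M 0).
- by rewrite subrr.
- move=> u; have := is_deriveB (d0 u) (is_derive_cst (phi0 0) u 1).
  by rewrite subr0.
- by move=> u; rewrite expr0 mulr1.
Qed.

Let is_derive_eqfun (f g : R -> R) (df dg t : R) : is_derive t (1 : R) f df -> f = g -> df = dg ->
  is_derive t (1 : R) g dg.
Proof. by move=> ? <- <-. Qed.

Let is_derive_lin (c t : R) : is_derive t (1 : R) (fun u => u * c) c.
Proof.
have := is_deriveZ c (is_derive_id t (1 : R)); move=> /is_derive_eqfun; apply.
  by apply/funext => u; rewrite mulrC.
exact: mulr1.
Qed.

Let is_derive_sqr (c t : R) : is_derive t (1 : R) (fun u => u ^+ 2 * c) (2 * t * c).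
Proof.
have := is_deriveZ c (is_deriveX 2 (is_derive_id t (1 : R))).
move=> /is_derive_eqfun; apply.
  by apply/funext => u; rewrite mulrC.
by rewrite /GRing.scale /=; ring.
Qed.

Let is_derive_opp phi dphi t : is_derive (- t) (1 : R) phi dphi ->
  is_derive t (1 : R) (fun u => phi (- u)) (- dphi).
Proof.
move=> d; have := is_derive1_comp d (is_deriveN (is_derive_id t (1 : R))).
by move=> /is_derive_eqfun; apply => //; rewrite mulrN1.
Qed.

Lemma taylor2 phi0 phi1 phi2 M : (forall t, is_derive t (1 : R) phi0 (phi1 t)) ->
  (forall t, is_derive t (1 : R) phi1 (phi2 t)) ->
  (forall t, `|phi2 t| <= M) -> forall t, `|phi0 t - phi0 0 - t * phi1 0| <= M * t ^+ 2.
Proof.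
move=> d0 d1 bM t; rewrite -(ger0_norm (sqr_ge0 t)) normrX.
apply: (@mean_value_pow_bound (fun t => phi0 t - phi0 0 - t * phi1 0)
  (fun t => phi1 t - phi1 0) M 1).
- by rewrite subrr mul0r subr0.
- move=> u; have := is_deriveB (is_deriveB (d0 u) (is_derive_cst (phi0 0) u 1))
    (is_derive_lin (phi1 0) u).
  by move=> /is_derive_eqfun; apply => //; rewrite subr0.
- by move=> u; rewrite expr1; exact: taylor1 d1 bM u.
Qed.

(** Symmetrizing cancels the odd orders, whose Gaussian averages vanish. *)
Lemma taylor2_sym phi0 phi1 phi2 M : (forall t, is_derive t (1 : R) phi0 (phi1 t)) ->
  (forall t, is_derive t (1 : R) phi1 (phi2 t)) -> (forall t, `|phi2 t| <= M) ->
  forall t, `|phi0 t + phi0 (- t) - 2 * phi0 0| <= 2 * M * t ^+ 2.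
Proof.
move=> d0 d1 bM t.
have h1 := taylor2 d0 d1 bM t; have h2 := taylor2 d0 d1 bM (- t).
rewrite sqrrN in h2.
have -> : phi0 t + phi0 (- t) - 2 * phi0 0 =
    (phi0 t - phi0 0 - t * phi1 0) + (phi0 (- t) - phi0 0 - (- t) * phi1 0) by ring.
by rewrite -mulrA mulrDl mul1r (le_trans (ler_normD _ _))// lerD.
Qed.

Lemma taylor4_sym phi0 phi1 phi2 phi3 phi4 M :
  (forall t, is_derive t (1 : R) phi0 (phi1 t)) ->
  (forall t, is_derive t (1 : R) phi1 (phi2 t)) ->
  (forall t, is_derive t (1 : R) phi2 (phi3 t)) ->
  (forall t, is_derive t (1 : R) phi3 (phi4 t)) -> (forall t, `|phi4 t| <= M) ->
  forall t, `|phi0 t + phi0 (- t) - 2 * phi0 0 - t ^+ 2 * phi2 0| <= 2 * M * t ^+ 4.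
Proof.
move=> d0 d1 d2 d3 bM t; rewrite -(ger0_norm (exprn_even_ge0 t (isT : ~~ odd 4))) normrX.
apply: (@mean_value_pow_bound
  (fun t => phi0 t + phi0 (- t) - 2 * phi0 0 - t ^+ 2 * phi2 0)
  (fun t => phi1 t - phi1 (- t) - 2 * t * phi2 0)).
- by rewrite oppr0 expr0n mul0r; ring.
- move=> u; have := is_deriveB (is_deriveB (is_deriveD (d0 u) (is_derive_opp (d0 (- u))))
    (is_derive_cst (2 * phi0 0) u 1)) (is_derive_sqr (phi2 0) u).
  by move=> /is_derive_eqfun; apply => //; rewrite subr0.
- move=> {}t; apply: (@mean_value_pow_bound (fun t => phi1 t - phi1 (- t) - 2 * t * phi2 0)
    (fun t => phi2 t + phi2 (- t) - 2 * phi2 0)).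
  + by rewrite oppr0 mulr0 mul0r; ring.
  + move=> u; have := is_deriveB (is_deriveB (d1 u) (is_derive_opp (d1 (- u))))
      (is_derive_lin (2 * phi2 0) u).
    move=> /is_derive_eqfun; apply; last by rewrite opprK.
    by apply/funext => v; rewrite !fctE /=; ring.
  + move=> {}t; rewrite -normrX (ger0_norm (sqr_ge0 t)).
    exact: taylor2_sym d2 d3 bM t.
Qed.

Local Notation gauss := (normal_prob (0 : R) (1 : R)).

Let gauss_sym phi s : bmeas phi ->
  \int[gauss]_a phi (s * a) = 2^-1 * \int[gauss]_a (phi (s * a) + phi (- (s * a))).
Proof.
move=> bf.
have bs (r : R) : bmeas (fun a : R => phi (r * a)).
  by apply: (bmeas_comp bf); exact: measurable_realfun.mulrl_measurable.
have bn : bmeas (fun a : R => phi (- (s * a))).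
  by have := bs (- s); under eq_fun do rewrite mulNr.
have E : \int[gauss]_a phi (- (s * a)) = \int[gauss]_a phi (s * a).
  have bN : bmeas (fun a : R => phi (s * - a)).
    by move: bn; under eq_fun do rewrite -mulrN.
  rewrite -(@gauss_intN _ (fun a => phi (s * a)) (bs s).1 (bmeas_integrable gauss bN)).
  by under eq_Rintegral do rewrite -mulrN.
rewrite (bmeas_intD gauss (bs s) bn) E.
by move: (Rintegral _ _ _) => I; field.
Qed.

(** The Gaussian law is symmetric, so the symmetrized estimates apply; its second
    moment is one. *)
Lemma gauss_taylor2 phi0 phi1 phi2 M s : bmeas phi0 ->
  (forall t, is_derive t (1 : R) phi0 (phi1 t)) ->
  (forall t, is_derive t (1 : R) phi1 (phi2 t)) -> (forall t, `|phi2 t| <= M) ->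
  `|\int[gauss]_a phi0 (s * a) - phi0 0| <= M * s ^+ 2.
Proof.
move=> bf d0 d1 bM; rewrite gauss_sym//.
have bs (r : R) : bmeas (fun a : R => phi0 (r * a)).
  by apply: (bmeas_comp bf); exact: measurable_realfun.mulrl_measurable.
have bn : bmeas (fun a : R => phi0 (- (s * a))).
  by have := bs (- s); under eq_fun do rewrite mulNr.
have bp : bmeas (fun a => phi0 (s * a) + phi0 (- (s * a)) - 2 * phi0 0).
  by apply: bmeasB; [exact: bmeasD|exact: bmeas_cst].
have Ip : \int[gauss]_a (phi0 (s * a) + phi0 (- (s * a)) - 2 * phi0 0) =
    \int[gauss]_a (phi0 (s * a) + phi0 (- (s * a))) - 2 * phi0 0.
  have := bmeas_intB gauss (bmeasD (bs s) bn) (bmeas_cst _ (2 * phi0 0)).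
  by rewrite Rintegral_prob_cst.
have -> : 2^-1 * \int[gauss]_a (phi0 (s * a) + phi0 (- (s * a))) - phi0 0 =
    2^-1 * \int[gauss]_a (phi0 (s * a) + phi0 (- (s * a)) - 2 * phi0 0).
  by rewrite Ip; move: (Rintegral _ _ _) => I; field.
rewrite normrM ger0_norm ?invr_ge0// mulrC ler_pdivrMr//.
have -> : M * s ^+ 2 * 2 = \int[gauss]_a (2 * M * s ^+ 2 * a ^+ 2).
  rewrite RintegralZl//; last exact: gauss_integrable_sqr.
  by rewrite gauss_int_sqr; ring.
apply: le_trans (le_normr_Rintegral _ (bmeas_integrable gauss bp)) _ => //.
apply: le_Rintegral => //.
- exact: integrable_norm (bmeas_integrable gauss bp).
- exact: integrable_EFinZ gauss_integrable_sqr.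
- move=> a _; have := taylor2_sym d0 d1 bM (s * a).
  by rewrite exprMn mulrA.
Qed.

Lemma gauss_taylor4 phi0 phi1 phi2 phi3 phi4 M s : bmeas phi0 ->
  (forall t, is_derive t (1 : R) phi0 (phi1 t)) ->
  (forall t, is_derive t (1 : R) phi1 (phi2 t)) ->
  (forall t, is_derive t (1 : R) phi2 (phi3 t)) ->
  (forall t, is_derive t (1 : R) phi3 (phi4 t)) -> (forall t, `|phi4 t| <= M) ->
  `|\int[gauss]_a phi0 (s * a) - phi0 0 - s ^+ 2 / 2 * phi2 0| <= M * gauss_pow4 * s ^+ 4.
Proof.
move=> bf d0 d1 d2 d3 bM; rewrite gauss_sym//.
have bs (r : R) : bmeas (fun a : R => phi0 (r * a)).
  by apply: (bmeas_comp bf); exact: measurable_realfun.mulrl_measurable.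
have bn : bmeas (fun a : R => phi0 (- (s * a))).
  by have := bs (- s); under eq_fun do rewrite mulNr.
have bp : bmeas (fun a => phi0 (s * a) + phi0 (- (s * a)) - 2 * phi0 0).
  by apply: bmeasB; [exact: bmeasD|exact: bmeas_cst].
have Ip : \int[gauss]_a (phi0 (s * a) + phi0 (- (s * a)) - 2 * phi0 0) =
    \int[gauss]_a (phi0 (s * a) + phi0 (- (s * a))) - 2 * phi0 0.
  have := bmeas_intB gauss (bmeasD (bs s) bn) (bmeas_cst _ (2 * phi0 0)).
  by rewrite Rintegral_prob_cst.
have ip := bmeas_integrable gauss bp.
have iq := integrable_EFinZ (s ^+ 2 * phi2 0) (@gauss_integrable_sqr R).
have ipq := integrable_EFinB ip iq.
have -> : 2^-1 * \int[gauss]_a (phi0 (s * a) + phi0 (- (s * a))) - phi0 0 -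
    s ^+ 2 / 2 * phi2 0 = 2^-1 * \int[gauss]_a (phi0 (s * a) + phi0 (- (s * a)) -
    2 * phi0 0 - s ^+ 2 * phi2 0 * a ^+ 2).
  rewrite RintegralB// RintegralZl//; last exact: gauss_integrable_sqr.
  by rewrite gauss_int_sqr Ip; move: (Rintegral _ _ _) => I; field.
rewrite normrM ger0_norm ?invr_ge0// mulrC ler_pdivrMr//.
have -> : M * gauss_pow4 * s ^+ 4 * 2 = \int[gauss]_a (2 * M * s ^+ 4 * a ^+ 4).
  rewrite RintegralZl//; last exact: gauss_integrable_pow4.
  by rewrite -/(gauss_pow4); ring.
apply: le_trans (le_normr_Rintegral _ ipq) _ => //.
apply: le_Rintegral => //.
- exact: integrable_norm ipq.
- exact: integrable_EFinZ (@gauss_integrable_pow4 R).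
- move=> a _; have := taylor4_sym d0 d1 d2 d3 bM (s * a).
  have -> : (s * a) ^+ 2 * phi2 0 = s ^+ 2 * phi2 0 * a ^+ 2 by ring.
  by have -> : 2 * M * (s * a) ^+ 4 = 2 * M * s ^+ 4 * a ^+ 4 by ring.
Qed.

End taylor.

(** * Smooth functions on the torus *)

Section open_measurable.
Context {R : realType}.

(** An open set is the union of the boxes with rational centres and sides
    2 / (n + 1) that it contains. *)
Lemma open_measurable_plane (O : set (R * R)) : open O -> measurable O.
Proof.
move=> oO.
pose box (p q : R) (n : nat) : set (R * R) := ball p n.+1%:R^-1 `*` ball q n.+1%:R^-1.
pose B (p q : rat) n := if `[< box (ratr p) (ratr q) n `<=` O >] then box (ratr p) (ratr q) n else set0.
rewrite (_ : O = \bigcup_(p : rat) \bigcup_(q : rat) \bigcup_n B p q n).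
  apply: bigcupT_measurable_rat => p; apply: bigcupT_measurable_rat => q.
  apply: bigcupT_measurable => n; rewrite /B; case: ifP => // _.
  by apply: measurableX; exact: measurable_ball.
apply/seteqP; split => [x Ox|x [p _ [q _ [n _]]]]; last first.
  by rewrite /B; case: ifPn => // /asboolP; apply.
move: oO; rewrite openE => /(_ x Ox)/nbhs_ballP[e /= e0 eO].
pose n := Num.bound (2 / e).
have n0 : 0 < n.+1%:R^-1 :> R by rewrite invr_gt0.
have ne : 2 * n.+1%:R^-1 <= e.
  have h : 2 / e < n.+1%:R.
    have de : 0 <= 2 / e by rewrite divr_ge0// ltW.
    by rewrite (lt_trans (archi_boundP de))// ltr_nat.
  by rewrite ler_pdivrMr// mulrC -ler_pdivrMr// ltW.
have near_rat (y : R) : exists q : rat, `|(ratr q : R) - y| < n.+1%:R^-1.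
  have yy : y < y + n.+1%:R^-1 by rewrite ltrDl.
  have [q] := rat_in_itvoo yy; rewrite in_itv /= => /andP[q1 q2]; exists q.
  by rewrite ger0_norm ?subr_ge0 ?ltW// ltrBlDl.
have [p hp] := near_rat x.1; have [q hq] := near_rat x.2.
exists p => //; exists q => //; exists n => //; rewrite /B.
have near2 (a b c : R) : `|b - a| < n.+1%:R^-1 -> `|b - c| < n.+1%:R^-1 -> `|a - c| < e.
  move=> h1 h2; apply: lt_le_trans ne; rewrite (_ : a - c = (a - b) + (b - c)); last by ring.
  rewrite (le_lt_trans (ler_normD _ _))// mulr_natl mulr2n ltrD// distrC.
  exact: h1.
case: ifPn => [_|/asboolP[]]; first by split; rewrite -ball_normE.
move=> y [/= ]; rewrite -!ball_normE /= => h1 h2; apply: eO.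
by split; rewrite -ball_normE /ball_ /=; [exact: near2 hp h1|exact: near2 hq h2].
Qed.

Lemma continuous_measurable_plane (u : R * R -> R) : continuous u -> measurable_fun setT u.
Proof.
move=> cu; apply: (measurability _ (RGenOInfty.measurableE R)) => _ [_ [a ->] <-].
rewrite setTI; apply: open_measurable_plane; apply: open_comp => [x _|]; first exact: cu.
rewrite set_itvoy; exact: open_gt.
Qed.

End open_measurable.

Section smooth_torus.
Context {R : realType}.
Implicit Types (u : R * R -> R) (x : R * R) (b : bool) (t : R).

Definition axis b : R * R := if b then e1 else e2.

Definition pd b u : R * R -> R := 'D_(axis b) u.

Definition smooth_torus u : Prop := smooth u /\ torus_fun u.

Lemma derive_translate u v w x : (forall y, u (y + w) = u y) ->
  'D_v u (x + w) = 'D_v u x.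
Proof.
move=> uw; have E : (fun h : R => h^-1 *: ((u \o shift (x + w)) (h *: v) - u (x + w))) =
    (fun h : R => h^-1 *: ((u \o shift x) (h *: v) - u x)).
  by apply/funext => h /=; rewrite addrA !uw.
by rewrite /derive [X in lim (X @ _)]E.
Qed.

Lemma smooth_torus_pd b u : smooth_torus u -> smooth_torus (pd b u).
Proof.
move=> [su [p1 p2]]; split.
  move=> s; have := su (rcons s b); rewrite (_ : iter_partial (rcons s b) u = iter_partial s (pd b u))//.
  by elim: s => //= c s ->.
by split=> x; exact: derive_translate.
Qed.

(** Reduces partial derivatives to calculus on a line. *)
Lemma is_derive_line u b x t : smooth u ->
  is_derive t (1 : R) (fun t => u (x + t *: axis b)) (pd b u (x + t *: axis b)).
Proof.
move=> su; have := su [::] => -[_ d1 d2].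
have du y : derivable u y (axis b) by case: b; [exact: d1|exact: d2].
have E : (fun h : R => h^-1 *: (((fun t => u (x + t *: axis b)) \o shift t) (h *: 1) -
      u (x + t *: axis b))) =
    (fun h : R => h^-1 *: ((u \o shift (x + t *: axis b)) (h *: axis b) -
      u (x + t *: axis b))).
  apply/funext => h /=; congr (_ *: (u _ - _)).
  by rewrite [h *: 1]mulr1 scalerDl addrCA.
split.
  by rewrite /derivable [X in cvg (X @ _)]E; exact: du.
by rewrite /derive [X in lim (X @ _)]E.
Qed.

Lemma smooth_continuous u : smooth u -> continuous u.
Proof. by move=> /(_ [::])[]. Qed.

Lemma torus_fun_frac u x : torus_fun u ->
  u x = u (x.1 - (Num.floor x.1)%:~R, x.2 - (Num.floor x.2)%:~R).
Proof.
move=> tu.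
have nat1 n (a c : R) : u (a + n%:R, c) = u (a, c).
  by elim: n => [|n IH]; rewrite ?addr0// -natr1 addrA torus_fun_add1.
have nat2 n (a c : R) : u (a, c + n%:R) = u (a, c).
  by elim: n => [|n IH]; rewrite ?addr0// -natr1 addrA torus_fun_add2.
have int1 (z : int) (a c : R) : u (a - z%:~R, c) = u (a, c).
  case: z => n; first by rewrite -pmulrn -(nat1 n (a - n%:R)) subrK.
  by rewrite NegzE mulrNz opprK -pmulrn nat1.
have int2 (z : int) (a c : R) : u (a, c - z%:~R) = u (a, c).
  case: z => n; first by rewrite -pmulrn -(nat2 n a (c - n%:R)) subrK.
  by rewrite NegzE mulrNz opprK -pmulrn nat2.
by rewrite int1 int2 -surjective_pairing.
Qed.

(** All values are taken on the compact unit square. *)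
Lemma continuous_torus_bounded u : continuous u -> torus_fun u ->
  exists2 M, 0 <= M & forall x, `|u x| <= M.
Proof.
move=> cu tu; suff [M hM] : exists M, forall x, `|u x| <= M.
  by exists M => //; exact: le_trans (normr_ge0 _) (hM 0).
pose Q : set (R * R) := `[0, 1] `*` `[0, 1].
have cQ : compact Q by apply: compact_setX; exact: segment_compact.
have cI : compact [set u x | x in Q].
  by apply: continuous_compact => //; exact: continuous_subspaceT.
have [M0 [_ hM]] := compact_bounded cI.
exists (M0 + 1) => x; rewrite (torus_fun_frac x tu).
apply: (hM (M0 + 1)); first by rewrite ltrDl.
exists (x.1 - (Num.floor x.1)%:~R, x.2 - (Num.floor x.2)%:~R) => //.
split; rewrite /= in_itv /=.
  have /andP[h1 h2] := floor_itv x.1; rewrite subr_ge0 h1 lerBlDl /=.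
  by rewrite ltW// (lt_le_trans h2)// intrD.
have /andP[h1 h2] := floor_itv x.2; rewrite subr_ge0 h1 lerBlDl /=.
by rewrite ltW// (lt_le_trans h2)// intrD.
Qed.

Lemma smooth_torus_bounded u : smooth_torus u ->
  exists2 M, 0 <= M & forall x, `|u x| <= M.
Proof. by move=> [su tu]; apply: continuous_torus_bounded => //; exact: smooth_continuous. Qed.

Lemma smooth_torus_tfun u : smooth_torus u -> tfun u.
Proof.
move=> su; split; last by case: su.
split; first exact: (continuous_measurable_plane (smooth_continuous su.1)).
by have [M _ hM] := smooth_torus_bounded su; exists M.
Qed.

Lemma smooth_torus_lipschitz u b : smooth_torus u ->
  exists2 M, 0 <= M & forall x t, `|u (x + t *: axis b) - u x| <= M * `|t|.
Proof.
move=> su; have [M M0 hM] := smooth_torus_bounded (smooth_torus_pd b su).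
exists M => // x t.
have := taylor1 (fun t => is_derive_line b x t su.1) (fun t => hM _) t.
by rewrite scale0r addr0.
Qed.

Lemma smooth_torus_taylor2 u b : smooth_torus u ->
  exists2 M, 0 <= M & forall x t, `|u (x + t *: axis b) - u x - t * pd b u x| <= M * t ^+ 2.
Proof.
move=> su; have su1 := smooth_torus_pd b su; have su2 := smooth_torus_pd b su1.
have [M M0 hM] := smooth_torus_bounded su2; exists M => // x t.
have := taylor2 (fun t => is_derive_line b x t su.1)
  (fun t => is_derive_line b x t su1.1) (fun t => hM _) t.
by rewrite scale0r addr0.
Qed.

End smooth_torus.

Section heat_taylor.
Context {R : realType}.
Local Notation gauss := (normal_prob (0 : R) (1 : R)).
Implicit Types (u : R * R -> R) (x : R * R) (b : bool) (s : R).

Lemma measurable_line x b : measurable_fun setT (fun t : R => x + t *: axis b).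
Proof.
apply: measurable_fun_pairD; first exact: measurable_cst.
by apply: measurable_fun_pair; apply: measurable_realfun.measurable_funM => //; exact: measurable_cst.
Qed.

Lemma bmeas_line u x b : bmeas u -> bmeas (fun t : R => u (x + t *: axis b)).
Proof. by move=> bu; apply: (bmeas_comp bu); exact: measurable_line. Qed.

Lemma line_gauss2 u b : smooth_torus u -> exists2 M, 0 <= M &
  forall s x, `|\int[gauss]_a u (x + (s * a) *: axis b) - u x| <= M * s ^+ 2.
Proof.
move=> u0; have u1 := smooth_torus_pd b u0; have u2 := smooth_torus_pd b u1.
have [M M0 hM] := smooth_torus_bounded u2; exists M => // s x.
have bu := bmeas_line x b (smooth_torus_tfun u0).1.
have := gauss_taylor2 s bu (fun t => is_derive_line b x t u0.1)
  (fun t => is_derive_line b x t u1.1) (fun t => hM _).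
by rewrite scale0r addr0.
Qed.

Lemma line_gauss4 u b : smooth_torus u -> exists2 M, 0 <= M &
  forall s x, `|\int[gauss]_a u (x + (s * a) *: axis b) - u x - s ^+ 2 / 2 * pd b (pd b u) x|
    <= M * s ^+ 4.
Proof.
move=> u0; have u1 := smooth_torus_pd b u0; have u2 := smooth_torus_pd b u1.
have u3 := smooth_torus_pd b u2; have u4 := smooth_torus_pd b u3.
have [M M0 hM] := smooth_torus_bounded u4; exists (M * gauss_pow4) => [|s x].
  by rewrite mulr_ge0// gauss_pow4_ge0.
have bu := bmeas_line x b (smooth_torus_tfun u0).1.
have := gauss_taylor4 s bu (fun t => is_derive_line b x t u0.1)
  (fun t => is_derive_line b x t u1.1) (fun t => is_derive_line b x t u2.1)
  (fun t => is_derive_line b x t u3.1) (fun t => hM _).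
by rewrite scale0r addr0.
Qed.

Lemma scal_axis s (z x : R * R) :
  x + scal s z = x + (s * z.1) *: axis true + (s * z.2) *: axis false.
Proof.
rewrite -addrA; congr (_ + _); rewrite /scal /axis /e1 /e2.
rewrite /GRing.scale /= /GRing.add /= /add_pair /= /GRing.scale /=.
by rewrite !mulr1 !mulr0 addr0 add0r.
Qed.

Definition laplace u x := pd true (pd true u) x + pd false (pd false u) x.

(** One coordinate after the other: fourth order along each axis, and second
    order for the average along the first axis of the second derivative along the
    other one. *)
Lemma heat_taylor u : smooth_torus u -> exists2 M, 0 <= M &
  forall s x, `|heat s u x - u x - s ^+ 2 / 2 * laplace u x| <= M * s ^+ 4.
Proof.
move=> u0; have uyy := smooth_torus_pd false (smooth_torus_pd false u0).
have [M1 M10 h1] := line_gauss4 false u0.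
have [M2 M20 h2] := line_gauss4 true u0.
have [M3 M30 h3] := line_gauss2 true uyy.
exists (M1 + M2 + M3) => [|s x]; first by rewrite !addr_ge0.
have bu := (smooth_torus_tfun u0).1; have buyy := (smooth_torus_tfun uyy).1.
pose A (a : R) := u (x + (s * a) *: axis true).
pose W (a : R) := pd false (pd false u) (x + (s * a) *: axis true).
pose J (a : R) := \int[gauss]_b u (x + scal s (a, b)).
have msa : measurable_fun setT (fun a : R => s * a) by exact: measurable_realfun.mulrl_measurable.
have bA : bmeas A by exact: (bmeas_comp (bmeas_line x true bu) msa).
have bW : bmeas W by exact: (bmeas_comp (bmeas_line x true buyy) msa).
have bz := bmeas_heat_integrand s x bu.
have bJ : bmeas J by exact: (bmeas_int gauss bz).
have JE a : J a = \int[gauss]_b u (x + (s * a) *: axis true + (s * b) *: axis false).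
  by apply: eq_Rintegral => b _; rewrite scal_axis.
have e1 : `|\int[gauss]_a J a - \int[gauss]_a A a - s ^+ 2 / 2 * \int[gauss]_a W a| <= M1 * s ^+ 4.
  have bsW := bmeasZ (s ^+ 2 / 2) bW; have bJA := bmeasB bJ bA.
  rewrite -(bmeas_intZ gauss _ bW) -(bmeas_intB gauss bJ bA) -(bmeas_intB gauss bJA bsW).
  apply: bmeas_int_norm_le; first exact: bmeasB.
  by move=> a; rewrite JE; exact: h1.
have e2 : `|\int[gauss]_a A a - u x - s ^+ 2 / 2 * pd true (pd true u) x| <= M2 * s ^+ 4.
  exact: h2.
have e3 : `|\int[gauss]_a W a - pd false (pd false u) x| <= M3 * s ^+ 2 by exact: h3.
have -> : heat s u x = \int[gauss]_a J a by rewrite /heat (bmeas_int1 gauss gauss bz).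
move: e1 e2 e3; move: (\int[gauss]_a J a) (\int[gauss]_a A a) (\int[gauss]_a W a).
move=> j a w.
rewrite /laplace; move: (pd true (pd true u) x) (pd false (pd false u) x) => p q e1 e2 e3.
have -> : j - u x - s ^+ 2 / 2 * (p + q) = (j - a - s ^+ 2 / 2 * w) +
  (a - u x - s ^+ 2 / 2 * p) + s ^+ 2 / 2 * (w - q) by ring.
rewrite (le_trans (ler_normD _ _))// !mulrDl lerD//.
  by rewrite (le_trans (ler_normD _ _))// lerD.
have s20 : 0 <= s ^+ 2 / 2 by rewrite divr_ge0// sqr_ge0.
rewrite normrM (ger0_norm s20).
apply: (le_trans (ler_wpM2l s20 e3)).
have -> : s ^+ 2 / 2 * (M3 * s ^+ 2) = 2^-1 * (M3 * s ^+ 4) by ring.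
rewrite ler_piMl// ?invf_le1 ?ler1n//.
by rewrite mulr_ge0// exprn_even_ge0.
Qed.

End heat_taylor.

(** * Local error of the scheme *)

Section consistency.
Context {R : realType}.
Implicit Types (x : R * R) (s dt : R).

(** The deterministic part of one step. It is a composition of two shears, since
    the second coordinate moves by a function of the updated first one. *)
Definition drift (f g : R -> R) dt x : R * R :=
  let y := x.1 - f x.2 * dt in (y, x.2 + g y * dt).

Lemma drift_axis (f g : R -> R) dt x :
  drift f g dt x = x + (- (f x.2 * dt)) *: axis true
    + (g (x.1 - f x.2 * dt) * dt) *: axis false.
Proof.
rewrite /drift /axis /e1 /e2; case: x => a b /=.
rewrite /GRing.scale /= /GRing.add /= /add_pair /= /GRing.scale /=.
by rewrite !mulr1 !mulr0 !addr0.
Qed.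

(** One step reproduces the generator up to order dt ^ 2. Each term of the constant
    bounds one error: of the Gaussian averaging, of the two Taylor expansions
    along the axes, and of freezing the derivatives and g at x. *)
Lemma local_error (f g : R -> R) (sigma : R) (chi : R * R -> R) :
  smooth_torus (fun x => f x.2) -> smooth_torus (fun x => g x.1) -> smooth_torus chi ->
  exists2 M, 0 <= M & forall s dt x, 0 < dt -> s ^+ 2 = sigma ^+ 2 * dt ->
    `|heat s chi (drift f g dt x) - chi x - dt * generator f g sigma chi x| <= M * dt ^+ 2.
Proof.
move=> sf sg sc.
have [Bf Bf0 hBf] := smooth_torus_bounded sf; have [Bg Bg0 hBg] := smooth_torus_bounded sg.
have c1 := smooth_torus_pd true sc; have c2 := smooth_torus_pd false sc.
have c11 := smooth_torus_pd true c1; have c22 := smooth_torus_pd false c2.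
have [B2 B20 hB2] := smooth_torus_bounded c2.
have [M0 M00 E0] := heat_taylor sc.
have [M1 M10 E1] := smooth_torus_taylor2 false sc.
have [M2 M20 E2] := smooth_torus_taylor2 true sc.
have [L3 L30 E3] := smooth_torus_lipschitz true c2.
have [L4 L40 E4] := smooth_torus_lipschitz true sg.
have [L5 L50 E5] := smooth_torus_lipschitz true c11.
have [L6 L60 E6] := smooth_torus_lipschitz false c11.
have [L7 L70 E7] := smooth_torus_lipschitz true c22.
have [L8 L80 E8] := smooth_torus_lipschitz false c22.
pose S := sigma ^+ 2 / 2; have S0 : 0 <= S by rewrite divr_ge0// sqr_ge0.
exists (M0 * sigma ^+ 4 + M1 * Bg ^+ 2 + M2 * Bf ^+ 2 + Bg * (L3 * Bf) + L4 * Bf * B2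
    + S * (L5 * Bf + L6 * Bg + (L7 * Bf + L8 * Bg))).
  by repeat first [assumption|exact: exprn_even_ge0|apply: addr_ge0|apply: mulr_ge0].
move=> s dt x dt0 sE; have dt0' := ltW dt0.
set w := drift f g dt x; pose al := - (f x.2 * dt); pose be := g (x.1 - f x.2 * dt) * dt.
pose y := x + al *: axis true.
have wE : w = y + be *: axis false by rewrite /w drift_axis.
have hal : `|al| <= Bf * dt.
  by rewrite normrN normrM (gtr0_norm dt0) ler_wpM2r//; exact: (hBf x).
have hbe : `|be| <= Bg * dt.
  by rewrite normrM (gtr0_norm dt0) ler_wpM2r//; exact: (hBg (x.1 - f x.2 * dt, 0)).
have al2 : al ^+ 2 <= Bf ^+ 2 * dt ^+ 2.
  by rewrite -exprMn -(real_normK (num_real al)) ler_pXn2r// nnegrE// mulr_ge0.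
have be2 : be ^+ 2 <= Bg ^+ 2 * dt ^+ 2.
  by rewrite -exprMn -(real_normK (num_real be)) ler_pXn2r// nnegrE// mulr_ge0.
have s4 : s ^+ 4 = sigma ^+ 4 * dt ^+ 2.
  have -> : s ^+ 4 = (s ^+ 2) ^+ 2 by ring.
  by rewrite sE; ring.
have gE : g (x.1 + al) = g (x.1 - f x.2 * dt) by [].
have {}E0 : `|heat s chi w - chi w - s ^+ 2 / 2 * laplace chi w| <= M0 * sigma ^+ 4 * dt ^+ 2.
  have -> : M0 * sigma ^+ 4 * dt ^+ 2 = M0 * s ^+ 4 by rewrite s4; ring.
  exact: E0.
have {}E1 : `|chi w - chi y - be * pd false chi y| <= M1 * Bg ^+ 2 * dt ^+ 2.
  by rewrite wE (le_trans (E1 _ _))// -(mulrA M1) ler_wpM2l.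
have {}E2 : `|chi y - chi x - al * pd true chi x| <= M2 * Bf ^+ 2 * dt ^+ 2.
  by rewrite (le_trans (E2 _ _))// -(mulrA M2) ler_wpM2l.
have {}E3 : `|be * (pd false chi y - pd false chi x)| <= Bg * (L3 * Bf) * dt ^+ 2.
  have -> : Bg * (L3 * Bf) * dt ^+ 2 = (Bg * dt) * (L3 * (Bf * dt)) by ring.
  by rewrite normrM ler_pM// (le_trans (E3 _ _))// ler_wpM2l.
have {}E4 : `|dt * (g (x.1 + al) - g x.1) * pd false chi x| <= L4 * Bf * B2 * dt ^+ 2.
  have -> : L4 * Bf * B2 * dt ^+ 2 = dt * (L4 * (Bf * dt)) * B2 by ring.
  rewrite !normrM (gtr0_norm dt0) ler_pM ?mulr_ge0// ler_wpM2l//.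
  have := E4 x al; rewrite (_ : (x + al *: axis true).1 = x.1 + al).
    by move=> h; rewrite (le_trans h)// ler_wpM2l.
  by rewrite /axis /e1 /= /GRing.scale /= mulr1.
have {}E5 : `|laplace chi w - laplace chi x| <= (L5 * Bf + L6 * Bg + (L7 * Bf + L8 * Bg)) * dt.
  rewrite /laplace wE.
  have h5 := E5 x al; have h6 := E6 y be; have h7 := E7 x al; have h8 := E8 y be.
  have k5 : L5 * `|al| <= L5 * Bf * dt by rewrite -(mulrA L5) ler_wpM2l.
  have k6 : L6 * `|be| <= L6 * Bg * dt by rewrite -(mulrA L6) ler_wpM2l.
  have k7 : L7 * `|al| <= L7 * Bf * dt by rewrite -(mulrA L7) ler_wpM2l.
  have k8 : L8 * `|be| <= L8 * Bg * dt by rewrite -(mulrA L8) ler_wpM2l.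
  move: h5 h6 h7 h8; rewrite -/y; set P := pd true (pd true chi); set Q := pd false (pd false chi).
  move=> h5 h6 h7 h8.
  have telescope (a b c d e e' : R) :
    a + d - (c + e') = (b - c) + (a - b) + ((e - e') + (d - e)) by ring.
  rewrite (telescope _ (P y) _ _ (Q y)).
  rewrite !mulrDl; apply: (le_trans (ler_normD _ _)); apply: lerD;
    apply: (le_trans (ler_normD _ _)); apply: lerD.
        exact: le_trans h5 k5.
      exact: le_trans h6 k6.
    exact: le_trans h7 k7.
  exact: le_trans h8 k8.
have {}E5 : `|s ^+ 2 / 2 * (laplace chi w - laplace chi x)| <=
    S * (L5 * Bf + L6 * Bg + (L7 * Bf + L8 * Bg)) * dt ^+ 2.
  have sS : s ^+ 2 / 2 = S * dt by rewrite sE /S mulrAC.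
  have assoc (a b c : R) : a * b * c ^+ 2 = a * c * (b * c) by ring.
  by rewrite sS normrM (ger0_norm (mulr_ge0 S0 dt0')) assoc ler_wpM2l// mulr_ge0.
have telescope (H cw cy cx p2y p1 p2 lw p11 p22 fx gx gy v : R) :
    H - cx - dt * (- fx * p1 + gx * p2 + 2^-1 * v * p11 + 2^-1 * v * p22) =
    (H - cw - v * dt / 2 * lw) + (cw - cy - gy * dt * p2y)
    + (cy - cx - - (fx * dt) * p1) + gy * dt * (p2y - p2) + dt * (gy - gx) * p2
    + v * dt / 2 * (lw - (p11 + p22)) by field.
rewrite /generator (telescope _ (chi w) (chi y) _ (pd false chi y) _ _
  (laplace chi w) _ _ _ _ (g (x.1 + al))) -sE.
rewrite 5!mulrDl; do 5 (apply: (le_trans (ler_normD _ _)); apply: lerD => //).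
Qed.

End consistency.

(** * The transition operator of the scheme *)

Lemma geometric_sum_limit {R : realType} (a : nat -> R) (rho M : R) :
  0 <= rho < 1 -> (forall k, `|a k| <= M * rho ^+ k) ->
  exists l, forall n, `|l - \sum_(k < n) a k| <= M / (1 - rho) * rho ^+ n.
Proof.
move=> /andP[rho0 rho1] aM.
have r1 : 0 < 1 - rho by rewrite subr_gt0.
have M0 : 0 <= M by have := le_trans (normr_ge0 _) (aM 0%N); rewrite expr0 mulr1.
pose S n := \sum_(k < n) a k.
have tail n m : `|S (n + m)%N - S n| <= M / (1 - rho) * rho ^+ n.
  suff : `|S (n + m)%N - S n| <= M / (1 - rho) * (rho ^+ n - rho ^+ (n + m)).
    move=> /le_trans; apply; rewrite ler_wpM2l ?divr_ge0 ?(ltW r1)//.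
    by rewrite lerBlDr lerDl exprn_ge0.
  elim: m => [|m IH]; first by rewrite addn0 !subrr normr0 mulr0.
  rewrite addnS /S big_ord_recr /= -/(S (n + m)%N) addrAC.
  apply: (le_trans (ler_normD _ _)); apply: (le_trans (lerD IH (aM _))).
  rewrite le_eqVlt; apply/orP; left; apply/eqP; rewrite exprS; field.
  by rewrite gt_eqF.
have rho_cvg : (fun n => M / (1 - rho) * rho ^+ n) @ \oo --> (0 : R).
  rewrite -[X in _ --> X](mulr0 (M / (1 - rho))); apply: cvgMr.
  by apply: cvg_expr; rewrite ger0_norm.
have cS : cvgn S.
{ have -> : S = series a by apply/funext => n; rewrite /series /S /= big_mkord.
  apply: normed_cvg; apply: (@series_le_cvg _ _ (geometric M rho)).
  - by move=> n; exact: normr_ge0.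
  - by move=> n; rewrite /geometric /= mulr_ge0// exprn_ge0.
  - by move=> n; exact: aM.
  - by apply: is_cvg_geometric_series; rewrite ger0_norm. }
exists (limn S) => n; rewrite distrC.
have tailn : (fun m => `|S n - S m|) @ \oo --> `|S n - limn S|.
  by apply: cvg_norm; apply: cvgB => //; exact: cvg_cst.
apply: (cvgr_to_le tailn); exists n => // m /= nm.
by rewrite distrC -(subnKC nm) tail.
Qed.

Lemma geometric_bound_eq0 {R : realType} (x C rho : R) : 0 <= rho < 1 ->
  (forall n, `|x| <= C * rho ^+ n) -> x = 0.
Proof.
move=> /andP[rho0 rho1] h; apply/eqP; rewrite -normr_le0.
have c0 : (fun n => C * rho ^+ n) @ \oo --> (0 : R).
  rewrite -[X in _ --> X](mulr0 C); apply: cvgM; first exact: cvg_cst.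
  by apply: cvg_expr; rewrite ger0_norm.
apply: (cvgr_to_ge c0); exists 0%N => // n _; exact: h.
Qed.

Lemma addr_pairE {R : realType} (a b c d : R) : (a, b) + (c, d) = (a + c, b + d) :> R * R.
Proof. by []. Qed.

Section transition.
Context {R : realType}.
Local Notation gauss := (normal_prob (0 : R) (1 : R)).
Local Notation circ := (uniform_prob (@ltr01 R)).
Local Notation unif := (circ \x circ)%E.
Local Notation gauss2 := (gauss \x gauss)%E.
Implicit Types (phi psi : R * R -> R) (x z : R * R).

Variables (f g : R -> R) (s dt : R).
Hypotheses (tf : tfun (fun x => f x.2)) (tg : tfun (fun x => g x.1)).
Hypothesis s_gt0 : 0 < s.

Let mf : measurable_fun setT f.
Proof. exact: (bmeas_pair1 tf.1 0).1. Qed.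

Let mg : measurable_fun setT g.
Proof. exact: (bmeas_pair2 tg.1 0).1. Qed.

Lemma measurable_drift : measurable_fun setT (drift f g dt).
Proof.
have m1 : measurable_fun setT (fun x : R * R => x.1 - f x.2 * dt).
  apply: measurable_realfun.measurable_funB => //.
  by apply: measurable_realfun.measurable_funM => //; exact: (measurableT_comp mf).
apply: measurable_fun_pair => //; apply: measurable_realfun.measurable_funD => //.
by apply: measurable_realfun.measurable_funM => //; exact: (measurableT_comp mg m1).
Qed.

Lemma drift_e1 x : drift f g dt (x + e1) = drift f g dt x + e1.
Proof.
have gp a : g (a + 1) = g a by exact: (torus_fun_add1 a 0 tg.2).
case: x => a b; rewrite /e1 addr_pairE /drift /= addr_pairE !addr0.
have -> : a + 1 - f b * dt = a - f b * dt + 1 by ring.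
by rewrite gp.
Qed.

Lemma drift_e2 x : drift f g dt (x + e2) = drift f g dt x + e2.
Proof.
have fp a : f (a + 1) = f a by exact: (torus_fun_add2 0 a tf.2).
case: x => a b; rewrite /e2 addr_pairE /drift /= addr_pairE !addr0.
by rewrite fp addrAC.
Qed.

Lemma tfun_drift phi : tfun phi -> tfun (fun x => phi (drift f g dt x)).
Proof.
move=> [bp [p1 p2]]; split; first exact: bmeas_comp measurable_drift.
by split=> x; rewrite ?drift_e1 ?drift_e2 ?p1 ?p2.
Qed.

(** The drift is a composition of two shears, so it preserves area: this makes
    the uniform law invariant under the scheme. *)
Lemma unif_drift phi : tfun phi -> \int[unif]_x phi (drift f g dt x) = \int[unif]_x phi x.
Proof.
move=> tp; have mgd : measurable_fun setT (fun y => g y * dt).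
  by apply: measurable_realfun.measurable_funM.
have mfd : measurable_fun setT (fun y => - (f y * dt)).
  by apply: measurableT_comp => //; exact: measurable_realfun.measurable_funM.
rewrite -(unif_shear2 tp mgd).
have tsh : tfun (fun x => phi (x.1, x.2 + g x.1 * dt)).
  have [bp tp2] := tp; split.
    apply: (bmeas_comp bp); apply: measurable_fun_pair => //.
    by apply: measurable_realfun.measurable_funD => //; exact: (measurableT_comp mgd).
  have gp a : g (a + 1) = g a by exact: (torus_fun_add1 a 0 tg.2).
  split=> -[a b]; rewrite /e1 /e2 addr_pairE /= !addr0.
    by rewrite gp torus_fun_add1.
  by rewrite addrAC torus_fun_add2.
by rewrite -(unif_shear1 tsh mfd).
Qed.

(** The Markov operator of the scheme when the noise has deviation s. *)
Definition transition phi x := heat s phi (drift f g dt x).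

Lemma tfun_transition phi : tfun phi -> tfun (transition phi).
Proof. by move=> tp; exact/tfun_drift/tfun_heat. Qed.

Lemma unif_transition phi : tfun phi -> \int[unif]_x transition phi x = \int[unif]_x phi x.
Proof. by move=> tp; rewrite (unif_drift (tfun_heat s tp)) unif_heat. Qed.

Lemma transition_gap phi m : tfun phi -> \int[unif]_x phi x = 0 ->
  \int[unif]_x transition phi x ^+ 2 <=
  (1 - gauss_minor (m.+1%:R * s) ^+ 2 / m.+1%:R ^+ 2) * \int[unif]_x phi x ^+ 2.
Proof.
move=> tp p0; rewrite (unif_drift (tfunX 2 (tfun_heat s tp))).
exact: heat_spectral_gap.
Qed.

(** Truncated at zero, so as to be a rate of decay for every s. *)
Definition doeblin_rate : R := Num.max 0 (1 - gauss_minor s ^+ 2).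

Lemma doeblin_rate_itv : 0 <= doeblin_rate < 1.
Proof.
rewrite le_max lexx /= gt_max ltr01 /= ltrBlDr ltrDl exprn_gt0//.
exact: gauss_minor_gt0.
Qed.

Lemma tfun_iter_transition n phi : tfun phi -> tfun (iter n transition phi).
Proof. by move=> tp; elim: n => //= n IH; exact: tfun_transition. Qed.

Lemma unif_iter_transition n phi : tfun phi ->
  \int[unif]_x iter n transition phi x = \int[unif]_x phi x.
Proof.
move=> tp; elim: n => //= n IH; rewrite unif_transition//.
exact: tfun_iter_transition.
Qed.

(** Each step is the Doeblin contraction, evaluated at the drifted point. *)
Lemma iter_transition_mixing phi : tfun phi -> exists M, forall n x,
  `|iter n transition phi x - \int[unif]_y phi y| <= M * doeblin_rate ^+ n.
Proof.
move=> tp; have [_ [M hM]] := tp.1; set t := \int[unif]_y phi y.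
exists (M + `|t|) => n; elim: n => [|n IH] x.
  by rewrite expr0 mulr1 (le_trans (ler_normB _ _))// lerD.
have /andP[r0 _] := doeblin_rate_itv.
have := heat_contraction s_gt0 (tfun_iter_transition n tp) (unif_iter_transition n tp) IH
  (drift f g dt x).
move=> /le_trans; apply; rewrite (exprS doeblin_rate) [leRHS]mulrCA ler_wpM2r//.
  by rewrite mulr_ge0 ?exprn_ge0// addr_ge0// (le_trans _ (hM 0)).
by rewrite le_max lexx orbT.
Qed.

Lemma transitionB phi psi x : bmeas phi -> bmeas psi ->
  transition (fun y => phi y - psi y) x = transition phi x - transition psi x.
Proof. by move=> bp bq; rewrite /transition heatB. Qed.

Lemma transitionD phi psi x : bmeas phi -> bmeas psi ->
  transition (fun y => phi y + psi y) x = transition phi x + transition psi x.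
Proof. by move=> bp bq; rewrite /transition heatD. Qed.

(** The Poisson equation is solved by summing the iterates of phi, which decay
    geometrically since phi has mean zero. *)
Lemma poisson_equation phi : tfun phi -> \int[unif]_x phi x = 0 ->
  exists2 psi, tfun psi & forall x, transition psi x = psi x - phi x.
Proof.
move=> tp p0; have [M hM] := iter_transition_mixing tp.
rewrite p0 in hM; have rho01 := doeblin_rate_itv.
pose S n x := \sum_(k < n) iter k transition phi x.
have tS n : tfun (S n).
  elim: n => [|n IH].
    by rewrite /S; under eq_fun do rewrite big_ord0; exact: tfun_cst.
  rewrite /S; under eq_fun do rewrite big_ord_recr /=.
  by apply: tfunD => //; exact: tfun_iter_transition.
pose C := M / (1 - doeblin_rate).
have /choice[psi hpsi] : forall x, exists l, forall n, `|l - S n x| <= C * doeblin_rate ^+ n.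
  move=> x; apply: (@geometric_sum_limit _ (fun k => iter k transition phi x)) => // k.
  by have := hM k x; rewrite subr0.
have psi_cvg x : (fun n => S n x) @ \oo --> psi x.
  have c0 : (fun n => C * doeblin_rate ^+ n) @ \oo --> (0 : R).
    rewrite -[X in _ --> X](mulr0 C); apply: cvgM; first exact: cvg_cst.
    by have /andP[r0 r1] := rho01; apply: cvg_expr; rewrite ger0_norm.
  apply/cvgrPdist_le => e e0; have := (cvgr_norm_le _ c0); rewrite normr0 => /(_ _ e e0).
  by apply: filterS => n; apply: le_trans; apply: (le_trans (hpsi x n)); exact: ler_norm.
have tpsi : tfun psi.
{ split; first split.
  - apply: (@measurable_realfun.measurable_fun_cvg _ _ _ _ S) => [n|x _]; last exact: psi_cvg.
    exact: (tS n).1.1.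
  - have [_ [B hB]] := (tS 0%N).1; exists (B + C) => x.
    have := hpsi x 0%N; rewrite expr0 mulr1 => h.
    by rewrite -(subrK (S 0%N x) (psi x)) addrC (le_trans (ler_normD _ _))// lerD.
  - split=> x.
      apply: cvg_unique (psi_cvg _) _ => //; rewrite (_ : (fun n => _) = (fun n => S n x)); first exact: psi_cvg.
      by apply/funext => n; rewrite (tS n).2.1.
    apply: cvg_unique (psi_cvg _) _ => //; rewrite (_ : (fun n => _) = (fun n => S n x)); first exact: psi_cvg.
    by apply/funext => n; rewrite (tS n).2.2. }
exists psi => // x; apply/eqP; rewrite -subr_eq0; apply/eqP.
apply: (@geometric_bound_eq0 _ _ (C + C * doeblin_rate) doeblin_rate) => // n.
have SE k y : S k.+1 y = S k y + iter k transition phi y by rewrite /S big_ord_recr.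
have TS : transition (S n) x = S n.+1 x - phi x.
  elim: n => [|n IH].
    rewrite /S big_ord_recl big_ord0 /= addr0 subrr /transition.
    by rewrite (_ : (fun y => _) = (fun=> 0)) ?heat_cst//; apply/funext => y; rewrite big_ord0.
  rewrite (funext (SE n)) transitionD; [|exact: (tS n).1|exact: (tfun_iter_transition n tp).1].
  by rewrite IH (SE n.+1) addrAC.
have -> : transition psi x - (psi x - phi x) =
    transition (fun y => psi y - S n y) x - (psi x - S n.+1 x).
  rewrite transitionB; [|exact: tpsi.1|exact: (tS n).1].
  by rewrite TS; move: (transition psi x) (psi x) (S n.+1 x) (phi x) => p q r' t; ring.
rewrite (le_trans (ler_normB _ _))// mulrDl lerD//.
  by apply: heat_norm_le; [exact: (tfunB tpsi (tS n)).1|move=> y; exact: hpsi].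
by rewrite -mulrA -exprS.
Qed.

End transition.

(** * The martingale corrector *)

Section corrector.
Context {R : realType}.
Local Notation gauss := (normal_prob (0 : R) (1 : R)).
Local Notation circ := (uniform_prob (@ltr01 R)).
Local Notation unif := (circ \x circ)%E.
Local Notation gauss2 := (gauss \x gauss)%E.
Implicit Types (phi psi : R * R -> R) (x z : R * R).

Lemma gauss2_integrable_fst (k : R -> R) : gauss.-integrable setT (EFin \o k) ->
  gauss2.-integrable setT (EFin \o (fun z => k z.1)).
Proof.
move=> ik; have mk := measurable_int _ ik.
apply/integrable12ltyP; first exact: (measurableT_comp mk measurable_fst).
have /integrableP[_] := ik; congr (_ < _)%E; apply: eq_integral => x _.
by rewrite /= integral_cst// [X in (_ * X)%E](@probability_setT _ _ _ gauss) mule1.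
Qed.

Lemma gauss2_int_fst (k : R -> R) : gauss.-integrable setT (EFin \o k) ->
  \int[gauss2]_z k z.1 = \int[gauss]_a k a.
Proof.
move=> ik; have ik2 := gauss2_integrable_fst ik.
rewrite /Rintegral -(integral12_prod_meas1 ik2); congr fine; apply: eq_integral => x _.
by rewrite /fubini_F /= integral_cst// [X in (_ * X)%E](@probability_setT _ _ _ gauss) mule1.
Qed.

Variables (f g : R -> R) (s dt : R).
Hypotheses (tf : tfun (fun x => f x.2)) (tg : tfun (fun x => g x.1)).
Hypothesis s_gt0 : 0 < s.
Variable c : R * R -> R.
Hypotheses (tc : tfun c)
  (Pc : forall x, transition f g s dt c x = c x + dt * f x.2).

Local Notation P := (transition f g s dt).

(** A martingale along the scheme: by the equation for c the expected increment of
    c compensates the displacement - dt f of the first coordinate. *)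
Let V x := x.1 + c x.

Let X x z := c (drift f g dt x + scal s z).

Let bX x : bmeas (X x). Proof. exact: bmeas_heat_integrand tc.1. Qed.

Let iw : gauss2.-integrable setT (EFin \o (fun z : R * R => s * z.1)).
Proof. exact/integrable_EFinZ/(gauss2_integrable_fst (@gauss_integrable_id R)). Qed.

Let iw2 : gauss2.-integrable setT (EFin \o (fun z : R * R => (s * z.1) ^+ 2)).
Proof.
have := integrable_EFinZ (s ^+ 2) (gauss2_integrable_fst (@gauss_integrable_sqr R)).
by congr (is_true (integrable _ _ _)); apply/funext => z /=; rewrite exprMn.
Qed.

Let int_w : \int[gauss2]_z (s * z.1) = 0.
Proof.
have := RintegralZl s (measurableT) (gauss2_integrable_fst (@gauss_integrable_id R)) => ->.
by rewrite (gauss2_int_fst (@gauss_integrable_id R)) gauss_int_id mulr0.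
Qed.

Let int_w2 : \int[gauss2]_z (s * z.1) ^+ 2 = s ^+ 2.
Proof.
under eq_Rintegral do rewrite exprMn.
have i2 := gauss2_integrable_fst (@gauss_integrable_sqr R).
rewrite (RintegralZl (s ^+ 2) measurableT i2) (gauss2_int_fst (@gauss_integrable_sqr R)).
by rewrite gauss_int_sqr mulr1.
Qed.

Let iwX (d : R * R -> R) : bmeas d ->
  gauss2.-integrable setT (EFin \o (fun z => s * z.1 * d z)).
Proof.
move=> [md [M hM]]; apply: (le_integrable _ _ _ (integrable_EFinZ M iw)) => //.
  apply/measurable_EFinP; apply: measurable_realfun.measurable_funM => //.
  by apply/measurable_EFinP; exact: measurable_int iw.
move=> z _ /=; rewrite lee_fin normrM mulrC (normrM M) ler_wpM2r//.
by rewrite (le_trans (hM z))// ler_norm.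
Qed.

(** Conditional variance, from x, of the increment of the martingale V. *)
Definition increment_variance x : R :=
  \int[gauss2]_z (s * z.1 + (c (drift f g dt x + scal s z) - P c x)) ^+ 2.

Let bd x : bmeas (fun z => X x z - P c x).
Proof. by apply: bmeasB => //; exact: bmeas_cst. Qed.

Let id2 x : gauss2.-integrable setT (EFin \o (fun z => (X x z - P c x) ^+ 2)).
Proof. by have h := bmeasX 2 (bd x); exact: (bmeas_integrable gauss2 h). Qed.

Let i_inc x : gauss2.-integrable setT
  (EFin \o (fun z => (s * z.1 + (X x z - P c x)) ^+ 2)).
Proof.
have := integrable_EFinD (integrable_EFinD iw2 (integrable_EFinZ 2 (iwX (bd x)))) (id2 x).
congr (is_true (integrable _ _ _)); apply/funext => z /=; congr _%:E.
by move: (X x z - P c x) (s * z.1) => a b; ring.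
Qed.

Lemma increment_variance_ge0 x : 0 <= increment_variance x.
Proof. by apply: Rintegral_ge0 => z _; exact: sqr_ge0. Qed.

Lemma tfun_increment_variance : tfun increment_variance.
Proof.
have tP := tfun_transition s dt tf tg tc.
split; first split.
- apply: (measurable_Rintegral gauss2 (phi := fun p : (R * R) * (R * R) =>
    (s * p.2.1 + (c (drift f g dt p.1 + scal s p.2) - P c p.1)) ^+ 2)).
  apply: measurable_realfun.measurable_funX; apply: measurable_realfun.measurable_funD.
    apply: measurable_realfun.measurable_funM => //.
    exact: (measurableT_comp measurable_fst measurable_snd).
  apply: measurable_realfun.measurable_funB; last exact: (measurableT_comp tP.1.1 measurable_fst).
  apply: (measurableT_comp tc.1.1); apply: measurable_fun_pairD.
    exact: (measurableT_comp (measurable_drift dt tf tg) measurable_fst).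
  exact: (measurable_fun_scal s measurable_snd).
- have [_ [B hB]] := tc.1.
  exists (2 * s ^+ 2 + 2 * (B + B) ^+ 2) => x.
  rewrite ger0_norm ?increment_variance_ge0//.
  have ib := integrable_EFinD (integrable_EFinZ 2 iw2)
    (bmeas_integrable gauss2 (bmeas_cst _ (2 * (B + B) ^+ 2))).
  have -> : 2 * s ^+ 2 + 2 * (B + B) ^+ 2 =
      \int[gauss2]_z (2 * (s * z.1) ^+ 2 + 2 * (B + B) ^+ 2).
    have ic := bmeas_integrable gauss2 (bmeas_cst (R * R)%type (2 * (B + B) ^+ 2)).
    rewrite (RintegralD measurableT (integrable_EFinZ 2 iw2) ic).
    by rewrite Rintegral_prob_cst (RintegralZl 2 measurableT iw2) int_w2.
  apply: (le_Rintegral measurableT (i_inc x) ib) => z _.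
  have hd : `|X x z - P c x| <= B + B.
    apply: (le_trans (ler_normB _ _)); apply: lerD; first exact: hB.
    exact: heat_norm_le tc.1 hB.
  have hd2 : (X x z - P c x) ^+ 2 <= (B + B) ^+ 2.
    by rewrite -(real_normK (num_real (X x z - P c x))) ler_pXn2r// nnegrE// (le_trans _ hd).
  have ineq (a b e : R) : a ^+ 2 <= e ^+ 2 -> (b + a) ^+ 2 <= 2 * b ^+ 2 + 2 * e ^+ 2.
    by move=> h; have := sqr_ge0 (b - a); nra.
  exact: ineq hd2.
- have [p1 p2] := tP.2; have [c1 c2] := tc.2.
  split=> x; apply: eq_Rintegral => z _.
    by rewrite p1 (drift_e1 _ _ tg) addrAC c1.
  by rewrite p2 (drift_e2 _ _ tf) addrAC c2.
Qed.

(** The increment of V has mean zero, so the cross term vanishes. *)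
Lemma corrector_second_moment x :
  (\int[gauss2]_z ((V (drift f g dt x + scal s z)) ^+ 2)%:E =
   (V x ^+ 2 + increment_variance x)%:E)%E.
Proof.
pose inc z := s * z.1 + (X x z - P c x).
have VE z : V (drift f g dt x + scal s z) = V x + inc z.
  have regroup (a b q e w : R) : a - b * dt + w + e = a + q + (w + (e - (q + dt * b))) by ring.
  rewrite /V /inc Pc -regroup -/(X x z).
  by rewrite (_ : (drift f g dt x + scal s z).1 = x.1 - f x.2 * dt + s * z.1).
have ii : gauss2.-integrable setT (EFin \o inc).
  exact: integrable_EFinD iw (bmeas_integrable gauss2 (bd x)).
have i1 := bmeas_integrable gauss2 (bmeas_cst (R * R)%type (V x ^+ 2)).
have i2 := integrable_EFinZ (2 * V x) ii.
have iall := integrable_EFinD (integrable_EFinD i1 i2) (i_inc x).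
have -> : (\int[gauss2]_z ((V (drift f g dt x + scal s z)) ^+ 2)%:E =
    (\int[gauss2]_z (V x ^+ 2 + 2 * V x * inc z + inc z ^+ 2))%:E)%E.
  rewrite /Rintegral fineK; last exact: integrable_fin_num iall.
  by apply: eq_integral => z _; rewrite VE; congr _%:E; move: (V x) (inc z) => a b; ring.
congr _%:E; rewrite (RintegralD measurableT (integrable_EFinD i1 i2) (i_inc x)).
rewrite (RintegralD measurableT i1 i2) Rintegral_prob_cst (RintegralZl _ measurableT ii).
rewrite (RintegralD measurableT iw (bmeas_integrable gauss2 (bd x))) int_w.
rewrite (bmeas_intB gauss2 (bX x) (bmeas_cst _ (P c x))) Rintegral_prob_cst.
by rewrite -/(heat s c (drift f g dt x)) subrr addr0 mulr0 addr0.
Qed.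

(** Covariance, from x, of the noise and of c after one step. *)
Let Q x := \int[gauss2]_z (s * z.1 * X x z).

Let bQ : bmeas Q.
Proof.
split.
  apply: (measurable_Rintegral gauss2 (phi := fun p : (R * R) * (R * R) =>
    s * p.2.1 * c (drift f g dt p.1 + scal s p.2))).
  apply: measurable_realfun.measurable_funM.
    apply: measurable_realfun.measurable_funM => //.
    exact: (measurableT_comp measurable_fst measurable_snd).
  apply: (measurableT_comp tc.1.1); apply: measurable_fun_pairD.
    exact: (measurableT_comp (measurable_drift dt tf tg) measurable_fst).
  exact: (measurable_fun_scal s measurable_snd).
have [_ [B hB]] := tc.1.
have in1 : gauss2.-integrable setT (EFin \o (fun z : R * R => `|s * z.1|)).
  exact: integrable_norm iw.
exists (B * \int[gauss2]_z `|s * z.1|) => x.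
apply: (le_trans (le_normr_Rintegral measurableT (iwX (bX x)))).
rewrite -(RintegralZl B measurableT in1).
apply: (le_Rintegral measurableT); [exact: integrable_norm (iwX (bX x))|exact: integrable_EFinZ in1|].
by move=> z _; rewrite normrM mulrC ler_wpM2r// hB.
Qed.

(** The noise is uncorrelated with c after one step, once x is averaged over the
    torus: the map z |-> mean of c (drift x + s z) over x is constant. *)
Let unif_Q : \int[unif]_x Q x = 0.
Proof.
have [_ [B hB]] := tc.1.
have in1 : gauss2.-integrable setT (EFin \o (fun z : R * R => B * `|s * z.1|)).
  exact/integrable_EFinZ/integrable_norm/iw.
pose Phi (p : (R * R) * (R * R)) := s * p.2.1 * c (drift f g dt p.1 + scal s p.2).
have mPhi : measurable_fun setT Phi.
  apply: measurable_realfun.measurable_funM.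
    apply: measurable_realfun.measurable_funM => //.
    exact: (measurableT_comp measurable_fst measurable_snd).
  apply: (measurableT_comp tc.1.1); apply: measurable_fun_pairD.
    exact: (measurableT_comp (measurable_drift dt tf tg) measurable_fst).
  exact: (measurable_fun_scal s measurable_snd).
have hPhi x z : `|Phi (x, z)| <= B * `|s * z.1|.
  by rewrite /Phi /= normrM mulrC ler_wpM2r// hB.
have E1 := @dominated_int1 _ _ _ _ _ unif gauss2 Phi _ mPhi in1 hPhi.
have E2 := @dominated_int2 _ _ _ _ _ unif gauss2 Phi _ mPhi in1 hPhi.
have QE : (fun x => Q x) = (fun x => \int[gauss2]_z Phi (x, z)) by apply/funext.
rewrite QE -E1 E2; transitivity (\int[gauss2]_z ((\int[unif]_x c x) * (s * z.1))).
  apply: eq_Rintegral => z _; have tz := tfun_translate (scal s z) tc.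
  rewrite /Phi /= bmeas_intZ; last exact: (tfun_drift dt tf tg tz).1.
  by rewrite (unif_drift dt tf tg tz) (unif_translate _ tc) mulrC.
by rewrite (RintegralZl _ measurableT iw) int_w mulr0.
Qed.

(** Expand the square. By invariance the mean of P (c ^ 2) is that of c ^ 2, and
    the mean of (P c) ^ 2 is that of (c + dt f) ^ 2. *)
Lemma unif_increment_variance : \int[unif]_x increment_variance x =
  s ^+ 2 - 2 * dt * \int[unif]_x (c x * f x.2) - dt ^+ 2 * \int[unif]_x (f x.2 ^+ 2).
Proof.
have tc2 := tfunX 2 tc; have tPc2 := tfun_transition s dt tf tg tc2.
have hE x : increment_variance x = (s ^+ 2 + 2 * Q x) + (P (fun y => c y ^+ 2) x - P c x ^+ 2).
  rewrite /increment_variance; set m := P c x.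
  have i1 := iwX (bX x); have i2 := integrable_EFinZ 2 i1.
  have bX2 := bmeasX 2 (bX x); have bmX := bmeasZ (2 * m) (bX x).
  have bcm := bmeas_cst (R * R)%type (m ^+ 2).
  have brest := bmeasD (bmeasB bX2 bmX) bcm.
  have i3 := integrable_EFinZ (2 * m) iw.
  have i4 := integrable_EFinB (integrable_EFinD iw2 i2) i3.
  transitivity (\int[gauss2]_z (((s * z.1) ^+ 2 + 2 * (s * z.1 * X x z)
      - 2 * m * (s * z.1)) + (X x z ^+ 2 - 2 * m * X x z + m ^+ 2))).
    apply: eq_Rintegral => z _; rewrite -/(X x z).
    by move: (X x z) (s * z.1) => a b; ring.
  rewrite (RintegralD measurableT i4 (bmeas_integrable gauss2 brest)).
  rewrite (RintegralB measurableT (integrable_EFinD iw2 i2) i3).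
  rewrite (RintegralD measurableT iw2 i2) (RintegralZl 2 measurableT i1).
  rewrite (RintegralZl (2 * m) measurableT iw) int_w int_w2 mulr0 subr0.
  rewrite (bmeas_intD gauss2 (bmeasB bX2 bmX) bcm) (bmeas_intB gauss2 bX2 bmX).
  rewrite Rintegral_prob_cst (bmeas_intZ gauss2 (2 * m) (bX x)).
  rewrite -/(Q x) -/(heat s c (drift f g dt x)) -/(heat s (fun y => c y ^+ 2) (drift f g dt x)).
  rewrite -/(P c x) -/m -/(P (fun y => c y ^+ 2) x).
  have regroup (a b e n : R) : a + 2 * b + (e - 2 * n * n + n ^+ 2) = a + 2 * b + (e - n ^+ 2) by ring.
  exact: regroup.
under eq_Rintegral do rewrite hE.
have b2Q := bmeasZ 2 bQ; have bs := bmeas_cst (R * R)%type (s ^+ 2).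
have tq := tfunD tc (tfunZ dt tf).
have bPc2 : bmeas (fun x => P c x ^+ 2) by apply/bmeasX/(tfun_transition s dt tf tg tc).1.
rewrite (bmeas_intD unif (bmeasD bs b2Q) (bmeasB tPc2.1 bPc2)).
rewrite (bmeas_intD unif bs b2Q) (bmeas_intB unif tPc2.1 bPc2) Rintegral_prob_cst.
rewrite (bmeas_intZ unif 2 bQ) unif_Q mulr0 addr0 (unif_transition s dt tf tg tc2).
have bcf := bmeasZ (2 * dt) (bmeasM tc.1 tf.1).
have bff := bmeasZ (dt ^+ 2) (bmeasX 2 tf.1).
have -> : \int[unif]_x P c x ^+ 2 =
    \int[unif]_x ((c x ^+ 2 + 2 * dt * (c x * f x.2)) + dt ^+ 2 * f x.2 ^+ 2).
  by apply: eq_Rintegral => x _; rewrite Pc; move: (c x) (f x.2) => a b; ring.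
rewrite (bmeas_intD unif (bmeasD tc2.1 bcf) bff) (bmeas_intD unif tc2.1 bcf).
rewrite (bmeas_intZ unif _ (bmeasM tc.1 tf.1)) (bmeas_intZ unif _ (bmeasX 2 tf.1)).
by move: (\int[unif]_x c x ^+ 2) (\int[unif]_x (c x * f x.2)) (\int[unif]_x f x.2 ^+ 2) => p q r; ring.
Qed.

End corrector.

(** * Accuracy of the corrector *)

Section accuracy.
Context {R : realType}.
Local Notation gauss := (normal_prob (0 : R) (1 : R)).
Local Notation circ := (uniform_prob (@ltr01 R)).
Local Notation unif := (circ \x circ)%E.
Implicit Types (phi psi u : R * R -> R) (x z : R * R).

(** The increments of u over a translation by t have mean zero, and are t times the
    derivative up to order t ^ 2. *)
Lemma unif_pd u b : smooth_torus u -> \int[unif]_x pd b u x = 0.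
Proof.
move=> su; have [M M0 hM] := smooth_torus_taylor2 b su.
have tu := smooth_torus_tfun su; have td := smooth_torus_tfun (smooth_torus_pd b su).
set I := \int[unif]_x pd b u x.
have key (t : R) : 0 < t -> `|I| <= M * t.
  move=> t0; rewrite -(ler_pM2l t0) -{1}(gtr0_norm t0) -normrM mulrCA -expr2.
  have tt := tfun_translate (t *: axis b) tu.
  have E : - (t * I) = \int[unif]_x (u (x + t *: axis b) - u x - t * pd b u x).
    rewrite (bmeas_intB unif (bmeasB tt.1 tu.1) (bmeasZ t td.1)).
    rewrite (bmeas_intB unif tt.1 tu.1) (bmeas_intZ unif t td.1) (unif_translate _ tu).
    by rewrite subrr sub0r.
  rewrite -normrN E; apply: bmeas_int_norm_le; last by move=> x; exact: hM.
  exact: (bmeasB (bmeasB tt.1 tu.1) (bmeasZ t td.1)).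
apply/eqP; rewrite -normr_le0; apply: (@le_of_le_eps _ _ _ M) => t t0 _.
by rewrite add0r mulrC; exact: key.
Qed.

(** A lower bound, per unit of time and uniform in the step, for the spectral gap
    of the scheme. *)
Definition gap_rate (sigma : R) : R := (normal_pdf 0 1 (2 / sigma) / sigma) ^+ 2.

Lemma gap_rate_gt0 (sigma : R) : 0 < sigma -> 0 < gap_rate sigma.
Proof.
move=> s0; rewrite exprn_gt0// divr_gt0// normal_pdf0E// invr1 mul1r.
by rewrite mulr_gt0 ?expR_gt0 ?normal_peak_gt0.
Qed.

(** Magnifying displacements of size sigma sqrt dt about 1 / sqrt dt times makes
    them comparable with sigma, and costs a factor of order dt. *)
Lemma gap_rate_le (sigma dt : R) : 0 < sigma -> 0 < dt < 1 ->
  exists m, gap_rate sigma * dt <=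
    gauss_minor (m.+1%:R * (sigma * Num.sqrt dt)) ^+ 2 / m.+1%:R ^+ 2.
Proof.
move=> s0 /andP[dt0 dt1]; set q := Num.sqrt dt.
have q0 : 0 < q by rewrite sqrtr_gt0.
have qq : q ^+ 2 = dt by rewrite sqr_sqrtr// ltW.
have q1 : q < 1 by rewrite -(ltr_pXn2r (n := 2)) ?nnegrE ?(ltW q0)// qq expr1n.
have iq0 : 0 <= q^-1 by rewrite invr_ge0 ltW.
have := truncn_itv iq0; set n := Num.truncn q^-1; move=> /andP[n1 n2].
have n0 : (0 < n)%N.
  by rewrite truncn_gt0 -[leLHS]invr1 lef_pV2 ?posrE// ltW.
exists n.-1; rewrite prednK//; have nR0 : 0 < n%:R :> R by rewrite ltr0n.
have nq1 : n%:R * q <= 1 by rewrite -ler_pdivlMr// div1r.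
have nq2 : 1 <= 2 * (n%:R * q).
  have h : 1 < n.+1%:R * q by rewrite -ltr_pdivrMr// div1r.
  apply: (le_trans (ltW h)); rewrite mulrA ler_wpM2r ?(ltW q0)//.
  by rewrite -natrM ler_nat mul2n -addnn -addn1 leq_add2l.
set r := n%:R * (sigma * q).
have r0 : 0 < r by rewrite !mulr_gt0.
have r1 : r <= sigma.
  by rewrite /r mulrCA -[leRHS]mulr1 ler_wpM2l// ltW.
have r2 : r^-1 <= 2 / sigma.
  have sr : sigma <= 2 * r.
    by rewrite (_ : 2 * r = sigma * (2 * (n%:R * q))) ?ler_peMr ?(ltW s0)// /r; ring.
  by rewrite ler_pdivlMr// mulrC ler_pdivrMr.
have h : normal_pdf 0 1 (2 / sigma) / sigma <= gauss_minor r.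
  rewrite /gauss_minor ler_pM ?normal_pdf_ge0 ?invr_ge0 ?(ltW s0)//; last first.
    by rewrite lef_pV2.
  rewrite !normal_pdf0E// ler_wpM2l ?mulr_ge0 ?invr_ge0 ?normal_peak_ge0// ler_expR.
  rewrite !mulNr lerN2 ler_wpM2r ?invr_ge0 ?mulrn_wge0 ?exprn_ge0//.
  by rewrite ler_pXn2r ?nnegrE ?divr_ge0 ?invr_ge0 ?(ltW r0) ?(ltW s0).
have b0 : 0 <= normal_pdf 0 1 (2 / sigma) / sigma by rewrite divr_ge0 ?normal_pdf_ge0// ltW.
rewrite ler_pM ?sqr_ge0 ?(ltW dt0)//; first by rewrite ler_pXn2r ?nnegrE// (le_trans b0).
rewrite -div1r ler_pdivlMr ?exprn_gt0// mulrC -qq -exprMn.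
by rewrite exprn_ile1// mulr_ge0 ?ltW.
Qed.

Section mean_square.
Variables (f g : R -> R) (s dt k K : R).
Hypotheses (tf : tfun (fun x => f x.2)) (tg : tfun (fun x => g x.1)).
Hypotheses (dt_itv : 0 < dt < 1) (k_gt0 : 0 < k).
Hypothesis gap : forall phi, tfun phi -> \int[unif]_x phi x = 0 ->
  \int[unif]_x transition f g s dt phi x ^+ 2 <= (1 - k * dt) * \int[unif]_x phi x ^+ 2.

(** By the gap, inverting the generator of the scheme loses a factor 1 / dt. *)
Lemma mean_square_error psi : tfun psi -> \int[unif]_x psi x = 0 ->
  (forall x, `|transition f g s dt psi x - psi x| <= K * dt ^+ 2) ->
  \int[unif]_x psi x ^+ 2 <= (2 / k + 4 / k ^+ 2) * K ^+ 2 * dt ^+ 2.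
Proof.
move=> tp p0 hK; have /andP[dt0 dt1] := dt_itv.
set A := \int[unif]_x psi x ^+ 2; have gA := gap tp p0; rewrite -/A in gA.
have tP := tfun_transition s dt tf tg tp.
(* Young's inequality, with a weight eta that uses up half of the gap. *)
pose eta := k * dt / 2; have eta0 : 0 < eta by rewrite divr_gt0// mulr_gt0.
have bP2 := bmeasX 2 tP.1; have bK := bmeas_cst (R * R)%type ((1 + eta^-1) * (K * dt ^+ 2) ^+ 2).
have h1 : A <= (1 + eta) * ((1 - k * dt) * A) + (1 + eta^-1) * (K * dt ^+ 2) ^+ 2.
  apply: (@le_trans _ _ (\int[unif]_x ((1 + eta) * transition f g s dt psi x ^+ 2
      + (1 + eta^-1) * (K * dt ^+ 2) ^+ 2))).
    apply: bmeas_int_le; first exact: bmeasX tp.1.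
      exact: bmeasD (bmeasZ _ bP2) bK.
    move=> x; move: (hK x); move: (transition f g s dt psi x) (psi x) => p e h.
    have h2 : (p - e) ^+ 2 <= (K * dt ^+ 2) ^+ 2.
      by rewrite -(real_normK (num_real (p - e))) ler_pXn2r// nnegrE// (le_trans _ h).
    have h3 : (1 + eta^-1) * (p - e) ^+ 2 <= (1 + eta^-1) * (K * dt ^+ 2) ^+ 2.
      by rewrite ler_wpM2l// addr_ge0// invr_ge0 ltW.
    apply: le_trans (_ : (1 + eta) * p ^+ 2 + (1 + eta^-1) * (p - e) ^+ 2 <= _); last by rewrite lerD2l.
    rewrite -subr_ge0 (_ : _ - _ = eta^-1 * (eta * p + (p - e)) ^+ 2); last by field; rewrite gt_eqF.
    by rewrite mulr_ge0 ?sqr_ge0// invr_ge0 ltW.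
  rewrite (bmeas_intD unif (bmeasZ _ bP2) bK) Rintegral_prob_cst (bmeas_intZ unif _ bP2).
  by rewrite lerD2r ler_wpM2l// addr_ge0// ltW.
have A0 : 0 <= A by apply: Rintegral_ge0 => x _; exact: sqr_ge0.
have h2 : eta * A <= (1 + eta^-1) * (K * dt ^+ 2) ^+ 2.
  have kd : k * dt = 2 * eta by rewrite /eta; field.
  have e2 : 0 <= eta ^+ 2 * A by rewrite mulr_ge0// sqr_ge0.
  move: h1; rewrite kd; set D := (1 + eta^-1) * _; nra.
have h3 : A <= (eta^-1 + eta ^- 2) * (K * dt ^+ 2) ^+ 2.
  rewrite -(ler_pM2l eta0); apply: (le_trans h2).
  rewrite le_eqVlt; apply/orP; left; apply/eqP; field.
  by rewrite gt_eqF.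
apply: (le_trans h3); rewrite [leRHS]mulrAC.
have -> : (eta^-1 + eta ^- 2) * (K * dt ^+ 2) ^+ 2 =
    (2 / k * dt + 4 / k ^+ 2) * dt ^+ 2 * K ^+ 2.
  by rewrite /eta; field; rewrite !gt_eqF.
rewrite ler_wpM2r ?sqr_ge0// ler_wpM2r ?sqr_ge0// lerD2r ler_piMr ?(ltW dt1)//.
by rewrite divr_ge0// ltW.
Qed.

End mean_square.

(** The corrector c solves for the scheme the equation that chi solves for the
    diffusion. By the local error the transition moves e = c - chi by order
    dt ^ 2 only; with the spectral gap of order dt this bounds the mean square of
    e, up to its mean, by order dt ^ 2. As f has mean zero, the means of c f and
    chi f then differ by order dt. *)
Lemma effective_diffusivity (f g : R -> R) (sigma : R) chi :
  smooth_torus (fun x => f x.2) -> smooth_torus (fun x => g x.1) -> smooth_torus chi ->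
  0 < sigma -> \int[unif]_x f x.2 = 0 ->
  (forall x, generator f g sigma chi x = f x.2) ->
  exists2 C, 0 < C & forall dt, 0 < dt < 1 -> let s := sigma * Num.sqrt dt in
    exists c, [/\ tfun c, forall x, transition f g s dt c x = c x + dt * f x.2 &
      `|(\int[unif]_x increment_variance f g s dt c x) / dt
        - (sigma ^+ 2 - 2 * \int[unif]_x (chi x * f x.2))| <= C * dt].
Proof.
move=> sf sg sc sigma0 f0 gen; have tf := smooth_torus_tfun sf.
have tg := smooth_torus_tfun sg; have tchi := smooth_torus_tfun sc.
have [K K0 hK] := local_error sigma sf sg sc.
have [B B0 hB] := smooth_torus_bounded sf.
set k := gap_rate sigma; have k0 : 0 < k by exact: gap_rate_gt0.
pose D := (2 / k + 4 / k ^+ 2) * K ^+ 2.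
have D0 : 0 <= D.
  by rewrite mulr_ge0 ?sqr_ge0// addr_ge0// divr_ge0 ?sqr_ge0// ltW.
exists (D + 2 * B ^+ 2 + 1); first by rewrite ltr_wpDl// addr_ge0// mulr_ge0// sqr_ge0.
move=> dt dtI s; have /andP[dt0 dt1] := dtI.
have s0 : 0 < s by rewrite mulr_gt0// sqrtr_gt0.
have sE : s ^+ 2 = sigma ^+ 2 * dt by rewrite exprMn sqr_sqrtr// ltW.
have [psi tpsi Ppsi] := poisson_equation dt tf tg s0 tf f0.
pose c x := - dt * psi x; have tc : tfun c by exact: tfunZ.
have Pc x : transition f g s dt c x = c x + dt * f x.2.
  have -> : transition f g s dt c x = - dt * transition f g s dt psi x.
    exact: (heatZ s (- dt) _ tpsi.1).
  by rewrite Ppsi /c; move: (psi x) (f x.2) => p q; ring.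
exists c; split=> //.
pose e0 x := c x - chi x; have te0 : tfun e0 by exact: tfunB.
pose mu0 := \int[unif]_x e0 x; pose e x := e0 x - mu0.
have te : tfun e by exact: tfunB te0 (tfun_cst mu0).
have Ie : \int[unif]_x e x = 0.
  by rewrite (bmeas_intB unif te0.1 (bmeas_cst _ mu0)) Rintegral_prob_cst subrr.
have gap phi : tfun phi -> \int[unif]_x phi x = 0 ->
    \int[unif]_x transition f g s dt phi x ^+ 2 <= (1 - k * dt) * \int[unif]_x phi x ^+ 2.
  move=> tp p0; have [m hm] := gap_rate_le sigma0 dtI.
  apply: (le_trans (transition_gap dt tf tg s0 m tp p0)); apply: ler_wpM2r.
    by apply: Rintegral_ge0 => x _; exact: sqr_ge0.
  by rewrite lerD2l lerN2.
have Pe x : `|transition f g s dt e x - e x| <= K * dt ^+ 2.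
  have -> : transition f g s dt e x = transition f g s dt c x - transition f g s dt chi x - mu0.
    have h1 := transitionB f g s dt x te0.1 (bmeas_cst _ mu0).
    have h2 := transitionB f g s dt x tc.1 tchi.1.
    by rewrite -h2 -[mu0 in RHS](heat_cst s mu0 (drift f g dt x)).
  have := hK s dt x dt0 sE; rewrite gen -/(transition f g s dt chi x) Pc /e /e0.
  rewrite -normrN; congr (`|_| <= _).
  by move: (transition f g s dt chi x) (chi x) (c x) (f x.2) => p q r t; ring.
have hA := mean_square_error tf tg dtI k0 gap te Ie Pe; rewrite -/D in hA.
set A := \int[unif]_x e x ^+ 2 in hA.
have bf2 := bmeasX 2 tf.1; have bef := bmeasM te.1 tf.1; have be2 := bmeasX 2 te.1.
have bcf := bmeasM tc.1 tf.1; have bchif := bmeasM tchi.1 tf.1.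
set FF := \int[unif]_x f x.2 ^+ 2.
have hF : 0 <= FF <= B ^+ 2.
  apply/andP; split; first by apply: Rintegral_ge0 => x _; exact: sqr_ge0.
  rewrite -(Rintegral_prob_cst unif (B ^+ 2)).
  apply: (bmeas_int_le unif bf2 (bmeas_cst _ (B ^+ 2))) => x.
  rewrite -(real_normK (num_real (f x.2))) ler_pXn2r ?nnegrE//; exact: hB x.
have Ief : \int[unif]_x (e x * f x.2) =
    \int[unif]_x (c x * f x.2) - \int[unif]_x (chi x * f x.2).
  have bm := bmeasZ mu0 tf.1.
  transitivity (\int[unif]_x (c x * f x.2 - chi x * f x.2) - \int[unif]_x (mu0 * f x.2)).
    rewrite -(bmeas_intB unif (bmeasB bcf bchif) bm); apply: eq_Rintegral => x _.
    by rewrite /e /e0 !mulrBl.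
  by rewrite (bmeas_intZ unif mu0 tf.1) f0 mulr0 subr0 (bmeas_intB unif bcf bchif).
(* Young's inequality with weight dt, as the mean square A of e is of order dt^2. *)
have hef : `|2 * \int[unif]_x (e x * f x.2)| <= D * dt + dt * FF.
  have bl := bmeasD (bmeasZ dt^-1 be2) (bmeasZ dt bf2).
  have El : \int[unif]_x (dt^-1 * e x ^+ 2 + dt * f x.2 ^+ 2) = dt^-1 * A + dt * FF.
    by rewrite (bmeas_intD unif (bmeasZ _ be2) (bmeasZ _ bf2)) !bmeas_intZ.
  have hl : dt^-1 * A <= D * dt by rewrite mulrC ler_pdivrMr// -mulrA -expr2.
  apply: (@le_trans _ _ (dt^-1 * A + dt * FF)); last by rewrite lerD2r.
  rewrite -(bmeas_intZ unif 2 bef) -El.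
  have square (a b t : R) : t != 0 -> t^-1 * a ^+ 2 + t * b ^+ 2 + 2 * (a * b) = t^-1 * (a + t * b) ^+ 2.
    by move=> t0; field.
  have bs := bmeasZ 2 bef.
  have pos a b : 0 <= dt^-1 * a ^+ 2 + dt * b ^+ 2 + 2 * (a * b).
    by rewrite square ?gt_eqF// mulr_ge0 ?sqr_ge0// invr_ge0 ltW.
  rewrite ler_norml; apply/andP; split.
    rewrite -mulN1r -(bmeas_intZ unif (-1) bl); apply: (bmeas_int_le unif (bmeasZ (-1) bl) bs) => x.
    by have := pos (e x) (f x.2); rewrite mulN1r; move: (e x) (f x.2) => p q; lra.
  apply: (bmeas_int_le unif bs bl) => x.
  have := pos (e x) (- f x.2); rewrite mulrN mulrN sqrrN.
  by move: (e x) (f x.2) => p q; lra.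
have -> : (\int[unif]_x increment_variance f g s dt c x) / dt -
    (sigma ^+ 2 - 2 * \int[unif]_x (chi x * f x.2)) =
    - (2 * \int[unif]_x (e x * f x.2) + dt * FF).
  rewrite (unif_increment_variance tf tg tc Pc) sE Ief -/FF.
  move: (\int[unif]_x (c x * f x.2)) (\int[unif]_x (chi x * f x.2)) => p q.
  by field; rewrite gt_eqF.
rewrite normrN (le_trans (ler_normD _ _))//.
have /andP[F0 FB] := hF.
rewrite (ger0_norm (mulr_ge0 (ltW dt0) F0)) (le_trans (lerD hef (lexx _)))//.
have dB : dt * FF <= dt * B ^+ 2 by rewrite ler_wpM2l// ltW.
have -> : (D + 2 * B ^+ 2 + 1) * dt = D * dt + dt * B ^+ 2 + dt * B ^+ 2 + dt by ring.
by rewrite ler_wpDr ?(ltW dt0)// lerD// lerD2l.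
Qed.

End accuracy.

(** * The scheme as a Markov chain *)

(** Identities between probabilities extend from rectangles to all measurable
    sets of a product, since rectangles form a generating system closed under
    intersection. *)
Lemma rectangle_extension {R : realType} d d1 d2 (T : measurableType d)
    (T1 : measurableType d1) (T2 : measurableType d2) (P : probability T R)
    (U : T -> T1) (W : T -> T2) (E : set T) (c : {nonneg R}) :
  measurable_fun setT U -> measurable_fun setT W -> measurable E ->
  (forall A B, measurable A -> measurable B ->
    P (U @^-1` A `&` W @^-1` B `&` E) = (c%:num%:E * P (U @^-1` A `&` W @^-1` B))%E) ->
  forall D, measurable D ->
    P ((fun w => (U w, W w)) @^-1` D `&` E) =
    (c%:num%:E * P ((fun w => (U w, W w)) @^-1` D))%E.
Proof.
move=> mU mW mE rect; set Z := fun w => (U w, W w).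
have mZ : measurable_fun setT Z by exact: measurable_fun_pair.
pose m1 : {measure set (T1 * T2) -> \bar R} :=
  measure_function_pushforward__canonical__measure_function_Measure (mrestr P mE) mZ.
pose m2 : {measure set (T1 * T2) -> \bar R} :=
  mscale c (measure_function_pushforward__canonical__measure_function_Measure P mZ).
move=> D mD; suff : m1 D = m2 D by [].
pose C : set (set (T1 * T2)) :=
  [set K | exists A, measurable A /\ exists B, measurable B /\ K = A `*` B].
apply: (measure_unique C (fun=> setT)) => //.
- rewrite measurable_prod_measurableType; congr (<<s _ >>).
  rewrite predeqE => K; split => [[A mA [B mB <-]]|[A [mA [B [mB ->]]]]].
    by exists A; split => //; exists B.
  by exists A => //; exists B.
- move=> _ _ [X1 [mX1 [X2 [mX2 ->]]]] [Y1 [mY1 [Y2 [mY2 ->]]]].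
  rewrite -setXI; exists (X1 `&` Y1); split; first exact: measurableI.
  by exists (X2 `&` Y2); split => //; exact: measurableI.
- by move=> n; exists setT; split => //; exists setT; split => //; rewrite setXTT.
- by apply/seteqP; split => // t _; exists 0%N.
- move=> _ [A [mA [B [mB ->]]]]; exact: rect.
- move=> _; rewrite /m1 /= /pushforward /mrestr preimage_setT setTI.
  by apply: (le_lt_trans (probability_le1 P mE)); rewrite ltry.
Qed.

(** The one-dimensional scaling, applied in each variable between two uses of
    Tonelli's theorem. *)
Lemma integral_gauss2_scale {R : realType} (s : R) (phi : R * R -> R) : 0 < s ->
  measurable_fun setT phi -> (forall x, 0 <= phi x) ->
  (\int[(normal_prob (0 : R) s \x normal_prob (0 : R) s)]_z (phi z)%:E =
   \int[(normal_prob (0 : R) 1 \x normal_prob (0 : R) 1)]_z (phi (scal s z))%:E)%E.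
Proof.
move=> s0 mp p0; set N := normal_prob 0 s; set G := normal_prob 0 1.
transitivity (\int[N]_x \int[N]_y (phi (x, y))%:E)%E.
  have mE : measurable_fun setT (EFin \o phi) by exact/measurable_EFinP.
  have p0E : forall x, (0 <= (EFin \o phi) x)%E by [].
  exact: (@fubini_tonelli1 _ _ _ _ _ N N _ mE p0E).
transitivity (\int[N]_x \int[G]_y (phi (x, s * y))%:E)%E.
  apply: eq_integral => x _; apply: (integral_normal_scale (f := fun y => phi (x, y))) => //.
  exact: (measurableT_comp mp).
have msy : measurable_fun setT (fun p : R * R => (p.1, s * p.2)).
  apply: measurable_fun_pair => //; apply: measurable_realfun.measurable_funM => //.
transitivity (\int[G]_y \int[N]_x (phi (x, s * y))%:E)%E.
  pose psi (p : R * R) := (phi (p.1, s * p.2))%:E.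
  have mE : measurable_fun setT psi.
    by apply/measurable_EFinP; exact: (measurableT_comp mp msy).
  have p0E x : (0 <= psi x)%E by rewrite lee_fin.
  exact: (@fubini_tonelli _ _ _ _ _ N G _ mE p0E).
transitivity (\int[G]_y \int[G]_x (phi ((s * x)%R, (s * y)%R))%:E)%E.
  apply: eq_integral => y _.
  apply: (integral_normal_scale (f := fun x => phi (x, s * y))) => //.
  exact: (measurableT_comp mp).
pose psi (z : R * R) := (phi (scal s z))%:E.
have mE : measurable_fun setT psi.
  by apply/measurable_EFinP; apply: (measurableT_comp mp); exact: measurable_fun_scal.
have p0E z : (0 <= psi z)%E by rewrite lee_fin.
exact/esym/(@fubini_tonelli2 _ _ _ _ _ G G _ mE p0E).
Qed.

Section chain.
Context {R : realType} d (T : measurableType d) (P : probability T R).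
Variables (N1 N2 : nat -> {RV P >-> R}) (dt : R).
Hypotheses (dt_gt0 : 0 < dt) (noise : gaussian_noise dt N1 N2).
Variables (f g : R -> R) (sigma : R) (x0 : R * R).
Hypotheses (tf : tfun (fun x => f x.2)) (tg : tfun (fun x => g x.1)).

Let idx (i : nat + nat) : nat := match i with inl k => k | inr k => k end.

Let NN (i : nat + nat) : {RV P >-> R} := match i with inl k => N1 k | inr k => N2 k end.

(** With lists the product rule of independence is a recursion, one factor for
    each entry. *)
Fixpoint noise_event (L : seq ((nat + nat) * set R)) : set T :=
  if L is p :: L' then (NN p.1 @^-1` p.2) `&` noise_event L' else setT.

Fixpoint noise_prob (L : seq ((nat + nat) * set R)) : \bar R :=
  if L is p :: L' then (P (NN p.1 @^-1` p.2) * noise_prob L')%E else 1%E.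

(** The indices are pairwise distinct and belong to times at least n. *)
Fixpoint noise_from (n : nat) (L : seq ((nat + nat) * set R)) : Prop :=
  if L is p :: L' then
    [/\ measurable p.2, (n <= idx p.1)%N, p.1 \notin map fst L' & noise_from n L']
  else True.

Let measurable_preimage i (B : set R) : measurable B -> measurable (NN i @^-1` B).
Proof. by move=> mB; rewrite -[X in measurable X]setTI; exact: measurable_funP. Qed.

Lemma measurable_noise_event n L : noise_from n L -> measurable (noise_event L).
Proof.
elim: L => [_|p L IH] /=; first exact: measurableT.
move=> [mp _ _ /IH mL].
by apply: measurableI => //; exact: measurable_preimage.
Qed.

Lemma noise_fromW n L : noise_from n.+1 L -> noise_from n L.
Proof. by elim: L => [//|p L IH] /= [mp /ltnW np pL /IH]. Qed.

Lemma noise_from_notin n i L : noise_from n.+1 L -> idx i = n -> i \notin map fst L.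
Proof.
elim: L => [//|p L IH] /= [_ np _ hL] ni; rewrite inE negb_or IH// andbT.
by apply: contraTneq np => <-; rewrite ni ltnn.
Qed.

Lemma noise_prob_fin n L : noise_from n L -> exists c : {nonneg R}, noise_prob L = c%:num%:E.
Proof.
elim: L => [_|p L IH] /=; first by exists 1%:nng.
move=> [mp _ _ /IH[c ->]]; have h := fin_num_measure P _ (measurable_preimage p.1 mp).
have q0 : 0 <= fine (P (NN p.1 @^-1` p.2)) * c%:num by rewrite mulr_ge0// fine_ge0.
exists (NngNum q0) => /=.
by rewrite EFinM fineK.
Qed.

Lemma noise_eventE n L : noise_from n L -> P (noise_event L) = noise_prob L.
Proof.
move=> hL; have [_ _ indep] := noise.
suff [B [mB EB PB]] : exists B : nat + nat -> set R, [/\ forall i, measurable (B i),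
    noise_event L = \bigcap_(i in [set` map fst L]) (NN i @^-1` B i) &
    noise_prob L = (\prod_(i <- map fst L) P (NN i @^-1` B i))%E].
  rewrite EB PB; apply: indep => //.
  by elim: L hL {EB PB} => [//|p L IH] /= [_ _ -> /IH].
elim: L hL => [_|[i b] L IH] /=.
  exists (fun=> setT); split=> //; last by rewrite big_nil.
  by rewrite set_nil bigcap_set0.
move=> [mb _ iL /IH[B [mB EB PB]]].
exists (fun j => if j == i then b else B j); split.
- by move=> j; case: ifP.
- have -> : [set` i :: map fst L] = i |` [set` map fst L].
    by apply/seteqP; split => j /= h; apply/predU1P; move: h; rewrite ?inE.
  rewrite EB bigcap_setU1 eqxx; congr (_ `&` _).
  apply: eq_bigcapr => j /= jL; case: eqP => // ji.
  by move: iL; rewrite -ji jL.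
- rewrite PB big_cons eqxx; congr (_ * _)%E; apply: eq_big_seq => j jL.
  by case: eqP => // ji; move: iL; rewrite -ji jL.
Qed.

Let X n w := scheme f g sigma dt x0 (N1 ^~ w) (N2 ^~ w) n.

Let W n w : R * R := (N1 n w, N2 n w).

Let next (p : (R * R) * (R * R)) : R * R := drift f g dt p.1 + scal sigma p.2.

Let measurable_next : measurable_fun setT next.
Proof.
apply: measurable_fun_pairD.
  exact: (measurableT_comp (measurable_drift dt tf tg) measurable_fst).
exact: (measurable_fun_scal sigma measurable_snd).
Qed.

Let measurable_W n : measurable_fun setT (W n).
Proof. by apply: measurable_fun_pair; exact: measurable_funP. Qed.

Lemma measurable_scheme n : measurable_fun setT (X n).
Proof.
elim: n => [|n IH]; first exact: measurable_cst.
exact: (measurableT_comp measurable_next (measurable_fun_pair IH (measurable_W n))).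
Qed.

Let measurable_X_preimage n (A : set (R * R)) : measurable A -> measurable (X n @^-1` A).
Proof. by move=> mA; rewrite -[X in measurable X]setTI; exact: measurable_scheme. Qed.

Let independent_at n := forall A L, measurable A -> noise_from n L ->
  P (X n @^-1` A `&` noise_event L) = (P (X n @^-1` A) * noise_prob L)%E.

(** The pair of noises of time n ranges over arbitrary measurable sets of the
    plane, and not only over the rectangles to which independence refers. *)
Let independent_noise_pair n A D L : independent_at n -> measurable A -> measurable D ->
  noise_from n.+1 L ->
  P (X n @^-1` A `&` W n @^-1` D `&` noise_event L) =
  (P (X n @^-1` A) * P (W n @^-1` D) * noise_prob L)%E.
Proof.
move=> indep mA mD hL; have [c cE] := noise_prob_fin hL.
have pairL B C L0 : measurable B -> measurable C -> noise_from n.+1 L0 ->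
    noise_from n ((inl n, B) :: (inr n, C) :: L0).
  move=> mB mC h0; split => //=.
    by rewrite inE negb_or /=; exact: noise_from_notin h0 _.
  by split => //; [exact: noise_from_notin h0 _|exact: noise_fromW].
have mXA := measurable_X_preimage n mA.
have q0 : 0 <= fine (P (X n @^-1` A)) * c%:num by rewrite mulr_ge0// fine_ge0.
have q0E : ((fine (P (X n @^-1` A)) * c%:num)%:E = P (X n @^-1` A) * noise_prob L)%E.
  by rewrite EFinM fineK ?cE// fin_num_measure.
have mE : measurable (X n @^-1` A `&` noise_event L).
  by apply: measurableI => //; exact: measurable_noise_event hL.
have mN1 : measurable_fun setT (N1 n) by exact: measurable_funP.
have mN2 : measurable_fun setT (N2 n) by exact: measurable_funP.
rewrite (setIC (X n @^-1` A)) -setIA.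
rewrite (rectangle_extension (c := NngNum q0) mN1 mN2 mE _ mD) /= q0E.
  by rewrite muleAC.
move=> B C mB mC; have hp := pairL B C L mB mC hL; have hp0 := pairL B C [::] mB mC I.
have -> : N1 n @^-1` B `&` N2 n @^-1` C = noise_event [:: (inl n, B); (inr n, C)].
  by rewrite /= setIT.
rewrite (noise_eventE hp0) setICA.
rewrite (_ : noise_event [:: _; _] `&` noise_event L =
  noise_event [:: (inl n, B), (inr n, C) & L]); last by rewrite /= setIT setIA.
rewrite (indep _ _ mA hp) /= mule1.
by rewrite -[RHS]muleA; congr (_ * _)%E; rewrite [RHS]muleC -[RHS]muleA.
Qed.

(** The state at time n + 1 is a function of the state and the noise at time n,
    which are jointly independent of all later noise. *)
Lemma scheme_independent n : independent_at n.
Proof.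
elim: n => [|n IH] A L mA hL.
  have [Ax|nAx] := pselect (A x0).
    rewrite (_ : X 0 @^-1` A = setT); last by apply/seteqP; split.
    by rewrite setTI probability_setT mul1e (noise_eventE hL).
  rewrite (_ : X 0 @^-1` A = set0); last by apply/seteqP; split.
  by rewrite set0I measure0 mul0e.
have mE := measurable_noise_event hL; have [c cE] := noise_prob_fin hL.
have mnA : measurable (next @^-1` A) by rewrite -[X in measurable X]setTI; exact: measurable_next.
rewrite (rectangle_extension (c := c) (measurable_scheme n) (measurable_W n) mE _ mnA).
  by rewrite -cE muleC.
move=> A0 D mA0 mD; rewrite -cE.
rewrite (independent_noise_pair IH mA0 mD hL) muleC; congr (_ * _)%E.
have := independent_noise_pair IH mA0 mD (I : noise_from n.+1 [::]).
by rewrite /= setIT mule1.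
Qed.

Local Notation gauss_dt := (normal_prob (0 : R) (Num.sqrt dt)).

Let law_W n D : measurable D -> P (W n @^-1` D) = (gauss_dt \x gauss_dt)%E D.
Proof.
move=> mD; have [law1 law2 _] := noise.
pose mW : @measurable_fun _ _ T (measurableTypeR R * measurableTypeR R)%type setT (W n) :=
  measurable_W n.
pose m : {measure set (measurableTypeR R * measurableTypeR R) -> \bar R} :=
  measure_function_pushforward__canonical__measure_function_Measure P mW.
apply/esym; apply: (product_measure_unique (m' := m)) => // B C mB mC.
have h : noise_from n [:: (inl n, B); (inr n, C)] by split => //=; rewrite ?inE.
transitivity (P (noise_event [:: (inl n, B); (inr n, C)])).
  by rewrite /m /= /pushforward setIT.
by rewrite (noise_eventE h) /= mule1; congr (_ * _)%E; [exact: law1|exact: law2].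
Qed.

Let Z n w := (X n w, W n w).

Let measurable_Z n : measurable_fun setT (Z n).
Proof. by apply: measurable_fun_pair; [exact: measurable_scheme|exact: measurable_W]. Qed.

Let expect_Z n (h : (R * R) * (R * R) -> \bar R) : measurable_fun setT h ->
  (forall p, 0 <= h p)%E ->
  (\int[P]_w h (Z n w) = \int[P]_w \int[(gauss_dt \x gauss_dt)]_z h (X n w, z))%E.
Proof.
move=> mh h0.
pose G2 : probability (measurableTypeR R * measurableTypeR R)%type R := (gauss_dt \x gauss_dt)%E.
pose X_RV : {RV P >-> (R * R)%type} :=
  HB.pack_for {mfun T >-> (R * R)%type} (X n) (isMeasurableFun.Build _ _ _ _ _ (measurable_scheme n)).
pose muX : probability (R * R)%type R := distribution P X_RV.
pose TZ := ((R * R) * (measurableTypeR R * measurableTypeR R))%type.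
pose mZ : @measurable_fun _ _ T TZ setT (Z n) := measurable_Z n.
pose m : {measure set TZ -> \bar R} :=
  measure_function_pushforward__canonical__measure_function_Measure P mZ.
transitivity (\int[m]_p h p)%E.
  by rewrite ge0_integral_pushforward.
transitivity (\int[(muX \x G2)%E]_p h p)%E.
  apply: eq_measure_integral => D mD _; apply/esym.
  apply: (product_measure_unique (m' := m)) => // A B mA mB.
  rewrite /m /= /pushforward /= -(law_W n mB).
  have := independent_noise_pair (@scheme_independent n) mA mB (I : noise_from n.+1 [::]).
  by rewrite /= setIT mule1.
transitivity (\int[muX]_x \int[G2]_y h (x, y))%E.
  exact: fubini_tonelli1.
rewrite ge0_integral_pushforward//.
- exact: measurable_fun_fubini_tonelli_F.
- by move=> x _; exact: integral_ge0.
Qed.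

(** Markov property: the noise of a step is independent of the present state. *)
Lemma expect_step n (phi : R * R -> R) : measurable_fun setT phi -> (forall x, 0 <= phi x) ->
  (\int[P]_w (phi (X n.+1 w))%:E =
   \int[P]_w \int[(normal_prob (0 : R) 1 \x normal_prob (0 : R) 1)]_z
     (phi (drift f g dt (X n w) + scal (sigma * Num.sqrt dt) z))%:E)%E.
Proof.
move=> mp p0.
have mpn : measurable_fun setT (fun p => phi (next p)) by exact: (measurableT_comp mp).
have mE : measurable_fun setT (fun p => (phi (next p))%:E) by exact/measurable_EFinP.
have p0E p : (0 <= (phi (next p))%:E)%E by rewrite lee_fin.
apply: (etrans (expect_Z n mE p0E)); apply: eq_integral => w _.
have mw : measurable_fun setT (fun z => phi (next (X n w, z))).
  exact: (measurableT_comp mpn).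
have sdt : 0 < Num.sqrt dt by rewrite sqrtr_gt0.
apply: (etrans (integral_gauss2_scale sdt mw (fun z => p0 _))); apply: eq_integral => z _.
by congr (phi (_ + _))%:E; rewrite /scal /= !mulrA.
Qed.

End chain.

(** * Linear growth of the mean square displacement *)

Lemma cvg_div_linear {R : realType} (a : nat -> R) (m dt : R) : 0 < dt ->
  (forall e, 0 < e -> exists K, forall n, `|a n - n%:R * m| <= e * n%:R + K) ->
  (fun n => a n * (n%:R * dt)^-1) @ \oo --> m / dt.
Proof.
move=> dt0 growth; apply/cvgrPdist_le => e e0.
have e2 : 0 < e * dt / 2 by rewrite divr_gt0// mulr_gt0.
have [K hK] := growth _ e2.
near=> n.
have n1 : 1 <= n%:R :> R by near: n; exact: nbhs_infty_ger.
have nK : K / (e * dt / 2) <= n%:R by near: n; exact: nbhs_infty_ger.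
have n0 : 0 < n%:R :> R by apply: lt_le_trans n1.
have nd : 0 < n%:R * dt by rewrite mulr_gt0.
have -> : m / dt - a n / (n%:R * dt) = - (a n - n%:R * m) / (n%:R * dt).
  move: (a n) n%:R n0 dt0 => p q q0 d0; field.
  by rewrite !gt_eqF.
rewrite normrM normrN normfV (gtr0_norm nd) ler_pdivrMr//.
apply: (le_trans (hK n)); move: nK; rewrite ler_pdivrMr// => nK.
have -> : e * (n%:R * dt) = e * dt / 2 * n%:R + n%:R * (e * dt / 2).
  by move: (n%:R : R) => q; field.
by rewrite lerD2l.
Unshelve. all: by end_near.
Qed.

(** Young's inequality. *)
Lemma sqr_le_of_close {R : realType} (u v B e : R) : 0 < e -> `|u - v| <= B ->
  u ^+ 2 <= (1 + e) * v ^+ 2 + (1 + e^-1) * B ^+ 2.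
Proof.
move=> e0 h; have -> : u = v + (u - v) by rewrite addrC subrK.
move: (u - v) h => b hb.
have b2 : b ^+ 2 <= B ^+ 2 by rewrite -(real_normK (num_real b)) lerXn2r// nnegrE (le_trans _ hb).
have ei0 : 0 < e^-1 by rewrite invr_gt0.
have h1 : 2 * (v * b) <= e * v ^+ 2 + e^-1 * b ^+ 2.
  have := sqr_ge0 (e * v - b); rewrite -(pmulr_rge0 _ ei0).
  have -> : e^-1 * (e * v - b) ^+ 2 = e * v ^+ 2 + e^-1 * b ^+ 2 - 2 * (v * b).
    by field; rewrite gt_eqF.
  by rewrite subr_ge0.
have h2 : (1 + e^-1) * b ^+ 2 <= (1 + e^-1) * B ^+ 2 by rewrite ler_wpM2l// addr_ge0// ltW.
have -> : (v + b) ^+ 2 = v ^+ 2 + 2 * (v * b) + b ^+ 2 by ring.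
move: h1 h2; move: (v * b) (v ^+ 2) (b ^+ 2) (B ^+ 2) => p q r t h1 h2.
by move: h1 h2; rewrite !mulrDl !mul1r; lra.
Qed.

Section second_moment.
Context {R : realType} d (T : measurableType d) (P : probability T R).

Lemma expect_sqr_le_of_close (U V : T -> R) (b B e : R) :
  measurable_fun setT U -> measurable_fun setT V -> 0 < e ->
  (forall w, `|U w - V w| <= B) ->
  (\int[P]_w (V w ^+ 2)%:E = b%:E)%E ->
  (\int[P]_w (U w ^+ 2)%:E <= ((1 + e) * b + (1 + e^-1) * B ^+ 2)%:E)%E.
Proof.
move=> mU mV e0 UV Vb.
have mU2 : measurable_fun setT (fun w => (U w ^+ 2)%:E).
  by apply/measurable_EFinP; exact: measurable_realfun.measurable_funX.
have mV2 : measurable_fun setT (fun w => (V w ^+ 2)%:E).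
  by apply/measurable_EFinP; exact: measurable_realfun.measurable_funX.
have e1 : 0 <= 1 + e by rewrite addr_ge0// ltW.
have C0 : 0 <= (1 + e^-1) * B ^+ 2 by rewrite mulr_ge0 ?sqr_ge0// addr_ge0// invr_ge0 ltW.
set C := (1 + e^-1) * B ^+ 2.
have mV2e : measurable_fun setT (fun w => (1 + e)%:E * (V w ^+ 2)%:E)%E.
  by apply: measurable_funeM.
have V2e0 w : (0 <= (1 + e)%:E * (V w ^+ 2)%:E)%E by rewrite -EFinM lee_fin mulr_ge0// sqr_ge0.
apply: (@le_trans _ _ (\int[P]_w ((1 + e)%:E * (V w ^+ 2)%:E + C%:E))%E).
{ apply: ge0_le_integral => //.
  - by move=> w _; rewrite lee_fin sqr_ge0.
  - by apply: emeasurable_funD => //; exact: measurable_cst.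
  - by move=> w _; rewrite -EFinM -EFinD lee_fin; exact: sqr_le_of_close. }
rewrite ge0_integralD//.
rewrite ge0_integralZl_EFin//; last by move=> w _; rewrite lee_fin sqr_ge0.
by rewrite Vb integral_cst// [X in (C%:E * X)%E](@probability_setT _ _ _ P) mule1 -EFinM -EFinD.
Qed.

Variables (N1 N2 : nat -> {RV P >-> R}) (dt : R).
Hypotheses (dt_gt0 : 0 < dt) (noise : gaussian_noise dt N1 N2).
Variables (f g : R -> R) (sigma : R) (x0 : R * R).
Hypotheses (tf : tfun (fun x => f x.2)) (tg : tfun (fun x => g x.1)).
Hypothesis sigma_gt0 : 0 < sigma.

Let s := sigma * Num.sqrt dt.

Let s_gt0 : 0 < s. Proof. by rewrite mulr_gt0// sqrtr_gt0. Qed.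

Let X n w := scheme f g sigma dt x0 (N1 ^~ w) (N2 ^~ w) n.

Let mX n : measurable_fun setT (X n).
Proof. exact: measurable_scheme. Qed.

(** Nonnegativity lets Tonelli's theorem apply at each step. *)
Lemma expect_iter n phi : tfun phi -> (forall x, 0 <= phi x) ->
  (\int[P]_w (phi (X n w))%:E = (iter n (transition f g s dt) phi x0)%:E)%E.
Proof.
elim: n phi => [|n IH] phi tp p0.
  rewrite -[LHS]/(\int[P]_w (phi x0)%:E)%E.
  by rewrite integral_cst// [X in (_ * X)%E](@probability_setT _ _ _ P) mule1.
apply: (etrans (expect_step dt_gt0 noise sigma x0 tf tg n tp.1.1 p0)).
have tPp := tfun_transition s dt tf tg tp.
have Pp0 x : 0 <= transition f g s dt phi x by apply: Rintegral_ge0.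
rewrite iterSr -(IH _ tPp Pp0).
apply: eq_integral => w _; rewrite bmeas_int_EFin//.
exact: bmeas_heat_integrand tp.1.
Qed.

Variable c : R * R -> R.
Hypotheses (tc : tfun c)
  (Pc : forall x, transition f g s dt c x = c x + dt * f x.2).

Let h := increment_variance f g s dt c.

Let V x := x.1 + c x.

Let mV : measurable_fun setT V.
Proof. by apply: measurable_realfun.measurable_funD => //; exact: tc.1.1. Qed.

Let b n := V x0 ^+ 2 + \sum_(k < n) iter k (transition f g s dt) h x0.

(** Squares of martingales grow by the conditional variances. *)
Lemma expect_corrected_square n : (\int[P]_w (V (X n w) ^+ 2)%:E = (b n)%:E)%E.
Proof.
have th : tfun h by exact: tfun_increment_variance.
have h0 x : 0 <= h x by exact: increment_variance_ge0.
have mV2 : measurable_fun setT (fun x => V x ^+ 2).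
  exact: measurable_realfun.measurable_funX.
have V20 x : 0 <= V x ^+ 2 by exact: sqr_ge0.
elim: n => [|n IH].
  rewrite /b big_ord0 addr0 -[LHS]/(\int[P]_w (V x0 ^+ 2)%:E)%E.
  by rewrite integral_cst// [X in (_ * X)%E](@probability_setT _ _ _ P) mule1.
apply: (etrans (expect_step dt_gt0 noise sigma x0 tf tg n mV2 V20)).
transitivity (\int[P]_w ((V (X n w) ^+ 2)%:E + (h (X n w))%:E))%E.
  by apply: eq_integral => w _; exact: corrector_second_moment.
rewrite ge0_integralD//.
- by rewrite IH (expect_iter n th h0) -EFinD /b big_ord_recr /= addrA.
- by move=> w _; rewrite lee_fin.
- by apply/measurable_EFinP; exact: (measurableT_comp mV2 (mX n)).
- by move=> w _; rewrite lee_fin.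
- by apply/measurable_EFinP; exact: (measurableT_comp th.1.1 (mX n)).
Qed.

Let m := \int[(uniform_prob (@ltr01 R) \x uniform_prob (@ltr01 R))%E]_x h x.

(** The chain mixes geometrically, so the conditional variances add up to n
    times their mean over the torus, up to a bounded error. *)
Lemma corrected_square_growth : exists2 D, 0 <= D & forall n, `|b n - n%:R * m| <= D.
Proof.
have th : tfun h by exact: tfun_increment_variance.
have [M hM] := iter_transition_mixing dt tf tg s_gt0 th.
have r01 := doeblin_rate_itv s_gt0; have /andP[r0 r1] := r01.
pose a k := iter k (transition f g s dt) h x0 - m.
have [l hl] := geometric_sum_limit (a := a) r01 (fun k => hM k x0).
have M0 : 0 <= M by have := hM 0%N x0; rewrite expr0 mulr1; exact: le_trans.
pose L := M / (1 - doeblin_rate s).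
have L0 : 0 <= L by rewrite divr_ge0// subr_ge0 ltW.
exists (V x0 ^+ 2 + (`|l| + L)) => [|n]; first by rewrite !addr_ge0// sqr_ge0.
have -> : b n - n%:R * m = V x0 ^+ 2 + (l - (l - \sum_(k < n) a k)).
  rewrite /b /a big_split /= sumr_const card_ord -mulr_natl.
  by move: (\sum_(i < n) _) => q; ring.
apply: (le_trans (ler_normD _ _)); rewrite ger0_norm ?sqr_ge0// lerD2l.
apply: (le_trans (ler_normB _ _)); rewrite lerD2l (le_trans (hl n))//.
by rewrite ler_piMr// exprn_ile1// ltW.
Qed.

Let m_ge0 : 0 <= m.
Proof. by apply: Rintegral_ge0 => x _; exact: increment_variance_ge0. Qed.

(** Replacing V by the displacement costs a bounded amount, hence an arbitrarily
    small fraction of the mean square. *)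
Lemma mean_square_growth : exists a : nat -> R,
  (forall n, (\int[P]_w ((X n w).1 ^+ 2)%:E = (a n)%:E)%E) /\
  forall e, 0 < e -> exists K, forall n, `|a n - n%:R * m| <= e * n%:R + K.
Proof.
have [_ [B hB]] := tc.1.
have mX1 n : measurable_fun setT (fun w => (X n w).1).
  exact: (measurableT_comp measurable_fst (mX n)).
have mVX n : measurable_fun setT (fun w => V (X n w)) by exact: (measurableT_comp mV (mX n)).
have dVX n w : `|V (X n w) - (X n w).1| <= B by rewrite /V addrC addKr.
have dXV n w : `|(X n w).1 - V (X n w)| <= B by rewrite distrC.
pose I n := (\int[P]_w ((X n w).1 ^+ 2)%:E)%E.
have Ifin n : I n = (fine (I n))%:E.
  rewrite fineK// ge0_fin_numE; last by apply: integral_ge0 => w _; rewrite lee_fin sqr_ge0.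
  apply: (@le_lt_trans _ _ ((1 + 1) * b n + (1 + 1^-1) * B ^+ 2)%:E); last exact: ltry.
  exact: (expect_sqr_le_of_close (mX1 n) (mVX n) ltr01 (dXV n) (expect_corrected_square n)).
exists (fun n => fine (I n)); split=> // e e0; set a := fun n => fine (I n).
have [D D0 hD] := corrected_square_growth.
(* Small enough for q <= 1 and 2 q m <= e, hence an error of at most e n. *)
pose q := e / (2 * (m + 1) + e).
have den : 0 < 2 * (m + 1) + e by rewrite addr_gt0// mulr_gt0// ltr_wpDl.
have q0 : 0 < q by rewrite divr_gt0.
have q1 : q <= 1 by rewrite ler_pdivrMr// mul1r lerDr mulr_ge0// addr_ge0.
have qm : 2 * q * m <= e.
  have swap (x y z : R) : 2 * (x * y) * z = x * (2 * z) * y by ring.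
  rewrite /q swap ler_pdivrMr// ler_pM2l// mulrDr -addrA lerDl.
  by rewrite addr_ge0// ltW.
pose C := (1 + q^-1) * B ^+ 2.
have C0 : 0 <= C by rewrite mulr_ge0 ?sqr_ge0// addr_ge0// invr_ge0 ltW.
have up n : a n <= (1 + q) * b n + C.
  have := expect_sqr_le_of_close (mX1 n) (mVX n) q0 (dXV n) (expect_corrected_square n).
  by rewrite -/(I n) Ifin lee_fin.
have lo n : b n <= (1 + q) * a n + C.
  have := expect_sqr_le_of_close (mVX n) (mX1 n) q0 (dVX n) (Ifin n).
  by rewrite expect_corrected_square lee_fin.
exists (3 * D + 2 * C) => n; rewrite -/(a n); have := hD n; have := up n; have := lo n.
have n0 : 0 <= n%:R :> R by exact: ler0n.
move: (a n) (b n) (n%:R : R) n0 => x y t t0 yx xy /ler_normlP[y1 y2].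
apply/ler_normlP.
pose z := q * (t * m).
have z0 : 0 <= z by apply: mulr_ge0; [exact: ltW|exact: mulr_ge0].
have zt : 2 * z <= e * t.
  have -> : 2 * z = 2 * q * m * t by rewrite /z; move: (m) => p; ring.
  by rewrite ler_wpM2r.
have qD : q * D <= D by rewrite ler_piMl.
have qC : q * C <= C by rewrite ler_piMl.
have qy : q * y <= z + D.
  apply: (@le_trans _ _ (z + q * D)); last by rewrite lerD2l.
  by rewrite /z -mulrDr ler_pM2l// addrC -lerBlDr.
have qx : q * x <= 2 * (z + D) + C.
  apply: (@le_trans _ _ (q * ((1 + q) * y + C))); first by rewrite ler_pM2l.
  rewrite mulrDr lerD// mulrCA; apply: (@le_trans _ _ ((1 + q) * (z + D))).
    by rewrite ler_wpM2l// addr_ge0// ltW.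
  by rewrite ler_wpM2r ?addr_ge0// -[2]/(1 + 1 : R) lerD2l.
move: xy yx; rewrite !mulrDl !mul1r => xy yx.
move: y1 y2 zt qy qx xy yx D0 C0 {z0}.
move: (t * m) (q * y) (q * x) (e * t) z => tm qy' qx' et z' ? ? ? ? ? ? ? ? ?.
by split; lra.
Qed.

End second_moment.

(** * Diffusivity of the scheme driven by a separable Hamiltonian *)

Lemma derive_hamiltonian1 {R : realType} (F G : R -> R) x :
  'D_e1 (hamiltonian F G) x = derive1 G x.1.
Proof.
rewrite derive1E /derive.
rewrite (_ : (fun h : R => _) = (fun h : R => h^-1 *: ((G \o shift x.1) h%:A - G x.1)))//.
apply/funext => h /=; congr (_ *: _).
rewrite /hamiltonian /= /shift /= /e1 /GRing.scale /= /scale_pair /=.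
by rewrite mulr0 add0r opprD addrACA subrr add0r.
Qed.

Lemma derive_hamiltonian2 {R : realType} (F G : R -> R) x :
  'D_e2 (hamiltonian F G) x = derive1 F x.2.
Proof.
rewrite derive1E /derive.
rewrite (_ : (fun h : R => _) = (fun h : R => h^-1 *: ((F \o shift x.2) h%:A - F x.2)))//.
apply/funext => h /=; congr (_ *: _).
rewrite /hamiltonian /= /shift /= /e2 /GRing.scale /= /scale_pair /=.
by rewrite mulr0 add0r opprD addrACA subrr addr0.
Qed.

Theorem theorem4p7 (R : realType) (F G : R -> R) (sigma : R)
    (x0 : R * R) (chi1 : R * R -> R)
    (H_smooth : smooth (hamiltonian F G))
    (H_periodic : torus_fun (hamiltonian F G))
    (sigma_gt0 : 0 < sigma)
    (chi1_cell : cell_solution (derive1 F) (derive1 G) sigma chi1) :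
  exists C delta : R, [/\ 0 < C, 0 < delta &
    forall dt : R, 0 < dt -> dt < delta ->
    forall (d : measure_display) (T : measurableType d) (P : probability T R)
      (N1 N2 : nat -> {RV P >-> R}), gaussian_noise dt N1 N2 ->
    exists l : R,
      ((fun n : nat =>
         ('E_P[fun w => ((scheme (derive1 F) (derive1 G) sigma dt x0
                          (fun k => N1 k w) (fun k => N2 k w) n).1 ^+ 2)%R]
         * ((n%:R * dt)^-1)%:E)%E) @ \oo --> l%:E) /\
      `|l - (sigma ^+ 2 - 2 * torus_integral (fun x => chi1 x * derive1 F x.2))|
        <= C * dt].
Proof.
have [chi_smooth chi_torus _ chi_eq] := chi1_cell.
have sH : smooth_torus (hamiltonian F G) by [].
have sf : smooth_torus (fun x => derive1 F x.2).
  by rewrite -(funext (derive_hamiltonian2 F G)); exact: (smooth_torus_pd false sH).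
have sg : smooth_torus (fun x => derive1 G x.1).
  by rewrite -(funext (derive_hamiltonian1 F G)); exact: (smooth_torus_pd true sH).
have schi : smooth_torus chi1 by [].
have f0 : \int[(uniform_prob (@ltr01 R) \x uniform_prob (@ltr01 R))%E]_x derive1 F x.2 = 0.
  by have := unif_pd false sH; rewrite -(funext (derive_hamiltonian2 F G)).
have [C C0 hC] := effective_diffusivity sf sg schi sigma_gt0 f0 chi_eq.
exists C, 1; split => // dt dt0 dt1 d T P N1 N2 noise.
have dt01 : 0 < dt < 1 by rewrite dt0.
have [c [tc Pc herr]] := hC dt dt01.
have tf := smooth_torus_tfun sf; have tg := smooth_torus_tfun sg.
have [a [aE a_growth]] := mean_square_growth dt0 noise x0 tf tg sigma_gt0 tc Pc.
eexists; split; last first.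
  rewrite torus_integralE; last first.
    exact: (tfunM (smooth_torus_tfun schi) tf).1.
  exact: herr.
rewrite (_ : (fun n => _) = (fun n => (a n * (n%:R * dt)^-1)%:E)).
  by apply: cvg_EFin; [near=> n|exact: cvg_div_linear].
by apply/funext => n; rewrite unlock aE -EFinM.
Unshelve. all: by end_near.
Qed.
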